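(* Let $\mathcal X=(\mathcal X_1,\mathcal X_2,\mu,\partial)$ be a finite crossed module with vacuum object $\underline{\mathbf 0}$, a commutative algebra in $\mathcal M(\mathcal X)$ with multiplication $m$. Then the induction functor $$\mathrm{Ind}_{\underline{\mathbf 0}}:\mathcal M(\mathcal X)\to\overline{\mathcal M(\mathcal X)}:=\underline{\mathbf 0}\text{-}\mathrm{Mod}_{\mathcal M(\mathcal X)},\qquad X\mapsto(\underline{\mathbf 0}\otimes X,\ m\otimes\mathrm{id}_X)$$ is a modularization of $\mathcal M(\mathcal X)$.
   Context: Throughout, $k$ is an algebraically closed field of characteristic zero. Crossed modules. A finite crossed module $\mathcal X=(\mathcal X_1,\mathcal X_2,\mu,\partial)$ consists of finite groups $\mathcal X_1,\mathcal X_2$, a right action $\mu$ of $\mathcal X_1$ on $\mathcal X_2$ by group automorphisms, written $\mu(m,g)=m^g$, and a group homomorphism (boundary map) $\partial:\mathcal X_2\to\mathcal X_1$ with $\partial(m^g)=g^{-1}(\partial m)g$ and $m^{\partial n}=n^{-1}mn$ for all $m,n\in\mathcal X_2$, $g\in\mathcal X_1$. Put $K=\ker\partial$ (central in $\mathcal X_2$), $I=\mathrm{Im}\,\partial$ (normal in $\mathcal X_1$), $C=\mathrm{coker}\,\partial=\mathcal X_1/I$. The category $\mathcal M(\mathcal X)$. Objects are triples $(V,P,Q)$: a finite-dimensional $\mathcal X_2$-graded $k$-vector space $V=\bigoplus_{m\in\mathcal X_2}V_m$, where $P(m)$ is the projection to $V_m$, with an action $Q:\mathcal X_1\to\mathrm{Aut}(V)$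 such that $P(m)Q(g)=Q(g)P(m^g)$ for all $m\in\mathcal X_2,g\in\mathcal X_1$. Morphisms are linear maps preserving grading and action. Tensor product: that of vector spaces, with $(V\otimes W)_m=\bigoplus_{nl=m}V_n\otimes W_l$ and diagonal action. Braiding: $R_{VW}(v\otimes w)=\sum_{m\in\mathcal X_2}Q_W(\partial m)w\otimes P_V(m)v$. Duals: $(V^* )_m=(V_{m^{-1}})^*$, $Q^*(g)=Q(g^{-1})^*$, with the evaluations and coevaluations of finite-dimensional vector spaces. The twist is $\theta_V=\sum_m Q_V(\partial m)P_V(m)$. With this structure $\mathcal M(\mathcal X)$ is a premodular category. The vacuum object $\underline{\mathbf 0}$: the vector space $k[K]\otimes k(C)$ with basis $x\otimes\delta_{Iy}$ ($x\in K$, $Iy\in C$), with $P(m)(x\otimes\delta_{Iy})=\delta(m^y,x)\,(x\otimes\delta_{Iy})$ and $Q(g)(x\otimes\delta_{Iy})=x\otimes\delta_{Igy}$. It is a transparent object and a commutative algebra in $\mathcal M(\mathcal X)$ with multiplication $(x\otimes\delta_{Iy})\cdot(\tilde x\otimes\delta_{I\tilde y})=\delta(Iy,I\tilde y)\,(x\tilde x\otimes\delta_{I\tilde y})$ and unit $\sum_{Iy\in C}1\otimes\delta_{Iy}$ (moreover a special symmetric Frobenius algebra). Modules. For a commutative algebra $A$ in a braided tensor category $\mathcal C$ (here $A=\underline{\mathbf 0}$, $\mathcal C=\mathcal M(\mathcal X)$), $A\text{-}\mathrm{Mod}_{\mathcal C}$ is the category of left $A$-modules $(M,\rho_M)$ in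 $\mathcal C$, with tensor product $M\otimes_AN=\mathrm{coker}\big((\rho_M\circ R_{M,A})\otimes\mathrm{id}_N-\mathrm{id}_M\otimes\rho_N\big)$ and unit $A$. For $A=\underline{\mathbf 0}$ the braiding and twist of $\underline{\mathbf 0}\text{-}\mathrm{Mod}$ are those induced by the braiding and twist of $\mathcal M(\mathcal X)$, and duals are the dual objects with the dual module structure. Premodular and modular categories. A premodular category over $k$ is an abelian, $k$-linear, semisimple ribbon category $\mathcal C$ with tensor product linear in each variable, $\mathrm{End}(\mathbf 1)=k$, and finitely many isomorphism classes of simple objects, indexed by a set $\Lambda_{\mathcal C}$. It is modular if the matrix $s_{XY}=\mathrm{tr}(R_{YX}\circ R_{XY})$, $X,Y\in\Lambda_{\mathcal C}$, is invertible. A functor $F:\mathcal C\to\mathcal C'$ is dominant if every object $X$ of $\mathcal C'$ is a retract of some $F(Y)$, i.e. there are $\iota:X\to F(Y)$, $\pi:F(Y)\to X$ with $\pi\iota=\mathrm{id}_X$. A modularization of a premodular category $\mathcal C$ is a dominant ribbon functor $F:\mathcal C\to\mathcal C'$ with $\mathcal C'$ a modular tensor category. *)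

(* Defs.v *)
From HB Require Import structures.
From mathcomp Require Import all_boot all_order all_fingroup all_algebra.

Set Implicit Arguments.
Unset Strict Implicit.
Unset Printing Implicit Defensive.

Import GRing.Theory.
Local Open Scope ring_scope.

Declare Scope cat_scope.
Delimit Scope cat_scope with cat.
Local Open Scope cat_scope.

(* k-linear categories: Mor-spaces are k-modules and composition is bilinear. *)
Record category (k : fieldType) := Category {
  Obj :> Type;
  Mor : Obj -> Obj -> lmodType k;
  idm : forall X, Mor X X;
  mcomp : forall X Y Z, Mor Y Z -> Mor X Y -> Mor X Z;
  mcompA : forall X Y Z T (h : Mor Z T) (g : Mor Y Z) (f : Mor X Y),
    mcomp h (mcomp g f) = mcomp (mcomp h g) f;
  mcomp1m : forall X Y (f : Mor X Y), mcomp (idm Y) f = f;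
  mcompm1 : forall X Y (f : Mor X Y), mcomp f (idm X) = f;
  mcomp_linl : forall X Y Z (f : Mor X Y), linear (fun g : Mor Y Z => mcomp g f);
  mcomp_linr : forall X Y Z (g : Mor Y Z), linear (fun f : Mor X Y => mcomp g f)
}.

Arguments Mor {k c}.
Arguments idm {k c} X.
Arguments mcomp {k c X Y Z} g f.
Notation "g ∘ f" := (mcomp g f) (at level 40, left associativity) : cat_scope.

Section Abelian.
Variables (k : fieldType) (C : category k).

Definition is_iso (X Y : C) (f : Mor X Y) :=
  exists g : Mor Y X, g ∘ f = idm X /\ f ∘ g = idm Y.

Definition isomorphic (X Y : C) := exists f : Mor X Y, is_iso f.

Definition is_mono (X Y : C) (f : Mor X Y) :=
  forall (Z : C) (g h : Mor Z X), f ∘ g = f ∘ h -> g = h.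

Definition is_epi (X Y : C) (f : Mor X Y) :=
  forall (Z : C) (g h : Mor Y Z), g ∘ f = h ∘ f -> g = h.

Definition is_ker (X Y K : C) (f : Mor X Y) (i : Mor K X) :=
  f ∘ i = 0 /\
  forall (Z : C) (g : Mor Z X), f ∘ g = 0 -> exists! h : Mor Z K, i ∘ h = g.

Definition is_coker (X Y Q : C) (f : Mor X Y) (p : Mor Y Q) :=
  p ∘ f = 0 /\
  forall (Z : C) (g : Mor Y Z), g ∘ f = 0 -> exists! h : Mor Q Z, h ∘ p = g.

Definition is_zero (X : C) := idm X = 0.

(* X is the biproduct of the finite family S; it is a zero object if n = 0. *)
Definition is_direct_sum n (S : 'I_n -> C) (X : C) :=
  exists (i : forall a, Mor (S a) X) (p : forall a, Mor X (S a)),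
    [/\ forall a, p a ∘ i a = idm (S a),
        forall a b, a != b -> p a ∘ i b = 0
      & \sum_a (i a ∘ p a) = idm X].

Definition abelian_category :=
  [/\ forall n (S : 'I_n -> C), exists X, is_direct_sum S X,
      forall (X Y : C) (f : Mor X Y), exists (K : C) (i : Mor K X), is_ker f i,
      forall (X Y : C) (f : Mor X Y), exists (Q : C) (p : Mor Y Q), is_coker f p,
      forall (X Y : C) (f : Mor X Y), is_mono f ->
        exists (Z : C) (g : Mor Y Z), is_ker g f
    & forall (X Y : C) (f : Mor X Y), is_epi f ->
        exists (Z : C) (g : Mor Z X), is_coker g f].

Definition simple_object (X : C) :=
  ~ is_zero X /\
  forall (Y : C) (i : Mor Y X), is_mono i -> i = 0 \/ is_iso i.

Definition semisimple_category :=
  forall X : C, exists n (S : 'I_n -> C),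
    (forall a, simple_object (S a)) /\ is_direct_sum S X.

Definition simple_representatives n (L : 'I_n -> C) :=
  [/\ forall a, simple_object (L a),
      forall a b, isomorphic (L a) (L b) -> a = b
    & forall X, simple_object X -> exists a, isomorphic X (L a)].

End Abelian.

(* Linearity of the tensor product in each variable is part of the structure. *)
Class monoidal (k : fieldType) (C : category k) := Monoidal {
  tens : C -> C -> C;
  tunit : C;
  tensm : forall X X' Y Y' : C,
    Mor X X' -> Mor Y Y' -> Mor (tens X Y) (tens X' Y');
  assoc : forall X Y Z : C, Mor (tens (tens X Y) Z) (tens X (tens Y Z));
  associ : forall X Y Z : C, Mor (tens X (tens Y Z)) (tens (tens X Y) Z);
  lunit : forall X : C, Mor (tens tunit X) X;
  runit : forall X : C, Mor (tens X tunit) X;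
  tensm1 : forall X Y : C, tensm (idm X) (idm Y) = idm (tens X Y);
  tensmM : forall (X X' X'' Y Y' Y'' : C) (f' : Mor X' X'') (f : Mor X X')
      (g' : Mor Y' Y'') (g : Mor Y Y'),
    tensm (f' ∘ f) (g' ∘ g) = tensm f' g' ∘ tensm f g;
  tensm_linl : forall (X X' Y Y' : C) (g : Mor Y Y'),
    linear (fun f : Mor X X' => tensm f g);
  tensm_linr : forall (X X' Y Y' : C) (f : Mor X X'),
    linear (fun g : Mor Y Y' => tensm f g);
  assocK : forall X Y Z : C, associ X Y Z ∘ assoc X Y Z = idm _;
  associK : forall X Y Z : C, assoc X Y Z ∘ associ X Y Z = idm _;
  lunit_iso : forall X : C, is_iso (lunit X);
  runit_iso : forall X : C, is_iso (runit X);
  assoc_nat : forall (X X' Y Y' Z Z' : C)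
      (f : Mor X X') (g : Mor Y Y') (h : Mor Z Z'),
    assoc X' Y' Z' ∘ tensm (tensm f g) h =
    tensm f (tensm g h) ∘ assoc X Y Z;
  lunit_nat : forall (X X' : C) (f : Mor X X'),
    lunit X' ∘ tensm (idm tunit) f = f ∘ lunit X;
  runit_nat : forall (X X' : C) (f : Mor X X'),
    runit X' ∘ tensm f (idm tunit) = f ∘ runit X;
  pentagon : forall W X Y Z : C,
    assoc W X (tens Y Z) ∘ assoc (tens W X) Y Z =
    tensm (idm W) (assoc X Y Z) ∘ assoc W (tens X Y) Z
      ∘ tensm (assoc W X Y) (idm Z);
  triangle : forall X Y : C,
    tensm (idm X) (lunit Y) ∘ assoc X tunit Y = tensm (runit X) (idm Y)
}.

Notation "X ⊗ Y" := (tens X Y) (at level 39, left associativity) : cat_scope.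
Notation "f ⊠ g" := (tensm f g) (at level 39, left associativity) : cat_scope.
Notation "𝟙" := tunit : cat_scope.

Class braided (k : fieldType) (C : category k) {M : monoidal C} := Braided {
  braid : forall X Y : C, Mor (X ⊗ Y) (Y ⊗ X);
  braid_iso : forall X Y : C, is_iso (braid X Y);
  braid_nat : forall (X X' Y Y' : C) (f : Mor X X') (g : Mor Y Y'),
    braid X' Y' ∘ (f ⊠ g) = (g ⊠ f) ∘ braid X Y;
  hexagonr : forall X Y Z : C,
    assoc Y Z X ∘ braid X (Y ⊗ Z) ∘ assoc X Y Z =
    (idm Y ⊠ braid X Z) ∘ assoc Y X Z ∘ (braid X Y ⊠ idm Z);
  hexagonl : forall X Y Z : C,
    associ Z X Y ∘ braid (X ⊗ Y) Z ∘ associ X Y Z =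
    (braid X Z ⊠ idm Y) ∘ associ X Z Y ∘ (idm X ⊠ braid Y Z)
}.
Arguments braided {k} C {M}.

(* The remaining half of duality (right duals) is determined by the left duals,
   the braiding and the twist. *)
Class ribbon (k : fieldType) (C : category k) {M : monoidal C}
    {B : braided C} := Ribbon {
  twist : forall X : C, Mor X X;
  twist_iso : forall X : C, is_iso (twist X);
  twist_nat : forall (X Y : C) (f : Mor X Y), twist Y ∘ f = f ∘ twist X;
  twist_tens : forall X Y : C,
    twist (X ⊗ Y) = braid Y X ∘ braid X Y ∘ (twist X ⊠ twist Y);
  ldual : C -> C;
  ev : forall X : C, Mor (ldual X ⊗ X) 𝟙;
  coev : forall X : C, Mor 𝟙 (X ⊗ ldual X);
  zigzagr : forall X : C,
    runit X ∘ (idm X ⊠ ev X) ∘ assoc X (ldual X) X ∘ (coev X ⊠ idm X) =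
    lunit X;
  zigzagl : forall X : C,
    lunit (ldual X) ∘ (ev X ⊠ idm (ldual X)) ∘ associ (ldual X) X (ldual X)
      ∘ (idm (ldual X) ⊠ coev X) = runit (ldual X);
  twist_dual : forall X : C,
    ev X ∘ (twist (ldual X) ⊠ idm X) = ev X ∘ (idm (ldual X) ⊠ twist X)
}.
Arguments ribbon {k} C {M B}.

Section Modular.
Variables (k : fieldType) (C : category k).
Context {M : monoidal C} {B : braided C} {R : ribbon C}.

Definition qtrace (X : C) (f : Mor X X) : Mor 𝟙 𝟙 :=
  ev X ∘ braid X (ldual X) ∘ ((twist X ∘ f) ⊠ idm (ldual X)) ∘ coev X.

Definition premodular :=
  [/\ abelian_category C, semisimple_category C,
      bijective (fun c : k => c *: idm (𝟙 : C))
    & exists n (L : 'I_n -> C), simple_representatives L].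

(* s a b is the trace of the double braiding of L a and L b, read in k = End(𝟙). *)
Definition modular :=
  premodular /\
  exists n (L : 'I_n -> C) (s : 'M[k]_n),
    [/\ simple_representatives L,
        forall a b, s a b *: idm (𝟙 : C) =
          qtrace (braid (L b) (L a) ∘ braid (L a) (L b))
      & s \in unitmx].

End Modular.
Arguments premodular {k} C {M}.
Arguments modular {k} C {M B R}.

Record functor (k : fieldType) (C D : category k) := Functor {
  fobj :> C -> D;
  fmap : forall X Y : C, Mor X Y -> Mor (fobj X) (fobj Y);
  fmap1 : forall X : C, fmap (idm X) = idm (fobj X);
  fmapM : forall (X Y Z : C) (g : Mor Y Z) (f : Mor X Y),
    fmap (g ∘ f) = fmap g ∘ fmap f;
  fmap_lin : forall X Y : C, linear (@fmap X Y)
}.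
Arguments fmap {k C D} F {X Y} f : rename.

Section RibbonFunctor.
Variables (k : fieldType) (C D : category k).
Context {MC : monoidal C} {BC : braided C} {RC : ribbon C}.
Context {MD : monoidal D} {BD : braided D} {RD : ribbon D}.

Record ribbon_functor (F : functor C D) := RibbonFunctor {
  rf_tens : forall X Y : C, Mor (F X ⊗ F Y) (F (X ⊗ Y));
  rf_one : Mor (𝟙 : D) (F 𝟙);
  rf_tens_iso : forall X Y, is_iso (rf_tens X Y);
  rf_one_iso : is_iso rf_one;
  rf_tens_nat : forall (X X' Y Y' : C) (f : Mor X X') (g : Mor Y Y'),
    rf_tens X' Y' ∘ (fmap F f ⊠ fmap F g) = fmap F (f ⊠ g) ∘ rf_tens X Y;
  rf_assoc : forall X Y Z : C,
    fmap F (assoc X Y Z) ∘ rf_tens (X ⊗ Y) Z ∘ (rf_tens X Y ⊠ idm (F Z)) =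
    rf_tens X (Y ⊗ Z) ∘ (idm (F X) ⊠ rf_tens Y Z) ∘ assoc (F X) (F Y) (F Z);
  rf_lunit : forall X : C,
    fmap F (lunit X) ∘ rf_tens 𝟙 X ∘ (rf_one ⊠ idm (F X)) = lunit (F X);
  rf_runit : forall X : C,
    fmap F (runit X) ∘ rf_tens X 𝟙 ∘ (idm (F X) ⊠ rf_one) = runit (F X);
  rf_braid : forall X Y : C,
    fmap F (braid X Y) ∘ rf_tens X Y = rf_tens Y X ∘ braid (F X) (F Y);
  rf_twist : forall X : C, fmap F (twist X) = twist (F X)
}.

Definition dominant (F : functor C D) :=
  forall X : D, exists (Y : C) (i : Mor X (F Y)) (p : Mor (F Y) X),
    p ∘ i = idm X.

Definition modularization (F : functor C D) :=
  [/\ premodular C, modular D, inhabited (ribbon_functor F) & dominant F].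

End RibbonFunctor.

Section Kelly.
Variables (k : fieldType) (C : category k).
Context {M : monoidal C}.

Lemma iso_epi (X Y : C) (f : Mor X Y) : is_iso f -> is_epi f.
Proof.
move=> [g [_ fg]] Z h h' e.
by rewrite -(mcompm1 h) -fg mcompA e -mcompA fg mcompm1.
Qed.

Lemma iso_mono (X Y : C) (f : Mor X Y) : is_iso f -> is_mono f.
Proof.
move=> [g [gf _]] Z h h' e.
by rewrite -(mcomp1m h) -gf -mcompA e mcompA gf mcomp1m.
Qed.

Lemma assoc_iso (X Y Z : C) : is_iso (assoc X Y Z).
Proof. by exists (associ X Y Z); split; [apply: assocK | apply: associK]. Qed.

Lemma tensm1_iso (X X' Y : C) (f : Mor X X') : is_iso f -> is_iso (f ⊠ idm Y).
Proof.
move=> [g [gf fg]]; exists (g ⊠ idm Y).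
by rewrite -!tensmM gf fg mcomp1m !tensm1.
Qed.

Lemma tens1m_inj (X Y : C) (f g : Mor X Y) :
  idm 𝟙 ⊠ f = idm 𝟙 ⊠ g -> f = g.
Proof.
by move=> e; apply: (iso_epi (lunit_iso X)); rewrite -!lunit_nat e.
Qed.

Lemma lunit_tens (X Y : C) : lunit (X ⊗ Y) ∘ assoc 𝟙 X Y = lunit X ⊠ idm Y.
Proof.
apply: tens1m_inj.
apply: (iso_epi (assoc_iso 𝟙 (𝟙 ⊗ X) Y)).
apply: (iso_epi (tensm1_iso Y (assoc_iso 𝟙 𝟙 X))).
rewrite -assoc_nat -[RHS]mcompA -tensmM mcomp1m triangle.
have -> : idm 𝟙 ⊠ (lunit (X ⊗ Y) ∘ assoc 𝟙 X Y) =
    (idm 𝟙 ⊠ lunit (X ⊗ Y)) ∘ (idm 𝟙 ⊠ assoc 𝟙 X Y).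
  by rewrite -tensmM mcomp1m.
have p := pentagon 𝟙 𝟙 X Y.
rewrite -mcompA -mcompA (mcompA (idm 𝟙 ⊠ assoc _ _ _)) -p mcompA triangle.
by rewrite -tensm1 assoc_nat.
Qed.

Lemma associ_nat (X X' Y Y' Z Z' : C)
    (f : Mor X X') (g : Mor Y Y') (h : Mor Z Z') :
  associ X' Y' Z' ∘ (f ⊠ (g ⊠ h)) = ((f ⊠ g) ⊠ h) ∘ associ X Y Z.
Proof.
apply: (iso_mono (assoc_iso _ _ _)); rewrite mcompA associK mcomp1m.
by rewrite mcompA assoc_nat -mcompA associK mcompm1.
Qed.

Lemma pentagoni (W X Y Z : C) :
  associ (W ⊗ X) Y Z ∘ associ W X (Y ⊗ Z) =
  (associ W X Y ⊠ idm Z) ∘ associ W (X ⊗ Y) Z ∘ (idm W ⊠ associ X Y Z).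
Proof.
apply: (iso_mono (assoc_iso _ _ _)); apply: (iso_mono (assoc_iso _ _ _)).
rewrite (mcompA (assoc (W ⊗ X) Y Z)) associK mcomp1m associK.
rewrite [in RHS]mcompA pentagon -!mcompA (mcompA (assoc W X Y ⊠ _)) -tensmM.
rewrite associK mcomp1m tensm1 mcomp1m (mcompA (assoc W _ Z)) associK mcomp1m.
by rewrite -tensmM mcomp1m associK tensm1.
Qed.

End Kelly.

Lemma linear_fun0 (k : fieldType) (U V : lmodType k) (f : U -> V) :
  linear f -> f 0 = 0.
Proof.
by move=> lf; have := lf (-1) 0 0; rewrite scaler0 addr0 scaleN1r addNr.
Qed.

Record comm_algebra (k : fieldType) (C : category k) {M : monoidal C}
    {B : braided C} := CommAlgebra {
  alg_obj :> C;
  alg_mul : Mor (alg_obj ⊗ alg_obj) alg_obj;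
  alg_one : Mor 𝟙 alg_obj;
  alg_mulA : alg_mul ∘ (alg_mul ⊠ idm alg_obj) =
    alg_mul ∘ (idm alg_obj ⊠ alg_mul) ∘ assoc alg_obj alg_obj alg_obj;
  alg_mul1m : alg_mul ∘ (alg_one ⊠ idm alg_obj) = lunit alg_obj;
  alg_mulm1 : alg_mul ∘ (idm alg_obj ⊠ alg_one) = runit alg_obj;
  alg_mulC : alg_mul ∘ braid alg_obj alg_obj = alg_mul
}.
Arguments comm_algebra {k} C {M B}.

Section Modules.
Variables (k : fieldType) (C : category k).
Context {MC : monoidal C} {BC : braided C}.
Variable A : comm_algebra C.

Record left_module := LeftModule {
  mod_obj :> C;
  mod_act : Mor (A ⊗ mod_obj) mod_obj;
  mod_actA : mod_act ∘ (alg_mul A ⊠ idm mod_obj) =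
    mod_act ∘ (idm A ⊠ mod_act) ∘ assoc A A mod_obj;
  mod_act1 : mod_act ∘ (alg_one A ⊠ idm mod_obj) = lunit mod_obj
}.

Definition mod_linear (M N : left_module) : {pred (Mor (c:=C) M N)} :=
  fun f => f ∘ mod_act M == mod_act N ∘ (idm A ⊠ f).
Arguments mod_linear M N f : clear implicits.

Record mod_hom (M N : left_module) := ModHom {
  mod_mor :> Mor (c:=C) M N;
  mod_morP : mod_mor \in mod_linear M N
}.

Section ModHomTheory.
Variables M N : left_module.

Lemma mod_linear_submod : submod_closed (mod_linear M N).
Proof.
split=> [|a f g].
  rewrite unfold_in; apply/eqP.
  have e0 := linear_fun0 (mcomp_linl (mod_act M) (Z := (N : C))).
  have t0 := linear_fun0 (tensm_linr (idm (A : C)) (Y := (M : C)) (Y' := (N : C))).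
  by rewrite /= in e0 t0; rewrite e0 t0 (linear_fun0 (mcomp_linr (mod_act N) (X := _))).
rewrite !unfold_in => /eqP ef /eqP eg; apply/eqP.
rewrite (mcomp_linl (mod_act M) a f g) ef eg.
by rewrite (tensm_linr (idm (A : C)) a f g) (mcomp_linr (mod_act N)).
Qed.

HB.instance Definition _ := GRing.isSubmodClosed.Build k (Mor (c:=C) M N)
  (mod_linear M N) mod_linear_submod.

HB.instance Definition _ := [isSub for @mod_mor M N].
HB.instance Definition _ := [Choice of mod_hom M N by <:].
HB.instance Definition _ := [SubChoice_isSubLmodule of mod_hom M N by <:].

End ModHomTheory.

Lemma mod_hom_eq (M N : left_module) (f g : mod_hom M N) :
  (f : Mor (c:=C) M N) = g -> f = g.
Proof. exact: val_inj. Qed.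

Lemma mod_hom_act (M N : left_module) (f : mod_hom M N) :
  f ∘ mod_act M = mod_act N ∘ (idm A ⊠ f).
Proof. exact: eqP (mod_morP f). Qed.

Fact mod_id_subproof (M : left_module) : idm (M : C) \in mod_linear M M.
Proof. by rewrite unfold_in tensm1 mcomp1m mcompm1. Qed.

Definition mod_id (M : left_module) := ModHom (mod_id_subproof M).

Fact mod_comp_subproof (M N P : left_module)
  (g : mod_hom N P) (f : mod_hom M N) : g ∘ f \in mod_linear M P.
Proof.
rewrite unfold_in -mcompA mod_hom_act mcompA mod_hom_act -mcompA -tensmM mcomp1m.
exact: eqxx.
Qed.

Definition mod_comp (M N P : left_module) (g : mod_hom N P) (f : mod_hom M N) :=
  ModHom (mod_comp_subproof g f).

Definition Mod : category k.
Proof.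
refine (@Category k left_module (fun M N => mod_hom M N) mod_id mod_comp
  _ _ _ _ _).
- by move=> *; apply: mod_hom_eq; apply: mcompA.
- by move=> *; apply: mod_hom_eq; apply: mcomp1m.
- by move=> *; apply: mod_hom_eq; apply: mcompm1.
- by move=> M N P f a g h; apply: mod_hom_eq; apply: (mcomp_linl _ a).
- by move=> M N P f a g h; apply: mod_hom_eq; apply: (mcomp_linr _ a).
Defined.

Definition regular_module : Mod :=
  LeftModule (alg_mulA A) (alg_mul1m A).

Definition free_act (X : C) : Mor (A ⊗ (A ⊗ X)) (A ⊗ X) :=
  (alg_mul A ⊠ idm X) ∘ associ A A X.

Fact free_actA (X : C) : free_act X ∘ (alg_mul A ⊠ idm (A ⊗ X)) =
  free_act X ∘ (idm A ⊠ free_act X) ∘ assoc A A (A ⊗ X).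
Proof.
apply: (iso_epi (f := associ A A (A ⊗ X))).
  by exists (assoc A A (A ⊗ X)); split; [apply: associK | apply: assocK].
rewrite -[RHS]mcompA associK mcompm1 /free_act.
have -> : idm A ⊠ ((alg_mul A ⊠ idm X) ∘ associ A A X) =
    (idm A ⊠ (alg_mul A ⊠ idm X)) ∘ (idm A ⊠ associ A A X).
  by rewrite -tensmM mcomp1m.
rewrite -tensm1 -!mcompA (mcompA (associ _ _ _) (alg_mul A ⊠ _)) associ_nat.
rewrite (mcompA (associ _ _ _) (idm A ⊠ _)) associ_nat -!mcompA pentagoni.
rewrite !mcompA -!tensmM !mcomp1m alg_mulA.
by rewrite -(mcompA _ (assoc _ _ _)) associK mcompm1.
Qed.

Fact free_act1 (X : C) :
  free_act X ∘ (alg_one A ⊠ idm (A ⊗ X)) = lunit (A ⊗ X).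
Proof.
rewrite /free_act -tensm1 -mcompA associ_nat mcompA -tensmM alg_mul1m mcomp1m.
by rewrite -lunit_tens -mcompA associK mcompm1.
Qed.

Definition free_module (X : C) : Mod :=
  LeftModule (free_actA X) (free_act1 X).

Fact free_map_subproof (X Y : C) (f : Mor X Y) :
  idm A ⊠ f \in mod_linear (free_module X) (free_module Y).
Proof.
rewrite unfold_in /= /free_act mcompA -tensmM mcomp1m mcompm1.
by rewrite -[in eqbRHS]mcompA associ_nat mcompA -tensmM tensm1 mcomp1m mcompm1.
Qed.

Definition free_map (X Y : C) (f : Mor X Y) :
    Mor (free_module X) (free_module Y) :=
  ModHom (free_map_subproof f).

Definition Ind : functor C Mod.
Proof.
refine (@Functor k C Mod free_module free_map _ _ _).
- by move=> X; apply: mod_hom_eq; apply: tensm1.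
- by move=> X Y Z g f; apply: mod_hom_eq; rewrite /= -tensmM mcomp1m.
- by move=> X Y a f g; apply: mod_hom_eq; apply: (tensm_linr _ a).
Defined.

Definition tens_balance (M N : Mod) :
    Mor (mod_obj M ⊗ A ⊗ mod_obj N) (mod_obj M ⊗ mod_obj N) :=
  ((mod_act M ∘ braid (mod_obj M) A) ⊠ idm (mod_obj N)) -
  (idm (mod_obj M) ⊠ mod_act N) ∘ assoc (mod_obj M) A (mod_obj N).

End Modules.
Arguments mod_linear {k C MC BC A} M N f.
Arguments Mod {k C MC BC} A.
Arguments Ind {k C MC BC} A.

Section Relative.
Variables (k : fieldType) (C : category k).
Context {MC : monoidal C} {BC : braided C} {RC : ribbon C}.
Variable A : comm_algebra C.
Context {T : monoidal (Mod A)} {B : braided (Mod A)} {R : ribbon (Mod A)}.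

Local Notation "⌊ M ⌋" := (mod_obj (M : left_module A)) (M at level 99).
Local Notation "f ♯" := (mod_mor f) (at level 2).

(* The structure on Mod A induced by the ribbon structure of C. Tensor products
   are cokernels, rel_proj being the projections; since the rel_proj are epi,
   their equations determine the action on M ⊗ N, the tensor product of
   morphisms, the constraints and the braiding. The unit object is A up to the
   specified isomorphism rel_unit. Likewise ldual M is the dual in C of the
   underlying object, up to rel_dual, and rel_dual_act says that its action is
   the dual one, ev (a φ ⊗ m) = ev (φ ⊗ a m), with A moved past the dual by the
   braiding. Altogether the structure is unique up to ribbon equivalence. *)
Record relative_ribbon := RelativeRibbon {
  rel_proj : forall M N : Mod A, Mor (⌊M⌋ ⊗ ⌊N⌋) ⌊M ⊗ N⌋;
  rel_coker : forall M N : Mod A, is_coker (tens_balance M N) (rel_proj M N);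
  rel_act : forall M N : Mod A,
    mod_act (M ⊗ N) ∘ (idm A ⊠ rel_proj M N) ∘ assoc A ⌊M⌋ ⌊N⌋ =
    rel_proj M N ∘ (mod_act M ⊠ idm ⌊N⌋);
  rel_tensm : forall (M M' N N' : Mod A) (f : Mor M M') (g : Mor N N'),
    (f ⊠ g)♯ ∘ rel_proj M N = rel_proj M' N' ∘ (f♯ ⊠ g♯);
  rel_assoc : forall M N P : Mod A,
    (assoc M N P)♯ ∘ rel_proj (M ⊗ N) P ∘ (rel_proj M N ⊠ idm ⌊P⌋) =
    rel_proj M (N ⊗ P) ∘ (idm ⌊M⌋ ⊠ rel_proj N P) ∘ assoc ⌊M⌋ ⌊N⌋ ⌊P⌋;
  rel_unit : Mor (regular_module A) (𝟙 : Mod A);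
  rel_unit_iso : is_iso rel_unit;
  rel_lunit : forall M : Mod A,
    (lunit M)♯ ∘ rel_proj 𝟙 M ∘ (rel_unit♯ ⊠ idm ⌊M⌋) = mod_act M;
  rel_runit : forall M : Mod A,
    (runit M)♯ ∘ rel_proj M 𝟙 ∘ (idm ⌊M⌋ ⊠ rel_unit♯) =
    mod_act M ∘ braid ⌊M⌋ A;
  rel_braid : forall M N : Mod A,
    (braid M N)♯ ∘ rel_proj M N = rel_proj N M ∘ braid ⌊M⌋ ⌊N⌋;
  rel_twist : forall M : Mod A, (twist M)♯ = twist ⌊M⌋;
  rel_dual : forall M : Mod A, Mor ⌊ldual M⌋ (ldual ⌊M⌋);
  rel_dual_iso : forall M : Mod A, is_iso (rel_dual M);
  rel_dual_act : forall M : Mod A,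
    ev ⌊M⌋ ∘ ((rel_dual M ∘ mod_act (ldual M)) ⊠ idm ⌊M⌋) =
    ev ⌊M⌋ ∘ (idm (ldual ⌊M⌋) ⊠ mod_act M) ∘ assoc (ldual ⌊M⌋) A ⌊M⌋
      ∘ ((braid A (ldual ⌊M⌋) ∘ (idm A ⊠ rel_dual M)) ⊠ idm ⌊M⌋)
}.

End Relative.
Arguments relative_ribbon {k C MC BC RC} A T B R.

Section TensorProduct.
Variable k : fieldType.

Definition tensV (V W : vectType k) : vectType k :=
  'M[k]_(\dim {:V}, \dim {:W}).

Definition tprod (V W : vectType k) (v : V) (w : W) : tensV V W :=
  \matrix_(i, j) (coord (vbasis {:V}) i v * coord (vbasis {:W}) j w).

Definition tlift_fun (V W U : vectType k) (b : V -> W -> U) (t : tensV V W) : U :=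
  \sum_i \sum_j (t : 'M_(_, _)) i j *: b (vbasis {:V})`_i (vbasis {:W})`_j.

Fact tlift_fun_linear (V W U : vectType k) (b : V -> W -> U) :
  linear (tlift_fun b).
Proof.
move=> a s t; rewrite /tlift_fun scaler_sumr -big_split /=.
apply: eq_bigr => i _; rewrite scaler_sumr -big_split /=.
by apply: eq_bigr => j _; rewrite !mxE scalerDl scalerA.
Qed.

HB.instance Definition _ (V W U : vectType k) (b : V -> W -> U) :=
  GRing.isLinear.Build k (tensV V W) U *:%R (tlift_fun b) (tlift_fun_linear b).

(* The linear map on V ⊗ W defined by a bilinear map b; see tliftE. *)
Definition tlift (V W U : vectType k) (b : V -> W -> U) : 'Hom(tensV V W, U) :=
  linfun (tlift_fun b).

Definition bilin (V W U : vectType k) (b : V -> W -> U) :=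
  (forall w, linear (b^~ w)) /\ (forall v, linear (b v)).

Lemma linear_fun_sum (U V : lmodType k) (f : U -> V) n (a : 'I_n -> k) x :
  linear f -> f (\sum_i a i *: x i) = \sum_i a i *: f (x i).
Proof.
move=> lf; elim/big_rec2: _ => [|i y z _ <-]; first exact: linear_fun0.
exact: lf.
Qed.

Lemma tliftE (V W U : vectType k) (b : V -> W -> U) v w :
  bilin b -> tlift b (tprod v w) = b v w.
Proof.
case=> bl br; rewrite /tlift lfunE /= /tlift_fun.
rewrite [in RHS](coord_vbasis (memvf v)) [RHS](linear_fun_sum _ _ (bl w)).
apply: eq_bigr => i _; rewrite [in RHS](coord_vbasis (memvf w)).
rewrite [X in _ *: X](linear_fun_sum _ _ (br _)) scaler_sumr.
by apply: eq_bigr => j _; rewrite mxE scalerA.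
Qed.

Lemma tprod_bilin (V W : vectType k) : bilin (@tprod V W).
Proof.
split=> [w a v v'|v a w w']; apply/matrixP=> i j; rewrite !mxE linearP /=.
  by rewrite mulrDl mulrA.
by rewrite mulrDr mulrCA.
Qed.

Lemma tprodPl (V W : vectType k) (w : W) : linear ((@tprod V W)^~ w).
Proof. exact: (tprod_bilin V W).1. Qed.
Lemma tprodPr (V W : vectType k) (v : V) : linear (@tprod V W v).
Proof. exact: (tprod_bilin V W).2. Qed.

HB.instance Definition _ (V W : vectType k) (v : V) :=
  GRing.isLinear.Build k W (tensV V W) *:%R (tprod v) (@tprodPr V W v).

Definition tprodr (V W : vectType k) (w : W) (v : V) := tprod v w.
HB.instance Definition _ (V W : vectType k) (w : W) :=
  GRing.isLinear.Build k V (tensV V W) *:%R (@tprodr V W w) (@tprodPl V W w).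

Lemma tprodZl (V W : vectType k) a (v : V) (w : W) :
  tprod (a *: v) w = a *: tprod v w.
Proof. exact: (linearZ_LR (@tprodr V W w)). Qed.
Lemma tprodZr (V W : vectType k) a (v : V) (w : W) :
  tprod v (a *: w) = a *: tprod v w.
Proof. exact: linearZ_LR. Qed.
Lemma tprod0l (V W : vectType k) (w : W) : tprod (0 : V) w = 0.
Proof. exact: (linear0 (@tprodr V W w)). Qed.
Lemma tprod0r (V W : vectType k) (v : V) : tprod v (0 : W) = 0.
Proof. exact: linear0. Qed.
Lemma tprod_suml (V W : vectType k) I (r : seq I) (P : pred I) (F : I -> V) (w : W) :
  tprod (\sum_(i <- r | P i) F i) w = \sum_(i <- r | P i) tprod (F i) w.
Proof. exact: (linear_sum (@tprodr V W w)). Qed.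
Lemma tprod_sumr (V W : vectType k) I (r : seq I) (P : pred I) (F : I -> W) (v : V) :
  tprod v (\sum_(i <- r | P i) F i) = \sum_(i <- r | P i) tprod v (F i).
Proof. exact: linear_sum. Qed.

Lemma tens_ext (V W U : vectType k) (f g : 'Hom(tensV V W, U)) :
  (forall v w, f (tprod v w) = g (tprod v w)) -> f = g.
Proof.
move=> e; apply/lfunP=> t.
rewrite (matrix_sum_delta (t : 'M_(_, _))) !linear_sum; apply: eq_bigr => i _.
rewrite !linear_sum; apply: eq_bigr => j _; rewrite !linearZ /=.
suff -> : delta_mx i j = tprod (vbasis {:V})`_i (vbasis {:W})`_j by rewrite e.
apply/matrixP=> a b; rewrite !mxE.
have f1 := basis_free (vbasisP {:V}); have f2 := basis_free (vbasisP {:W}).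
by rewrite !coord_free // -natrM mulnb (eq_sym a) (eq_sym b).
Qed.

Definition tmap (V V' W W' : vectType k) (f : 'Hom(V, V')) (g : 'Hom(W, W')) :
    'Hom(tensV V W, tensV V' W') :=
  tlift (fun v w => tprod (f v) (g w)).

Lemma tmapE (V V' W W' : vectType k) (f : 'Hom(V, V')) (g : 'Hom(W, W')) v w :
  tmap f g (tprod v w) = tprod (f v) (g w).
Proof.
rewrite /tmap tliftE //; split=> [w'|v'] a x y /=; rewrite linearP.
  exact: tprodPl.
by rewrite linearP.
Qed.

Definition tassoc (U V W : vectType k) :
    'Hom(tensV (tensV U V) W, tensV U (tensV V W)) :=
  tlift (fun t w => tlift (fun u v => tprod u (tprod v w)) t).

Definition tassoci (U V W : vectType k) :
    'Hom(tensV U (tensV V W), tensV (tensV U V) W) :=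
  tlift (fun u t => tlift (fun v w => tprod (tprod u v) w) t).

Lemma linear_tlift (U V W Z : vectType k) (b : Z -> V -> W -> U) :
  (forall v w, linear (fun z => b z v w)) ->
  forall t, linear (fun z => tlift (b z) t).
Proof.
move=> lb t a x y; rewrite /tlift !lfunE /= /tlift_fun.
rewrite scaler_sumr -big_split; apply: eq_bigr => i _ /=.
rewrite scaler_sumr -big_split; apply: eq_bigr => j _ /=.
by rewrite lb scalerDr !scalerA mulrC.
Qed.

Lemma tassocE (U V W : vectType k) (u : U) (v : V) (w : W) :
  tassoc U V W (tprod (tprod u v) w) = tprod u (tprod v w).
Proof.
rewrite /tassoc tliftE ?tliftE //.
- split=> [v'|u'] a x y /=; first exact: tprodPl.
  by rewrite (tprodPl w) tprodPr.
- split=> [w'|t] a x y; first exact: linearP.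
  apply: (linear_tlift (b := fun w u v => tprod u (tprod v w))) => u' v' c w1 w2.
  by rewrite !linearP.
Qed.

Lemma tassociE (U V W : vectType k) (u : U) (v : V) (w : W) :
  tassoci U V W (tprod u (tprod v w)) = tprod (tprod u v) w.
Proof.
rewrite /tassoci tliftE ?tliftE //.
- split=> [w'|v'] a x y /=; last exact: tprodPr.
  by rewrite linearP tprodPl.
- split=> [t|u'] a x y; last exact: linearP.
  apply: (linear_tlift (b := fun u v w => tprod (tprod u v) w)) => v' w' c u1 u2.
  by rewrite tprodPl tprodPl.
Qed.

Definition tlunit (V : vectType k) : 'Hom(tensV k^o V, V) :=
  tlift (fun (c : k^o) (v : V) => c *: v).

Definition trunit (V : vectType k) : 'Hom(tensV V k^o, V) :=
  tlift (fun (v : V) (c : k^o) => c *: v).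

Lemma tlunitE (V : vectType k) (c : k^o) (v : V) : tlunit V (tprod c v) = c *: v.
Proof.
rewrite /tlunit tliftE //; split=> [v'|c'] a x y /=.
  by rewrite scalerDl scalerA.
by rewrite scalerDr !scalerA mulrC.
Qed.

Lemma trunitE (V : vectType k) (c : k^o) (v : V) : trunit V (tprod v c) = c *: v.
Proof.
rewrite /trunit tliftE //; split=> [v'|c'] a x y /=.
  by rewrite scalerDr !scalerA mulrC.
by rewrite scalerDl scalerA.
Qed.

Definition dualV (V : vectType k) : vectType k := 'Hom(V, k^o).

Fact precomp_linear (V W : vectType k) (f : 'Hom(V, W)) :
  linear (fun phi : dualV W => (phi \o f)%VF : dualV V).
Proof. by move=> a x y; rewrite comp_lfunDl comp_lfunZl. Qed.

Definition precomp (V W : vectType k) (f : 'Hom(V, W)) (phi : dualV W) : dualV V :=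
  (phi \o f)%VF.
HB.instance Definition _ (V W : vectType k) (f : 'Hom(V, W)) :=
  GRing.isLinear.Build k (dualV W) (dualV V) *:%R (precomp f) (precomp_linear f).

Definition transp (V W : vectType k) (f : 'Hom(V, W)) : 'Hom(dualV W, dualV V) :=
  linfun (precomp f).

Lemma transpE (V W : vectType k) (f : 'Hom(V, W)) phi v :
  (transp f phi : 'Hom(V, k^o)) v = (phi : 'Hom(W, k^o)) (f v).
Proof. by rewrite /transp lfunE /= /precomp comp_lfunE. Qed.

Definition tev (V : vectType k) : 'Hom(tensV (dualV V) V, k^o) :=
  tlift (fun (phi : dualV V) (v : V) => (phi : 'Hom(V, k^o)) v).

Lemma tevE (V : vectType k) (phi : dualV V) (v : V) :
  tev V (tprod phi v) = (phi : 'Hom(V, k^o)) v.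
Proof.
rewrite /tev tliftE //; split=> [v'|phi'] a x y /=; last by rewrite linearP.
by rewrite add_lfunE scale_lfunE.
Qed.

Definition dbasis (V : vectType k) (i : 'I_(\dim {:V})) : dualV V :=
  linfun (coord (vbasis {:V}) i : V -> k^o).
Arguments dbasis : clear implicits.

Definition tcoev1 (V : vectType k) : tensV V (dualV V) :=
  \sum_(i < \dim {:V}) tprod (vbasis {:V})`_i (dbasis V i).

Definition scalev (U : vectType k) (u : U) (c : k^o) : U := c *: u.
Fact scalev_linear (U : vectType k) (u : U) : linear (scalev u).
Proof. by move=> a x y; rewrite /scalev scalerDl scalerA. Qed.
HB.instance Definition _ (U : vectType k) (u : U) :=
  GRing.isLinear.Build k k^o U *:%R (scalev u) (scalev_linear u).

Definition tcoev (V : vectType k) : 'Hom(k^o, tensV V (dualV V)) :=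
  linfun (scalev (tcoev1 V)).

Lemma tcoevE (V : vectType k) (c : k^o) : tcoev V c = c *: tcoev1 V.
Proof. by rewrite /tcoev lfunE. Qed.

Lemma dbasisE (V : vectType k) i (v : V) :
  (dbasis V i : 'Hom(V, k^o)) v = coord (vbasis {:V}) i v.
Proof. by rewrite /dbasis (lfunE (coord (vbasis {:V}) i : {linear V -> k^o})). Qed.

Lemma dbasis_sum (V : vectType k) (phi : dualV V) :
  phi = \sum_(i < \dim {:V}) (phi : 'Hom(V, k^o)) (vbasis {:V})`_i *: dbasis V i.
Proof.
apply/lfunP=> v; rewrite [in LHS](coord_vbasis (memvf v)) linear_sum sum_lfunE.
by apply: eq_bigr => i _; rewrite linearZ scale_lfunE dbasisE /= /GRing.scale /= mulrC.
Qed.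

Lemma tcoev_transp (V : vectType k) (f : 'End(V)) :
  tmap f \1%VF (tcoev1 V) = tmap \1%VF (transp f) (tcoev1 V).
Proof.
rewrite /tcoev1 !linear_sum /=.
under eq_bigr => i _ do rewrite tmapE id_lfunE (coord_vbasis (memvf (f _))) tprod_suml.
under [RHS]eq_bigr => i _ do
  rewrite tmapE id_lfunE (dbasis_sum (transp f _)) tprod_sumr.
rewrite exchange_big; apply: eq_bigr => i _; apply: eq_bigr => j _ /=.
by rewrite tprodZl tprodZr transpE dbasisE.
Qed.

Definition tprodL (V W : vectType k) (v : V) : 'Hom(W, tensV V W) := linfun (tprod v).
Definition tprodR (V W : vectType k) (w : W) : 'Hom(V, tensV V W) := linfun (@tprodr V W w).

Lemma tprodLE (V W : vectType k) (v : V) (w : W) : tprodL W v w = tprod v w.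
Proof. by rewrite /tprodL lfunE. Qed.
Lemma tprodRE (V W : vectType k) (v : V) (w : W) : tprodR V w v = tprod v w.
Proof. by rewrite /tprodR lfunE. Qed.

Lemma tens_ext3l (U V W Z : vectType k) (f g : 'Hom(tensV (tensV U V) W, Z)) :
  (forall u v w, f (tprod (tprod u v) w) = g (tprod (tprod u v) w)) -> f = g.
Proof.
move=> e; apply: tens_ext => t w.
suff /lfunP/(_ t) : (f \o tprodR _ w = g \o tprodR _ w)%VF.
  by rewrite !(comp_lfunE, tprodRE).
by apply: tens_ext => u v; rewrite !(comp_lfunE, tprodRE) e.
Qed.

Lemma tens_ext3r (U V W Z : vectType k) (f g : 'Hom(tensV U (tensV V W), Z)) :
  (forall u v w, f (tprod u (tprod v w)) = g (tprod u (tprod v w))) -> f = g.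
Proof.
move=> e; apply: tens_ext => u t.
suff /lfunP/(_ t) : (f \o tprodL _ u = g \o tprodL _ u)%VF.
  by rewrite !(comp_lfunE, tprodLE).
by apply: tens_ext => v w; rewrite !(comp_lfunE, tprodLE) e.
Qed.

Lemma tens_ext4l (U V W X Z : vectType k)
    (f g : 'Hom(tensV (tensV (tensV U V) W) X, Z)) :
  (forall u v w x, f (tprod (tprod (tprod u v) w) x) =
                   g (tprod (tprod (tprod u v) w) x)) -> f = g.
Proof.
move=> e; apply: tens_ext => t x.
suff /lfunP/(_ t) : (f \o tprodR _ x = g \o tprodR _ x)%VF.
  by rewrite !(comp_lfunE, tprodRE).
by apply: tens_ext3l => u v w; rewrite !(comp_lfunE, tprodRE) e.
Qed.

End TensorProduct.

(* Actions of the library are right actions: cm_act m g is m^g. *)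
Record crossed_module := CrossedModule {
  cm1 : finGroupType;
  cm2 : finGroupType;
  cm_act : groupAction [set: cm1] [set: cm2];
  cm_bd : {morphism [set: cm2] >-> cm1};
  cm_bd_act : forall (m : cm2) (g : cm1), cm_bd (cm_act m g) = (cm_bd m ^ g)%g;
  cm_peiffer : forall m n : cm2, cm_act m (cm_bd n) = (m ^ n)%g
}.

Section GradedReps.
Variables (k : fieldType) (X : crossed_module).
Local Notation X1 := (cm1 X).
Local Notation X2 := (cm2 X).
Local Notation act := (cm_act X).
Local Notation bd := (cm_bd X).

Lemma cm_bdM (m n : X2) : bd (m * n)%g = (bd m * bd n)%g.
Proof. by rewrite morphM ?inE. Qed.
Lemma cm_bdV (m : X2) : bd m^-1%g = (bd m)^-1%g.
Proof. by rewrite morphV ?inE. Qed.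
Lemma cm_bd1 : bd 1%g = 1%g.
Proof. exact: morph1. Qed.
Lemma cm_act1 (m : X2) : act m 1%g = m.
Proof. exact: act1. Qed.
Lemma cm_actM (m : X2) (g h : X1) : act m (g * h)%g = act (act m g) h.
Proof. by rewrite actMin ?inE. Qed.
Lemma cm_actK (m : X2) (g : X1) : act (act m g) g^-1%g = m.
Proof. by rewrite -cm_actM mulgV cm_act1. Qed.
Lemma cm_actKV (m : X2) (g : X1) : act (act m g^-1%g) g = m.
Proof. by rewrite -cm_actM mulVg cm_act1. Qed.
Lemma cm_act_mul (m n : X2) (g : X1) : act (m * n)%g g = (act m g * act n g)%g.
Proof. by rewrite gactM ?inE. Qed.
Lemma cm_act_1 (g : X1) : act 1%g g = 1%g.
Proof. by rewrite gact1 ?inE. Qed.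
Lemma cm_act_inv (m : X2) (g : X1) : act m^-1%g g = (act m g)^-1%g.
Proof. by rewrite gactV ?inE. Qed.
Lemma cm_act_bdV (m n : X2) : act n (bd m)^-1%g = (m * n * m^-1)%g.
Proof. by rewrite -cm_bdV cm_peiffer conjgE invgK mulgA. Qed.
Lemma cm_act_bd_id (m : X2) : act m (bd m)^-1%g = m.
Proof. by rewrite cm_act_bdV mulgK. Qed.

(* The triples (V, P, Q); gQ is a homomorphism to Aut(V) by gQ1 and gQM. *)
Record gobj := GObj {
  gV :> vectType k;
  gP : X2 -> 'End(gV);
  gQ : X1 -> 'End(gV);
  gP_orth : forall m n : X2, (gP m \o gP n)%VF = if m == n then gP m else 0;
  gP_sum : \sum_m gP m = \1%VF;
  gQ1 : gQ 1%g = \1%VF;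
  gQM : forall g h : X1, gQ (g * h)%g = (gQ g \o gQ h)%VF;
  gPQ : forall (m : X2) (g : X1), (gP m \o gQ g = gQ g \o gP (act m g))%VF
}.

Definition is_ghom (V W : gobj) : {pred 'Hom(V, W)} := fun f =>
  [forall m, f \o gP V m == gP W m \o f]%VF &&
  [forall g, f \o gQ V g == gQ W g \o f]%VF.
Arguments is_ghom V W f : clear implicits.

Record ghom (V W : gobj) := GHom {
  gfun :> 'Hom(V, W);
  gfunP : gfun \in is_ghom V W
}.

Fact is_ghom_submod (V W : gobj) : submod_closed (is_ghom V W).
Proof.
split=> [|a f g].
  by rewrite unfold_in; apply/andP; split; apply/forallP=> m;
     rewrite comp_lfun0l comp_lfun0r.
rewrite !unfold_in => /andP[/forallP fP /forallP fQ] /andP[/forallP hP /forallP hQ].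
apply/andP; split; apply/forallP=> m.
  by rewrite comp_lfunDl comp_lfunDr -comp_lfunZl -comp_lfunZr (eqP (fP m)) (eqP (hP m)).
by rewrite comp_lfunDl comp_lfunDr -comp_lfunZl -comp_lfunZr (eqP (fQ m)) (eqP (hQ m)).
Qed.

HB.instance Definition _ (V W : gobj) :=
  GRing.isSubmodClosed.Build k 'Hom(V, W) (is_ghom V W) (is_ghom_submod V W).
HB.instance Definition _ (V W : gobj) := [isSub for @gfun V W].
HB.instance Definition _ (V W : gobj) := [Choice of ghom V W by <:].
HB.instance Definition _ (V W : gobj) := [SubChoice_isSubLmodule of ghom V W by <:].

Lemma ghom_eq (V W : gobj) (f g : ghom V W) : (f : 'Hom(V, W)) = g -> f = g.
Proof. exact: val_inj. Qed.

Lemma ghomP (V W : gobj) (f : ghom V W) m v : f (gP V m v) = gP W m (f v).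
Proof.
have /andP[/forallP/(_ m)/eqP e _] := gfunP f.
by rewrite -!comp_lfunE e.
Qed.

Lemma ghomQ (V W : gobj) (f : ghom V W) g v : f (gQ V g v) = gQ W g (f v).
Proof.
have /andP[_ /forallP/(_ g)/eqP e] := gfunP f.
by rewrite -!comp_lfunE e.
Qed.

Definition homog (V : gobj) (m : X2) (v : V) := gP V m v = v.

Lemma homogP (V : gobj) (m n : X2) (v : V) :
  homog n v -> gP V m v = if m == n then v else 0.
Proof.
move=> hv; rewrite -hv -comp_lfunE gP_orth; case: eqP => [->|_]; first by rewrite hv.
by rewrite zero_lfunE.
Qed.

Lemma gP_homog (V : gobj) (m : X2) (v : V) : homog m (gP V m v).
Proof. by rewrite /homog -comp_lfunE gP_orth eqxx. Qed.

Lemma homog_dec (V : gobj) (v : V) : v = \sum_m gP V m v.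
Proof. by rewrite -sum_lfunE gP_sum id_lfunE. Qed.

Lemma gQ_homog (V : gobj) (m : X2) (g : X1) (v : V) :
  homog m v -> homog (act m g^-1%g) (gQ V g v).
Proof. by move=> hv; rewrite /homog -comp_lfunE gPQ comp_lfunE cm_actKV hv. Qed.

Lemma homog_ext (V : gobj) (U : vectType k) (f g : 'Hom(V, U)) :
  (forall m v, homog m v -> f v = g v) -> f = g.
Proof.
move=> e; apply/lfunP=> v; rewrite (homog_dec v) !linear_sum.
by apply: eq_bigr => m _; apply: (e m); apply: gP_homog.
Qed.

Lemma homog_tens_ext (V W : gobj) (U : vectType k) (f g : 'Hom(tensV V W, U)) :
  (forall m n v w, homog m v -> homog n w -> f (tprod v w) = g (tprod v w)) ->
  f = g.
Proof.
move=> e; apply: tens_ext => v w.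
rewrite (homog_dec v) tprod_suml !linear_sum; apply: eq_bigr => m _.
rewrite (homog_dec w) tprod_sumr !linear_sum; apply: eq_bigr => n _.
by apply: (e m n); apply: gP_homog.
Qed.

Lemma is_ghomI (V W : gobj) (f : 'Hom(V, W)) :
  (forall m v, homog m v -> homog m (f v)) ->
  (forall g m v, homog m v -> f (gQ V g v) = gQ W g (f v)) -> f \in is_ghom V W.
Proof.
move=> fP fQ; rewrite unfold_in; apply/andP; split; apply/forallP=> x; apply/eqP;
  apply: homog_ext => m v hv; rewrite !comp_lfunE; last exact: fQ hv.
rewrite (homogP _ hv) (homogP _ (fP _ _ hv)).
by case: eqP => // _; rewrite linear0.
Qed.

Lemma ghom_homog (V W : gobj) (f : ghom V W) m v : homog m v -> homog m (f v).
Proof. by move=> hv; rewrite /homog -ghomP hv. Qed.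

Fact gid_subproof (V : gobj) : \1%VF \in is_ghom V V.
Proof. by apply: is_ghomI => [m v|g m v]; rewrite !id_lfunE. Qed.
Definition gid (V : gobj) := GHom (gid_subproof V).

Fact gcomp_subproof (U V W : gobj) (g : ghom V W) (f : ghom U V) :
  (g \o f)%VF \in is_ghom U W.
Proof.
apply: is_ghomI => [m v hv|a m v hv]; rewrite !comp_lfunE; last by rewrite !ghomQ.
by do 2 apply: ghom_homog.
Qed.
Definition gcomp (U V W : gobj) (g : ghom V W) (f : ghom U V) :=
  GHom (gcomp_subproof g f).

(* The category M(X). *)
Definition catM : category k.
Proof.
refine (@Category k gobj (fun V W => ghom V W) gid gcomp _ _ _ _ _).
- by move=> *; apply: ghom_eq; apply: comp_lfunA.
- by move=> *; apply: ghom_eq; apply: comp_lfun1l.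
- by move=> *; apply: ghom_eq; apply: comp_lfun1r.
- by move=> U V W f a g h; apply: ghom_eq; rewrite /= comp_lfunDl comp_lfunZl.
- by move=> U V W f a g h; apply: ghom_eq; rewrite /= comp_lfunDr comp_lfunZr.
Defined.

Section Tens.
Variables V W : gobj.

Definition tensP (m : X2) : 'End(tensV V W) :=
  \sum_(p : X2 * X2 | (p.1 * p.2)%g == m) tmap (gP V p.1) (gP W p.2).
Definition tensQ (g : X1) : 'End(tensV V W) := tmap (gQ V g) (gQ W g).

Lemma tensPE m n l v w : homog n v -> homog l w ->
  tensP m (tprod v w) = if m == (n * l)%g then tprod v w else 0.
Proof.
move=> hv hw; rewrite /tensP sum_lfunE.
have E p : tmap (gP V p.1) (gP W p.2) (tprod v w) =
    if p == (n, l) then tprod v w else 0.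
  case: p => a b /=; rewrite tmapE (homogP a hv) (homogP b hw) xpair_eqE.
  by case: eqP => _; case: eqP => _; rewrite ?tprod0l ?tprod0r.
under eq_bigr => p _ do rewrite E.
rewrite -big_mkcondr /= eq_sym.
case: eqP => [e|ne].
  rewrite (big_pred1 (n, l)) // => p /=.
  by case: (p =P (n, l)) => [->|]; rewrite ?andbF //= e eqxx.
by apply: big_pred0 => p; case: (p =P (n, l)) => [->|]; rewrite ?andbF //=; case: eqP.
Qed.

Lemma tensQE g v w : tensQ g (tprod v w) = tprod (gQ V g v) (gQ W g w).
Proof. exact: tmapE. Qed.

Fact tensP_orth m n : (tensP m \o tensP n)%VF = if m == n then tensP m else 0.
Proof.
apply: homog_tens_ext => a b v w hv hw; rewrite comp_lfunE (tensPE _ hv hw).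
case: (m =P n) => [<-|ne].
  rewrite [in RHS](tensPE _ hv hw).
  by case: eqP => [e|_]; rewrite ?linear0 ?(tensPE _ hv hw) -?e ?eqxx.
rewrite zero_lfunE; case: eqP => [e|_]; last exact: linear0.
by rewrite (tensPE _ hv hw) -e (introF eqP ne).
Qed.

Fact tensP_sum : \sum_m tensP m = \1%VF.
Proof.
apply: homog_tens_ext => a b v w hv hw; rewrite sum_lfunE id_lfunE.
under eq_bigr => m _ do rewrite (tensPE _ hv hw).
by rewrite -big_mkcond big_pred1_eq.
Qed.

Fact tensQ1 : tensQ 1%g = \1%VF.
Proof. by apply: tens_ext => v w; rewrite tensQE !gQ1 !id_lfunE. Qed.

Fact tensQM g h : tensQ (g * h)%g = (tensQ g \o tensQ h)%VF.
Proof. by apply: tens_ext => v w; rewrite comp_lfunE !tensQE !gQM !comp_lfunE. Qed.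

Fact tensPQ m g : (tensP m \o tensQ g = tensQ g \o tensP (act m g))%VF.
Proof.
apply: homog_tens_ext => a b v w hv hw; rewrite !comp_lfunE tensQE.
rewrite (tensPE _ (gQ_homog g hv) (gQ_homog g hw)) (tensPE _ hv hw) -cm_act_mul.
rewrite -(inj_eq (act_inj act g) m) cm_actKV.
by case: eqP => _; rewrite ?tensQE ?linear0.
Qed.

Definition gtens := GObj tensP_orth tensP_sum tensQ1 tensQM tensPQ.

End Tens.

Lemma homog_tprod (V W : gobj) m n (v : V) (w : W) :
  homog m v -> homog n w -> homog (V := gtens V W) (m * n)%g (tprod v w).
Proof. by move=> hv hw; rewrite /homog /= (tensPE _ hv hw) eqxx. Qed.

Lemma is_ghom_tensI (V W Z : gobj) (f : 'Hom(tensV V W, Z)) :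
  (forall m n v w, homog m v -> homog n w -> homog (m * n)%g (f (tprod v w))) ->
  (forall g m n v w, homog m v -> homog n w ->
    f (tprod (gQ V g v) (gQ W g w)) = gQ Z g (f (tprod v w))) ->
  f \in is_ghom (gtens V W) Z.
Proof.
move=> fP fQ; rewrite unfold_in; apply/andP; split; apply/forallP=> x; apply/eqP;
  apply: homog_tens_ext => m n v w hv hw; rewrite !comp_lfunE /=; last first.
  by rewrite tensQE (fQ _ _ _ _ _ hv hw).
rewrite (tensPE _ hv hw) (homogP _ (fP _ _ _ _ hv hw)).
by case: eqP => // _; rewrite linear0.
Qed.

Fact gtensm_subproof (V V' W W' : gobj) (f : ghom V V') (g : ghom W W') :
  tmap f g \in is_ghom (gtens V W) (gtens V' W').
Proof.
apply: is_ghom_tensI => [m n v w hv hw|a m n v w hv hw]; rewrite !tmapE.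
  by apply: homog_tprod; apply: ghom_homog.
by rewrite !ghomQ.
Qed.
Definition gtensm (V V' W W' : gobj) (f : ghom V V') (g : ghom W W') :
  ghom (gtens V W) (gtens V' W') := GHom (gtensm_subproof f g).

Definition oneP (m : X2) : 'End(k^o) := if m == 1%g then \1%VF else 0.
Definition oneQ (g : X1) : 'End(k^o) := \1%VF.

Fact oneP_orth m n : (oneP m \o oneP n)%VF = if m == n then oneP m else 0.
Proof.
rewrite /oneP; case: (m =P n) => [->|ne].
  by case: eqP => _; rewrite ?comp_lfun1l ?comp_lfun0l.
case: (m =P 1%g) => [e|_]; last by rewrite comp_lfun0l.
by case: (n =P 1%g) => [e'|_]; rewrite ?comp_lfun0r //; case: ne; rewrite e e'.
Qed.
Fact oneP_sum : \sum_m oneP m = \1%VF.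
Proof. by rewrite /oneP -big_mkcond big_pred1_eq. Qed.
Fact oneQM g h : oneQ (g * h)%g = (oneQ g \o oneQ h)%VF.
Proof. by rewrite comp_lfun1l. Qed.
Fact onePQ m g : (oneP m \o oneQ g = oneQ g \o oneP (act m g))%VF.
Proof.
rewrite comp_lfun1l comp_lfun1r /oneP -(inj_eq (act_inj act g) m) cm_act_1.
by [].
Qed.
Definition gone := GObj oneP_orth oneP_sum (erefl : oneQ 1%g = \1%VF) oneQM onePQ.

Lemma homog_one (c : k^o) : homog (V := gone) 1%g c.
Proof. by rewrite /homog /= /oneP eqxx id_lfunE. Qed.

Lemma homog_oneE m (c : k^o) : homog (V := gone) m c -> c = 0 \/ m = 1%g.
Proof.
rewrite /homog /= /oneP; case: eqP => [->|_]; first by right.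
by rewrite zero_lfunE => <-; left.
Qed.

Lemma homog0 (V : gobj) m : homog m (0 : V).
Proof. by rewrite /homog linear0. Qed.
Lemma homogZ (V : gobj) m a (v : V) : homog m v -> homog m (a *: v).
Proof. by move=> hv; rewrite /homog linearZ /=; congr (_ *: _). Qed.

Lemma homog_tens3l_ext (U V W : gobj) (Z : vectType k)
    (f g : 'Hom(tensV (tensV U V) W, Z)) :
  (forall l m n (u : U) (v : V) (w : W), homog l u -> homog m v -> homog n w ->
    f (tprod (tprod u v) w) = g (tprod (tprod u v) w)) -> f = g.
Proof.
move=> e; apply: tens_ext3l => u v w.
rewrite (homog_dec u) !tprod_suml !linear_sum; apply: eq_bigr => l _.
rewrite (homog_dec v) tprod_sumr !tprod_suml !linear_sum; apply: eq_bigr => m _.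
rewrite (homog_dec w) !tprod_sumr !linear_sum; apply: eq_bigr => n _.
by apply: (e l m n); apply: gP_homog.
Qed.

Lemma homog_tens3r_ext (U V W : gobj) (Z : vectType k)
    (f g : 'Hom(tensV U (tensV V W), Z)) :
  (forall l m n (u : U) (v : V) (w : W), homog l u -> homog m v -> homog n w ->
    f (tprod u (tprod v w)) = g (tprod u (tprod v w))) -> f = g.
Proof.
move=> e; apply: tens_ext3r => u v w.
rewrite (homog_dec u) !tprod_suml !linear_sum; apply: eq_bigr => l _.
rewrite (homog_dec v) tprod_suml !tprod_sumr !linear_sum; apply: eq_bigr => m _.
rewrite (homog_dec w) !tprod_sumr !linear_sum; apply: eq_bigr => n _.
by apply: (e l m n); apply: gP_homog.
Qed.

Fact gassoc_subproof (U V W : gobj) :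
  tassoc U V W \in is_ghom (gtens (gtens U V) W) (gtens U (gtens V W)).
Proof.
rewrite unfold_in; apply/andP; split; apply/forallP=> x; apply/eqP;
  apply: homog_tens3l_ext => l m n u v w hu hv hw; rewrite !comp_lfunE /=.
  rewrite (tensPE _ (homog_tprod hu hv) hw) tassocE.
  rewrite (tensPE _ hu (homog_tprod hv hw)) mulgA.
  by case: eqP => _; rewrite ?tassocE ?linear0.
by rewrite tassocE (tensQE (V := gtens U V)) (tensQE (W := gtens V W)) !tmapE tassocE.
Qed.
Definition gassoc (U V W : gobj) := GHom (gassoc_subproof U V W).

Fact gassoci_subproof (U V W : gobj) :
  tassoci U V W \in is_ghom (gtens U (gtens V W)) (gtens (gtens U V) W).
Proof.
rewrite unfold_in; apply/andP; split; apply/forallP=> x; apply/eqP;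
  apply: homog_tens3r_ext => l m n u v w hu hv hw; rewrite !comp_lfunE /=.
  rewrite (tensPE _ hu (homog_tprod hv hw)) tassociE.
  rewrite (tensPE _ (homog_tprod hu hv) hw) mulgA.
  by case: eqP => _; rewrite ?tassociE ?linear0.
by rewrite tassociE (tensQE (V := gtens U V)) (tensQE (W := gtens V W)) !tmapE tassociE.
Qed.
Definition gassoci (U V W : gobj) := GHom (gassoci_subproof U V W).

Fact glunit_subproof (V : gobj) : tlunit V \in is_ghom (gtens gone V) V.
Proof.
apply: is_ghom_tensI => [m n c v hc hv|g m n c v hc hv]; rewrite !tlunitE.
  by case: (homog_oneE hc) => ->; rewrite ?scale0r ?mul1g; [apply: homog0 | apply: homogZ].
by rewrite linearZ /= id_lfunE.
Qed.
Definition glunit (V : gobj) := GHom (glunit_subproof V).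

Fact grunit_subproof (V : gobj) : trunit V \in is_ghom (gtens V gone) V.
Proof.
apply: is_ghom_tensI => [m n v c hv hc|g m n v c hv hc]; rewrite !trunitE.
  by case: (homog_oneE hc) => ->; rewrite ?scale0r ?mulg1; [apply: homog0 | apply: homogZ].
by rewrite linearZ /= id_lfunE.
Qed.
Definition grunit (V : gobj) := GHom (grunit_subproof V).

Lemma scale1o (c : k^o) : c = c *: (1 : k^o).
Proof. by rewrite /GRing.scale /= mulr1. Qed.

Fact glunit_iso (V : catM) : is_iso (glunit V : Mor (c:=catM) (gtens gone V) V).
Proof.
have P : tprodL (V := k^o) V 1 \in is_ghom V (gtens gone V).
  apply: is_ghomI => [m v hv|g m v hv]; rewrite !tprodLE.
    by rewrite -[m]mul1g; apply: homog_tprod => //; apply: homog_one.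
  by rewrite (tensQE (V := gone)) id_lfunE.
exists (GHom P); split; apply: ghom_eq => /=.
  apply: tens_ext => c v; rewrite comp_lfunE tlunitE id_lfunE tprodLE.
  by rewrite [c in RHS]scale1o tprodZl tprodZr.
by apply/lfunP=> v; rewrite comp_lfunE tprodLE tlunitE scale1r id_lfunE.
Qed.

Fact grunit_iso (V : catM) : is_iso (grunit V : Mor (c:=catM) (gtens V gone) V).
Proof.
have P : tprodR (W := k^o) V 1 \in is_ghom V (gtens V gone).
  apply: is_ghomI => [m v hv|g m v hv]; rewrite !tprodRE.
    by rewrite -[m]mulg1; apply: homog_tprod => //; apply: homog_one.
  by rewrite (tensQE (W := gone)) id_lfunE.
exists (GHom P); split; apply: ghom_eq => /=.
  apply: tens_ext => v c; rewrite comp_lfunE trunitE id_lfunE tprodRE.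
  by rewrite [c in RHS]scale1o tprodZl tprodZr.
by apply/lfunP=> v; rewrite comp_lfunE tprodRE trunitE scale1r id_lfunE.
Qed.

#[export] Instance catM_monoidal : monoidal catM.
Proof.
refine (@Monoidal k catM gtens gone gtensm gassoc gassoci glunit grunit
  _ _ _ _ _ _ glunit_iso grunit_iso _ _ _ _ _).
- by move=> V W; apply: ghom_eq; apply: tens_ext => v w; rewrite /= tmapE !id_lfunE.
- move=> V V' V'' W W' W'' f' f g' g; apply: ghom_eq; apply: tens_ext => v w /=.
  by rewrite !(comp_lfunE, tmapE).
- move=> V V' W W' g a f f'; apply: ghom_eq; apply: tens_ext => v w /=.
  by rewrite !(add_lfunE, scale_lfunE, tmapE) tprodPl.
- move=> V V' W W' g a f f'; apply: ghom_eq; apply: tens_ext => v w /=.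
  by rewrite !(add_lfunE, scale_lfunE, tmapE) tprodPr.
- move=> U V W; apply: ghom_eq; apply: tens_ext3l => u v w /=.
  by rewrite comp_lfunE tassocE tassociE id_lfunE.
- move=> U V W; apply: ghom_eq; apply: tens_ext3r => u v w /=.
  by rewrite comp_lfunE tassociE tassocE id_lfunE.
- move=> U U' V V' W W' f g h; apply: ghom_eq; apply: tens_ext3l => u v w /=.
  by rewrite !(comp_lfunE, tassocE, tmapE).
- move=> V V' f; apply: ghom_eq; apply: tens_ext => c v /=.
  by rewrite !(comp_lfunE, tlunitE, tmapE) linearZ id_lfunE.
- move=> V V' f; apply: ghom_eq; apply: tens_ext => v c /=.
  by rewrite !(comp_lfunE, trunitE, tmapE) linearZ id_lfunE.
- move=> U V W Z; apply: ghom_eq; apply: tens_ext4l => u v w z /=.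
  by rewrite !(comp_lfunE, tassocE, tmapE, id_lfunE).
- move=> V W; apply: ghom_eq; apply: tens_ext3l => v c w /=.
  rewrite !(comp_lfunE, tassocE, tmapE, id_lfunE, tlunitE, trunitE).
  by rewrite tprodZl tprodZr.
Defined.

Definition tbraid (V W : gobj) : 'Hom(tensV V W, tensV W V) :=
  tlift (fun v w => \sum_m tprod (gQ W (bd m) w) (gP V m v)).

Lemma tbraidE (V W : gobj) m (v : V) (w : W) : homog m v ->
  tbraid V W (tprod v w) = tprod (gQ W (bd m) w) v.
Proof.
move=> hv; rewrite /tbraid tliftE; last first.
  split=> [w'|v'] a x y /=; rewrite scaler_sumr -big_split; apply: eq_bigr => n _ /=.
    by rewrite linearP tprodPr.
  by rewrite linearP tprodPl.
rewrite (bigD1 m) //= hv big1 ?addr0 // => n ne.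
by rewrite (homogP _ hv) (negbTE ne) tprod0r.
Qed.

Fact gbraid_subproof (V W : gobj) : tbraid V W \in is_ghom (gtens V W) (gtens W V).
Proof.
apply: is_ghom_tensI => [m n v w hv hw|g m n v w hv hw].
  rewrite (tbraidE _ hv).
  have -> : (m * n)%g = (act n (bd m)^-1 * m)%g by rewrite cm_act_bdV mulgKV.
  by apply: homog_tprod => //; apply: gQ_homog.
rewrite (tbraidE _ hv) (tbraidE _ (gQ_homog g hv)) /= tensQE.
rewrite -!comp_lfunE -!gQM; congr (tprod (gQ _ _ _) _).
by rewrite cm_bd_act conjgE invgK !mulgA mulgKV.
Qed.
Definition gbraid (V W : gobj) := GHom (gbraid_subproof V W).

Definition tbraidi (V W : gobj) : 'Hom(tensV W V, tensV V W) :=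
  tlift (fun w v => \sum_m tprod (gP V m v) (gQ W (bd m)^-1%g w)).

Lemma tbraidiE (V W : gobj) m (v : V) (w : W) : homog m v ->
  tbraidi V W (tprod w v) = tprod v (gQ W (bd m)^-1%g w).
Proof.
move=> hv; rewrite /tbraidi tliftE; last first.
  split=> [w'|v'] a x y /=; rewrite scaler_sumr -big_split; apply: eq_bigr => n _ /=.
    by rewrite linearP tprodPr.
  by rewrite linearP tprodPl.
rewrite (bigD1 m) //= hv big1 ?addr0 // => n ne.
by rewrite (homogP _ hv) (negbTE ne) tprod0l.
Qed.

Lemma gQK (V : gobj) g (v : V) : gQ V g^-1%g (gQ V g v) = v.
Proof. by rewrite -comp_lfunE -gQM mulVg gQ1 id_lfunE. Qed.
Lemma gQKV (V : gobj) g (v : V) : gQ V g (gQ V g^-1%g v) = v.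
Proof. by rewrite -comp_lfunE -gQM mulgV gQ1 id_lfunE. Qed.

Lemma is_ghom_inv (V W : gobj) (f : ghom V W) (g : 'Hom(W, V)) :
  (g \o f)%VF = \1%VF -> (f \o g)%VF = \1%VF -> g \in is_ghom W V.
Proof.
move=> gf fg.
have gK v : g (f v) = v by rewrite -comp_lfunE gf id_lfunE.
have fK w : f (g w) = w by rewrite -comp_lfunE fg id_lfunE.
rewrite unfold_in; apply/andP; split; apply/forallP=> x; apply/eqP/lfunP=> w;
  rewrite !comp_lfunE -{1}[w]fK.
  by rewrite -ghomP gK.
by rewrite -ghomQ gK.
Qed.

Lemma ghom_iso (V W : catM) (f : Mor V W) (g : 'Hom(gV W, gV V)) :
  (g \o gfun f)%VF = \1%VF -> (gfun f \o g)%VF = \1%VF -> is_iso f.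
Proof.
move=> gf fg; exists (GHom (is_ghom_inv gf fg)).
by split; apply: ghom_eq.
Qed.

Fact gbraid_iso (V W : catM) : is_iso (gbraid V W : Mor (V ⊗ W) (W ⊗ V)).
Proof.
apply: (@ghom_iso (V ⊗ W) (W ⊗ V) _ (tbraidi V W)); apply: homog_tens_ext.
  move=> m n v w hv hw.
  by rewrite comp_lfunE /= (tbraidE _ hv) (tbraidiE _ hv) gQK id_lfunE.
move=> m n w v hw hv.
by rewrite comp_lfunE /= (tbraidiE _ hv) (tbraidE _ hv) gQKV id_lfunE.
Qed.

#[export] Instance catM_braided : braided catM.
Proof.
refine (@Braided k catM catM_monoidal gbraid gbraid_iso _ _ _).
- move=> V V' W W' f g; apply: ghom_eq; apply: homog_tens_ext => m n v w hv hw /=.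
  rewrite !comp_lfunE (tbraidE _ hv) !tmapE (tbraidE _ (ghom_homog f hv)).
  by rewrite ghomQ.
- move=> U V W; apply: ghom_eq; apply: homog_tens3l_ext => l m n u v w hu hv hw /=.
  rewrite !comp_lfunE tassocE (tbraidE (W := gtens V W) _ hu) /= tensQE tassocE.
  by rewrite !tmapE (tbraidE _ hu) tassocE tmapE (tbraidE _ hu) !id_lfunE.
- move=> U V W; apply: ghom_eq; apply: homog_tens3r_ext => l m n u v w hu hv hw /=.
  rewrite !comp_lfunE tassociE (tbraidE (V := gtens U V) _ (homog_tprod hu hv)).
  rewrite tassociE tmapE id_lfunE (tbraidE _ hv) tassociE tmapE (tbraidE _ hu) id_lfunE.
  by rewrite -comp_lfunE -gQM -cm_bdM.
Defined.

Definition ttwist (V : gobj) : 'End(V) := \sum_m (gQ V (bd m) \o gP V m)%VF.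

Lemma ttwistE (V : gobj) m (v : V) : homog m v -> ttwist V v = gQ V (bd m) v.
Proof.
move=> hv; rewrite /ttwist sum_lfunE (bigD1 m) //= comp_lfunE hv big1 ?addr0 //.
by move=> n ne; rewrite comp_lfunE (homogP _ hv) (negbTE ne) linear0.
Qed.

Lemma ttwist_homog (V : gobj) m (v : V) : homog m v -> homog m (gQ V (bd m) v).
Proof. by move=> hv; have := gQ_homog (bd m) hv; rewrite cm_act_bd_id. Qed.

Fact gtwist_subproof (V : gobj) : ttwist V \in is_ghom V V.
Proof.
apply: is_ghomI => [m v hv|g m v hv]; rewrite (ttwistE hv); first exact: ttwist_homog.
rewrite (ttwistE (gQ_homog g hv)) -!comp_lfunE -!gQM; congr (gQ _ _ _).
by rewrite cm_bd_act conjgE invgK !mulgA mulgKV.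
Qed.
Definition gtwist (V : gobj) := GHom (gtwist_subproof V).

Fact gtwist_iso (V : catM) : is_iso (gtwist V : Mor V V).
Proof.
pose h : 'End(gV V) := \sum_m (gQ V (bd m)^-1%g \o gP V m)%VF.
have hE m v : homog m v -> h v = gQ V (bd m)^-1%g v.
  move=> hv; rewrite /h sum_lfunE (bigD1 m) //= comp_lfunE hv big1 ?addr0 //.
  by move=> n ne; rewrite comp_lfunE (homogP _ hv) (negbTE ne) linear0.
apply: (@ghom_iso V V _ h); apply: homog_ext => m v hv; rewrite comp_lfunE id_lfunE.
  by rewrite [X in h X](ttwistE hv) (hE _ _ (ttwist_homog hv)) gQK.
rewrite (hE _ _ hv) [LHS](ttwistE (m := m)) ?gQKV //.
have := gQ_homog (bd m)^-1%g hv; rewrite invgK cm_peiffer.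
by rewrite conjgE mulKg.
Qed.

Section Dual.
Variable V : gobj.
Definition dualP (m : X2) : 'End(dualV V) := transp (gP V m^-1%g).
Definition dualQ (g : X1) : 'End(dualV V) := transp (gQ V g^-1%g).

Lemma transpM (f g : 'End(V)) : transp (f \o g)%VF = (transp g \o transp f)%VF.
Proof.
by apply/lfunP=> phi; apply/lfunP=> v; rewrite transpE !comp_lfunE !transpE.
Qed.
Lemma transp1 : transp (\1 : 'End(V))%VF = \1%VF.
Proof. by apply/lfunP=> phi; apply/lfunP=> v; rewrite transpE !id_lfunE. Qed.

Fact dualP_orth m n : (dualP m \o dualP n)%VF = if m == n then dualP m else 0.
Proof.
rewrite -transpM gP_orth (inj_eq invg_inj) eq_sym; case: eqP => [->//|_].
by apply/lfunP=> phi; apply/lfunP=> v; rewrite transpE !zero_lfunE linear0.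
Qed.
Fact dualP_sum : \sum_m dualP m = \1%VF.
Proof.
apply/lfunP=> phi; apply/lfunP=> v; rewrite id_lfunE sum_lfunE sum_lfunE.
under eq_bigr => m _ do rewrite transpE.
rewrite -linear_sum (reindex_inj invg_inj) /=.
by under eq_bigr => m _ do rewrite invgK; rewrite -homog_dec.
Qed.
Fact dualQ1 : dualQ 1%g = \1%VF.
Proof. by rewrite /dualQ invg1 gQ1 transp1. Qed.
Fact dualQM g h : dualQ (g * h)%g = (dualQ g \o dualQ h)%VF.
Proof. by rewrite /dualQ invMg gQM transpM. Qed.
Fact dualPQ m g : (dualP m \o dualQ g = dualQ g \o dualP (act m g))%VF.
Proof. by rewrite -!transpM -cm_act_inv gPQ cm_actK. Qed.
Definition gdual := GObj dualP_orth dualP_sum dualQ1 dualQM dualPQ.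
End Dual.

Fact gev_subproof (V : gobj) : tev V \in is_ghom (gtens (gdual V) V) gone.
Proof.
apply: is_ghom_tensI => [m n phi v hp hv|g m n phi v hp hv]; rewrite !tevE.
  rewrite -hp /= transpE (homogP _ hv).
  case: eqP => [<-|_]; first by rewrite mulgV; apply: homog_one.
  by rewrite linear0; apply: homog0.
by rewrite /= transpE gQK id_lfunE.
Qed.
Definition gev (V : gobj) := GHom (gev_subproof V).

Fact gcoev_subproof (V : gobj) : tcoev V \in is_ghom gone (gtens V (gdual V)).
Proof.
apply: is_ghomI => [m c hc|g m c hc]; rewrite !tcoevE.
  case: (homog_oneE hc) => ->; first by rewrite scale0r; apply: homog0.
  apply: homogZ; rewrite /homog /= /tensP sum_lfunE.
  transitivity (\sum_n tmap (gP V n) (dualP V n^-1%g) (tcoev1 V)).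
    rewrite (reindex_onto (fun n => (n, n^-1%g)) fst) /=.
      by apply: eq_bigl => n; rewrite mulgV !eqxx.
    by case=> a b /= /eqP e; rewrite -(mulKg a b) e mulg1.
  transitivity (\sum_n tmap (gP V n) \1%VF (tcoev1 V)).
    apply: eq_bigr => n _; rewrite tcoev_transp.
    have -> : tmap (gP V n) (dualP V n^-1%g) =
              (tmap \1%VF (transp (gP V n)) \o tmap (gP V n) \1%VF)%VF.
      by apply: tens_ext => v phi; rewrite comp_lfunE !tmapE !id_lfunE /dualP invgK.
    rewrite comp_lfunE tcoev_transp -comp_lfunE; congr (fun_of_lfun _ _).
    apply: tens_ext => v phi; rewrite comp_lfunE !tmapE !id_lfunE -comp_lfunE.
    by rewrite -transpM gP_orth eqxx.
  rewrite -sum_lfunE.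
  suff -> : \sum_n tmap (gP V n) (\1%VF : 'End(dualV V)) = \1%VF by rewrite id_lfunE.
  apply: tens_ext => v phi; rewrite sum_lfunE id_lfunE.
  under eq_bigr => n _ do rewrite tmapE id_lfunE.
  by rewrite -tprod_suml -homog_dec.
rewrite id_lfunE linearZ; congr (_ *: _) => /=.
have -> : tensQ V (gdual V) g =
    (tmap \1%VF (dualQ V g) \o tmap (gQ V g) \1%VF)%VF.
  by apply: tens_ext => v phi; rewrite tensQE comp_lfunE !tmapE !id_lfunE.
rewrite comp_lfunE tcoev_transp -comp_lfunE.
rewrite (_ : (_ \o _)%VF = \1%VF) ?id_lfunE //.
apply: tens_ext => v phi; rewrite comp_lfunE !tmapE !id_lfunE; congr tprod.
by rewrite -comp_lfunE -transpM -gQM mulgV gQ1 transp1 id_lfunE.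
Qed.
Definition gcoev (V : gobj) := GHom (gcoev_subproof V).

#[export] Instance catM_ribbon : ribbon catM.
Proof.
refine (@Ribbon k catM catM_monoidal catM_braided gtwist gtwist_iso _ _
  gdual gev gcoev _ _ _).
- move=> V W f; apply: ghom_eq; apply: homog_ext => m v hv /=.
  by rewrite !comp_lfunE (ttwistE hv) (ttwistE (ghom_homog f hv)) ghomQ.
- move=> V W; apply: ghom_eq; apply: homog_tens_ext => m n v w hv hw /=.
  rewrite !comp_lfunE (ttwistE (V := gtens V W) (homog_tprod hv hw)) /= tensQE.
  rewrite tmapE (ttwistE hv) (ttwistE hw) (tbraidE _ (ttwist_homog hv)).
  rewrite (tbraidE _ (gQ_homog (bd m) (ttwist_homog hw))) -!comp_lfunE -!gQM -!cm_bdM.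
  by rewrite cm_act_bdV mulgKV.
- move=> V; apply: ghom_eq; apply: tens_ext => c v /=.
  rewrite !comp_lfunE tmapE id_lfunE tlunitE tcoevE tprodZl !linearZ; congr (_ *: _).
  rewrite tprod_suml !linear_sum /= [RHS](coord_vbasis (memvf v)).
  apply: eq_bigr => i _; rewrite tassocE tmapE id_lfunE trunitE tevE dbasisE.
  by [].
- move=> V; apply: ghom_eq; apply: tens_ext => phi c /=.
  rewrite !comp_lfunE tmapE id_lfunE trunitE tcoevE tprodZr !linearZ; congr (_ *: _).
  rewrite tprod_sumr !linear_sum /= [RHS](dbasis_sum phi).
  by apply: eq_bigr => i _; rewrite tassociE tmapE id_lfunE tlunitE tevE.
- move=> V; apply: ghom_eq; apply: homog_tens_ext => m n phi v hp hv /=.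
  rewrite !comp_lfunE !tmapE !id_lfunE !tevE (ttwistE hp) (ttwistE hv) /= transpE.
  have hphi x : (phi : 'Hom(V, k^o)) x = (phi : 'Hom(V, k^o)) (gP V m^-1%g x).
    by rewrite -{1}hp /= transpE.
  rewrite [LHS]hphi [RHS]hphi (homogP _ (gQ_homog _ hv)) (homogP _ (ttwist_homog hv)).
  have mm : (m ^ m)%g = m by rewrite conjgE mulKg.
  rewrite invgK cm_peiffer -{1}mm -conjVg (inj_eq (conjg_inj m)).
  by case: eqP => [<-|//]; rewrite cm_bdV.
Defined.

End GradedReps.
Arguments is_ghom {k X} V W f.

Section Vacuum.
Variables (k : fieldType) (X : crossed_module).
Local Notation X1 := (cm1 X).
Local Notation X2 := (cm2 X).
Local Notation act := (cm_act X).
Local Notation bd := (cm_bd X).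

Definition cmK : {group X2} := ('ker bd)%G.
Definition cmI : {group X1} := (bd @* [set: X2])%G.
(* K × C, where C = coker ∂; the pair (x, Iy) stands for x ⊗ δ_{Iy}. *)
Definition vac_index : finType := (subg_of cmK * coset_of cmI)%type.
Definition vacV : vectType k := {ffun vac_index -> k^o}.
Definition vacb (p : vac_index) : vacV := [ffun q => (q == p)%:R].

Definition vext_fun (U : vectType k) (f : vac_index -> U) (phi : vacV) : U :=
  \sum_p (phi : {ffun _ -> _}) p *: f p.

Fact vext_fun_linear (U : vectType k) (f : vac_index -> U) : linear (vext_fun f).
Proof.
move=> a x y; rewrite /vext_fun scaler_sumr -big_split; apply: eq_bigr => p _ /=.
by rewrite !ffunE scalerDl scalerA.
Qed.
HB.instance Definition _ (U : vectType k) (f : vac_index -> U) :=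
  GRing.isLinear.Build k vacV U *:%R (vext_fun f) (vext_fun_linear f).

(* The linear map sending the basis vector vacb p to f p. *)
Definition vext (U : vectType k) (f : vac_index -> U) : 'Hom(vacV, U) :=
  linfun (vext_fun f).

Lemma vextE (U : vectType k) (f : vac_index -> U) p : vext f (vacb p) = f p.
Proof.
rewrite /vext lfunE /= /vext_fun (bigD1 p) //= ffunE eqxx scale1r big1 ?addr0 //.
by move=> q ne; rewrite ffunE (negbTE ne) scale0r.
Qed.

Lemma vac_dec (phi : vacV) : phi = \sum_p (phi : {ffun _ -> k}) p *: vacb p.
Proof.
apply/ffunP=> q; rewrite sum_ffunE (bigD1 q) //= !ffunE eqxx big1 ?addr0.
  by rewrite /GRing.scale /= mulr1.
by move=> p ne; rewrite !ffunE eq_sym (negbTE ne) scaler0.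
Qed.

Lemma vac_ext (U : vectType k) (f g : 'Hom(vacV, U)) :
  (forall p, f (vacb p) = g (vacb p)) -> f = g.
Proof.
move=> e; apply/lfunP=> phi; rewrite (vac_dec phi) !linear_sum.
by apply: eq_bigr => p _; rewrite !linearZ /= e.
Qed.

(* m^y = x does not depend on the choice of y in Iy when x is in K; see vac_deg. *)
Definition vacP (m : X2) : 'End(vacV) :=
  vext (fun p => if act m (repr p.2) == sgval p.1 then vacb p else 0).
Definition vacQ (g : X1) : 'End(vacV) :=
  vext (fun p => vacb (p.1, (coset cmI g * p.2)%g)).

Lemma cmK_P m : reflect (bd m = 1%g) (m \in cmK).
Proof. by apply: (iffP idP) => [/mker//|e]; rewrite !inE e eqxx. Qed.

Lemma cmK_act m g : (act m g \in cmK) = (m \in cmK).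
Proof.
apply/cmK_P/cmK_P; rewrite cm_bd_act => e; last by rewrite e conj1g.
by apply: (conjg_inj g); rewrite e conj1g.
Qed.

Lemma cmK_conj (m n : X2) : m \in cmK -> (m ^ n)%g = m.
Proof.
move=> /cmK_P e; have c : (n ^ m)%g = n by rewrite -cm_peiffer e cm_act1.
by rewrite conjgE -{2}c conjgE mulKVg mulKg.
Qed.

Lemma cmI_norm g : g \in 'N(cmI)%g.
Proof.
rewrite inE; apply/subsetP=> x /imsetP[y]; rewrite /= morphimEdom => /imsetP[m _ ->] ->.
by rewrite -cm_bd_act; apply: imset_f; rewrite inE.
Qed.

Lemma cmI_cosetM g h : coset cmI (g * h)%g = (coset cmI g * coset cmI h)%g.
Proof. by rewrite morphM ?cmI_norm. Qed.

Lemma vac_deg m (x : X2) (y z : X1) : x \in cmK -> coset cmI y = coset cmI z ->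
  (act m y == x) = (act m z == x).
Proof.
move=> xK /(kercoset_rcoset (cmI_norm _) (cmI_norm _)) [i].
rewrite /= morphimEdom => /imsetP[n _ ->] ->; rewrite cm_actM cm_peiffer.
case mK : (m \in cmK); first by rewrite cmK_conj.
apply/eqP/eqP => e; move: xK; rewrite -e cmK_act ?mK //.
by rewrite -cm_peiffer cmK_act mK.
Qed.

Fact vacP_orth m n : (vacP m \o vacP n)%VF = if m == n then vacP m else 0.
Proof.
apply: vac_ext => p; rewrite comp_lfunE [X in vacP m X]vextE.
case: (m =P n) => [<-|ne]; rewrite ?zero_lfunE.
  by case: eqP => [e|ne]; rewrite ?linear0 vextE; case: eqP.
case: eqP => [e|_]; rewrite ?linear0 // vextE; case: eqP => // e'.
by case: ne; apply: (act_inj act (repr p.2)); rewrite e e'.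
Qed.

Fact vacP_sum : \sum_m vacP m = \1%VF.
Proof.
apply: vac_ext => p; rewrite sum_lfunE id_lfunE.
under eq_bigr => m _ do rewrite vextE.
rewrite -big_mkcond (big_pred1 (act (sgval p.1) (repr p.2)^-1%g)) // => m /=.
by apply/eqP/eqP => [<-|->]; rewrite ?cm_actK ?cm_actKV.
Qed.

Fact vacQ1 : vacQ 1%g = \1%VF.
Proof. by apply: vac_ext => -[x c]; rewrite vextE id_lfunE morph1 mul1g. Qed.

Fact vacQM g h : vacQ (g * h)%g = (vacQ g \o vacQ h)%VF.
Proof. by apply: vac_ext => -[x c]; rewrite comp_lfunE !vextE cmI_cosetM mulgA. Qed.

Fact vacPQ m g : (vacP m \o vacQ g = vacQ g \o vacP (act m g))%VF.
Proof.
apply: vac_ext => -[x c]; rewrite !comp_lfunE !vextE /= -cm_actM.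
rewrite (@vac_deg m (sgval x) _ (g * repr c)%g) ?subgP //; last first.
  have E (d : coset_of cmI) : coset cmI (repr d) = d := coset_reprK d.
  by rewrite cmI_cosetM [in RHS]E; exact: (E (coset cmI g * c)%g).
by case: eqP => _; rewrite ?linear0 // vextE.
Qed.

Definition vac_obj : catM k X := GObj vacP_orth vacP_sum vacQ1 vacQM vacPQ.

Definition vac_degree (p : vac_index) : X2 := act (sgval p.1) (repr p.2)^-1%g.

Lemma vac_homog p : homog (V := vac_obj) (vac_degree p) (vacb p).
Proof. by rewrite /homog /= vextE cm_actKV eqxx. Qed.

Lemma vac_degreeK p : bd (vac_degree p) = 1%g.
Proof. by apply/cmK_P; rewrite cmK_act subgP. Qed.

Definition vac_mulb (p q : vac_index) : vacV :=
  if p.2 == q.2 then vacb ((p.1 * q.1)%g, p.2) else 0.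
Definition vac_mul : 'Hom(tensV vacV vacV, vacV) :=
  tlift (fun phi psi : vacV => vext (fun p => vext (vac_mulb p) psi) phi).

Lemma vac_mulE p q : vac_mul (tprod (vacb p) (vacb q)) = vac_mulb p q.
Proof.
rewrite /vac_mul tliftE ?vextE //; split=> [psi|phi] a x y; first exact: linearP.
rewrite /vext !lfunE /= /vext_fun scaler_sumr -big_split; apply: eq_bigr => r _ /=.
by rewrite linearP scalerDr !scalerA mulrC.
Qed.

Definition vac_one : 'Hom(k^o, vacV) := linfun (scalev (\sum_c vacb (1%g, c))).

Lemma vac_oneE (a : k^o) : vac_one a = a *: \sum_c vacb (1%g, c).
Proof. by rewrite /vac_one lfunE. Qed.

Lemma vac_tens_extl (W U : vectType k) (f g : 'Hom(tensV vacV W, U)) :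
  (forall p w, f (tprod (vacb p) w) = g (tprod (vacb p) w)) -> f = g.
Proof.
move=> e; apply: tens_ext => phi w; rewrite (vac_dec phi) tprod_suml !linear_sum.
by apply: eq_bigr => p _; rewrite tprodZl !linearZ /= e.
Qed.

Lemma vac_tens_ext (U : vectType k) (f g : 'Hom(tensV vacV vacV, U)) :
  (forall p q, f (tprod (vacb p) (vacb q)) = g (tprod (vacb p) (vacb q))) -> f = g.
Proof.
move=> e; apply: vac_tens_extl => p psi; rewrite (vac_dec psi) tprod_sumr !linear_sum.
by apply: eq_bigr => q _; rewrite tprodZr !linearZ /= e.
Qed.

Lemma vac_tens3_ext (U : vectType k) (f g : 'Hom(tensV (tensV vacV vacV) vacV, U)) :
  (forall p q r, f (tprod (tprod (vacb p) (vacb q)) (vacb r)) =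
                 g (tprod (tprod (vacb p) (vacb q)) (vacb r))) -> f = g.
Proof.
move=> e; apply: tens_ext3l => u v w.
rewrite (vac_dec u) !tprod_suml !linear_sum; apply: eq_bigr => p _.
rewrite (vac_dec v) tprod_sumr !tprod_suml !linear_sum; apply: eq_bigr => q _.
rewrite (vac_dec w) !tprod_sumr !linear_sum; apply: eq_bigr => r _.
by rewrite !(tprodZl, tprodZr) !linearZ /= e.
Qed.

Fact vac_mul_subproof : vac_mul \in is_ghom (gtens vac_obj vac_obj) vac_obj.
Proof.
rewrite unfold_in; apply/andP; split; apply/forallP=> m; apply/eqP;
  apply: vac_tens_ext => p q; rewrite !comp_lfunE.
  rewrite [X in vac_mul X](tensPE _ (vac_homog p) (vac_homog q)) vac_mulE.
  rewrite (fun_if vac_mul) linear0 vac_mulE /vac_mulb.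
  case: (p.2 =P q.2) => [e|_]; last by rewrite linear0 if_same.
  rewrite (homogP _ (vac_homog _)) /vac_degree -e -cm_act_mul /=.
  by [].
rewrite [X in vac_mul X](tensQE (V := vac_obj) (W := vac_obj)) /= !vextE !vac_mulE.
rewrite /vac_mulb /= (inj_eq (mulgI _)).
by case: eqP => _; rewrite ?linear0 // vextE.
Qed.

Fact vac_one_subproof : vac_one \in is_ghom (gone k X) vac_obj.
Proof.
apply: is_ghomI => [m a ha|g m a ha]; rewrite !vac_oneE.
  case: (homog_oneE ha) => ->; first by rewrite scale0r; apply: homog0.
  apply: homogZ; rewrite /homog linear_sum; apply: eq_bigr => c _ /=.
  by rewrite vextE /= cm_act_1 eqxx.
rewrite id_lfunE linearZ; congr (_ *: _); rewrite linear_sum /=.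
rewrite (reindex_inj (mulgI (coset cmI g))).
by apply: eq_bigr => c _; rewrite vextE.
Qed.

Definition vac_mulm : Mor (vac_obj ⊗ vac_obj) vac_obj := GHom vac_mul_subproof.
Definition vac_onem : Mor (𝟙 : catM k X) vac_obj := GHom vac_one_subproof.

Definition vacuum : comm_algebra (catM k X).
Proof.
refine (@CommAlgebra k (catM k X) _ _ vac_obj vac_mulm vac_onem _ _ _ _);
  apply: ghom_eq => /=.
- apply: vac_tens3_ext => p q r; rewrite !comp_lfunE tassocE !tmapE !id_lfunE.
  rewrite !vac_mulE /vac_mulb; case: eqP => [e|ne].
    rewrite vac_mulE /vac_mulb /= e; case: eqP => [e'|_].
      by rewrite vac_mulE /vac_mulb /= e eqxx mulgA.
    by rewrite tprod0r linear0.
  case: eqP => [e|_]; last by rewrite tprod0l tprod0r !linear0.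
  rewrite tprod0l linear0 vac_mulE /vac_mulb /=.
  by case: eqP.
- apply: tens_ext => a phi; rewrite !comp_lfunE tmapE id_lfunE tlunitE vac_oneE.
  rewrite tprodZl linearZ; congr (_ *: _).
  rewrite [in LHS](vac_dec phi) [RHS](vac_dec phi) tprod_sumr linear_sum.
  apply: eq_bigr => -[x c] _; rewrite tprodZr linearZ; congr (_ *: _).
  rewrite tprod_suml linear_sum (bigD1 c) //= vac_mulE /vac_mulb /= eqxx mul1g.
  by rewrite big1 ?addr0 // => d ne; rewrite vac_mulE /vac_mulb /= (negbTE ne).
- apply: tens_ext => phi a; rewrite !comp_lfunE tmapE id_lfunE trunitE vac_oneE.
  rewrite tprodZr linearZ; congr (_ *: _).
  rewrite [in LHS](vac_dec phi) [RHS](vac_dec phi) tprod_suml linear_sum.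
  apply: eq_bigr => -[x c] _; rewrite tprodZl linearZ; congr (_ *: _).
  rewrite tprod_sumr linear_sum (bigD1 c) //= vac_mulE /vac_mulb /= eqxx mulg1.
  rewrite big1 ?addr0 // => d ne.
  by rewrite vac_mulE /vac_mulb /= eq_sym (negbTE ne).
- apply: vac_tens_ext => p q; rewrite comp_lfunE.
  rewrite [X in vac_mul X](tbraidE (W := vac_obj) _ (vac_homog p)).
  rewrite vac_degreeK gQ1 id_lfunE !vac_mulE /vac_mulb eq_sym.
  case: eqP => [<-|//]; congr (vacb (_, _)); apply: val_inj => /=.
  by rewrite conjgC cmK_conj ?subgP.
Defined.

End Vacuum.

(* Main.v *)
From HB Require Import structures.
From mathcomp Require Import all_boot all_order all_fingroup all_algebra boolp.
Require Import Defs.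

Set Implicit Arguments.
Unset Strict Implicit.
Unset Printing Implicit Defensive.

Import GRing.Theory.
Local Open Scope ring_scope.
Local Open Scope cat_scope.

(** Both [M(X)] and the category of modules over the vacuum [A] are categories of finite
    dimensional vector spaces with operators subject to relations: the projections and the
    group action on [M(X)], and in addition the action [rho M p] of the basis vectors of [A]
    on a module [M]. In characteristic zero averaging over [X1], and for modules also over
    [K], turns every linear map into a morphism. This is recorded by the structure
    [concrete], with instances [catM_concrete] and [mod_concrete]. It implies by Maschke's
    argument that both categories are abelian and semisimple with finitely many simple
    objects, and that the characters of the simple objects are orthogonal
    ([trace_orth_eq], [trace_orth_neq]).

    As an algebra [A] is a product of copies of the group algebra [k[K]] indexed by [C].
    The sum of all [p ⊗ p^*] over its basis is a Casimir element ([casimir]); after division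
    by the order of [K] it acts on [M ⊗ N] as an idempotent, whose image is [M ⊗_A N]. Maps
    out of [M ⊗_A N] are the balanced maps out of [M ⊗ N]. The associator, the braiding, the
    twist and the duals of vector spaces descend; for the braiding this holds since [A] is
    transparent ([braid_balanced]). Induction is a ribbon functor because
    [(A ⊗ V) ⊗_A (A ⊗ W)] is [A ⊗ (V ⊗ W)], and it is dominant because the same Casimir
    element splits the action map [A ⊗ M -> M] of every module ([ind_dominant]).

    There remains the nondegeneracy of the S-matrix. The quantum trace over [A] is the linear
    trace up to a nonzero constant ([mod_qtrace]), hence the entry at two modules [M] and [N]
    is proportional to the trace of the operator [encircle M N] on [M], the partial trace
    over [N] of the double braiding. Let [x] be a vector in the kernel of the S-matrix, indexed
    by representatives [L b] of the simple modules. The operator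
    [\sum_b x b *: encircle M (L b)] is natural in [M]. On a simple module it is a scalar of
    trace zero, so it vanishes there, and therefore on every module ([encircle_separates],
    [natural_zero]). On the module induced from the regular representation it is given
    explicitly in terms of the character values of the [L b] at the products
    [rho p \o Q (∂u) \o P v], where [v] is summed over a coset of [K] ([char_sum_fibre]).
    Here the structure over [A] enters twice: characters of modules are constant on these
    cosets ([char_coset]), and they vanish at [rho p \o Q g \o P v] for [g] outside the image
    of [∂] ([char_out]). So [\sum_b x b * char (L b) t] is zero for all [t], and [x = 0] by the
    orthogonality of characters ([char_free]). *)

(** * Traces and partial traces of linear maps *)

Section Trace.
Variable k : fieldType.
Implicit Types V W U : vectType k.

Lemma comp_lfun_suml V W U I (r : seq I) (P : pred I) (F : I -> 'Hom(W, U))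
    (g : 'Hom(V, W)) :
  ((\sum_(i <- r | P i) F i) \o g = \sum_(i <- r | P i) (F i \o g))%VF.
Proof.
apply/lfunP=> v; rewrite comp_lfunE !sum_lfunE.
by apply: eq_bigr => i _; rewrite comp_lfunE.
Qed.

Lemma comp_lfun_sumr V W U I (r : seq I) (P : pred I) (F : I -> 'Hom(V, W))
    (g : 'Hom(W, U)) :
  (g \o (\sum_(i <- r | P i) F i) = \sum_(i <- r | P i) (g \o F i))%VF.
Proof.
apply/lfunP=> v; rewrite comp_lfunE !sum_lfunE linear_sum.
by apply: eq_bigr => i _; rewrite comp_lfunE.
Qed.

Definition ltr V (f : 'End(V)) : k :=
  \sum_i coord (vbasis {:V}) i (f (vbasis {:V})`_i).

Lemma ltr_linear V : linear (@ltr V : 'End(V) -> k^o).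
Proof.
move=> a f g; rewrite /ltr scaler_sumr -big_split; apply: eq_bigr => i _ /=.
by rewrite add_lfunE scale_lfunE linearP.
Qed.
HB.instance Definition _ V :=
  GRing.isLinear.Build k 'End(V) k^o *:%R (@ltr V) (@ltr_linear V).

Lemma coord_map V W (f : 'Hom(V, W)) j v :
  coord (vbasis {:W}) j (f v) =
  \sum_i coord (vbasis {:V}) i v * coord (vbasis {:W}) j (f (vbasis {:V})`_i).
Proof.
rewrite [in LHS](coord_vbasis (memvf v)) !linear_sum.
by apply: eq_bigr => i _; rewrite !linearZ.
Qed.

Lemma ltr_comm V W (f : 'Hom(V, W)) (g : 'Hom(W, V)) :
  ltr (f \o g)%VF = ltr (g \o f)%VF.
Proof.
rewrite /ltr; under eq_bigr => i _ do rewrite comp_lfunE coord_map.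
under [RHS]eq_bigr => i _ do rewrite comp_lfunE coord_map.
by rewrite exchange_big; apply: eq_bigr => i _; apply: eq_bigr => j _; rewrite mulrC.
Qed.

Lemma coord_basis V (i j : 'I_(\dim {:V})) :
  coord (vbasis {:V}) i (vbasis {:V})`_j = (i == j)%:R.
Proof. by rewrite (coord_free _ _ (basis_free (vbasisP _))) eq_sym. Qed.

Lemma ltr1 V : ltr (\1 : 'End(V))%VF = (\dim {:V})%:R.
Proof.
rewrite /ltr; under eq_bigr => i _ do rewrite id_lfunE coord_basis eqxx.
by rewrite sumr_const card_ord.
Qed.

(** The rank one operator sending [v] to [coord i v *: e_j]; these operators span
    the space of all linear maps. *)
Definition elem_map V W (i : 'I_(\dim {:V})) (j : 'I_(\dim {:W})) : 'Hom(V, W) :=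
  linfun (fun v => coord (vbasis {:V}) i v *: (vbasis {:W})`_j).

Lemma elem_mapE V W i j v :
  elem_map i j v = coord (vbasis {:V}) i v *: (vbasis {:W})`_j.
Proof.
have l : linear (fun v => coord (vbasis {:V}) i v *: (vbasis {:W})`_j).
  by move=> a x y; rewrite linearP scalerDl scalerA.
pose L := GRing.isLinear.Build k V W *:%R _ l.
pose F : {linear V -> W} := HB.pack (fun v => coord (vbasis {:V}) i v *: (vbasis {:W})`_j) L.
exact: (lfunE F).
Qed.

Lemma ltr_elem_map V i j : ltr (elem_map i j : 'End(V)) = (i == j)%:R.
Proof.
rewrite /ltr (bigD1 i) //= elem_mapE coord_basis eqxx scale1r coord_basis.
rewrite big1 ?addr0 // => l ne.
by rewrite elem_mapE coord_basis eq_sym (negbTE ne) scale0r linear0.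
Qed.

(** Contraction of the second factor with the [i]-th dual basis vector. *)
Definition contract V W (i : 'I_(\dim {:W})) : 'Hom(tensV V W, V) :=
  tlift (fun v w => coord (vbasis {:W}) i w *: v).

Lemma contractE V W (i : 'I_(\dim {:W})) (v : V) w :
  contract V i (tprod v w) = coord (vbasis {:W}) i w *: v.
Proof.
rewrite /contract tliftE //; split=> [w'|v'] a x y.
  by rewrite scalerDr !scalerA mulrC.
by rewrite linearP scalerDl scalerA.
Qed.

(** The partial trace over the second factor. *)
Definition ptr V V' W (f : 'Hom(tensV V W, tensV V' W)) : 'Hom(V, V') :=
  \sum_i (contract V' i \o f \o tprodR V (vbasis {:W})`_i)%VF.

Lemma ptr_linear V V' W : linear (@ptr V V' W).
Proof.
move=> a f g; rewrite /ptr scaler_sumr -big_split; apply: eq_bigr => i _ /=.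
by rewrite comp_lfunDr comp_lfunDl -comp_lfunZr -comp_lfunZl.
Qed.
HB.instance Definition _ V V' W :=
  GRing.isLinear.Build k 'Hom(tensV V W, tensV V' W) 'Hom(V, V') *:%R
    (@ptr V V' W) (@ptr_linear V V' W).

Lemma ptr_tmap V V' W (a : 'Hom(V, V')) (b : 'End(W)) :
  ptr (tmap a b) = ltr b *: a.
Proof.
apply/lfunP=> v; rewrite sum_lfunE scale_lfunE /ltr scaler_suml.
by apply: eq_bigr => i _; rewrite !comp_lfunE tprodRE tmapE contractE.
Qed.

Lemma contract_tmapl V V' W W' (a : 'Hom(V, V')) i :
  (contract V' i \o tmap a (\1 : 'End(W)) = a \o contract V i)%VF.
Proof.
by apply: tens_ext => v w; rewrite !comp_lfunE tmapE !contractE id_lfunE linearZ.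
Qed.

Lemma ptr_compl V V' V'' W (a : 'Hom(V', V'')) (f : 'Hom(tensV V W, tensV V' W)) :
  ptr (tmap a \1 \o f)%VF = (a \o ptr f)%VF.
Proof.
rewrite /ptr comp_lfun_sumr; apply: eq_bigr => i _.
by rewrite !comp_lfunA contract_tmapl.
Qed.

Lemma ptr_compr V V' V'' W (a : 'Hom(V, V')) (f : 'Hom(tensV V' W, tensV V'' W)) :
  ptr (f \o tmap a \1)%VF = (ptr f \o a)%VF.
Proof.
rewrite /ptr comp_lfun_suml; apply: eq_bigr => i _; rewrite -!comp_lfunA.
congr (_ \o (_ \o _))%VF; apply/lfunP=> v.
by rewrite !comp_lfunE !tprodRE tmapE id_lfunE.
Qed.

Lemma contract_tmapr V W W' (b : 'Hom(W, W')) i :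
  (contract V i \o tmap \1 b = \sum_(j < \dim {:W}) coord (vbasis {:W'}) i (b (vbasis {:W})`_j) *:
     contract V j)%VF.
Proof.
apply: tens_ext => v w; rewrite comp_lfunE tmapE contractE id_lfunE sum_lfunE.
rewrite coord_map scaler_suml; apply: eq_bigr => j _.
by rewrite scale_lfunE contractE scalerA mulrC.
Qed.

Lemma ptr_comm V V' W W' (b : 'Hom(W, W')) (f : 'Hom(tensV V W', tensV V' W)) :
  ptr (tmap \1 b \o f)%VF = ptr (f \o tmap \1 b)%VF.
Proof.
rewrite /ptr; under eq_bigr => i _ do rewrite comp_lfunA contract_tmapr !comp_lfun_suml.
rewrite exchange_big; apply: eq_bigr => j _ /=.
have e : (tmap \1 b \o tprodR V (vbasis {:W})`_j = \sum_(i < \dim {:W'})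
    coord (vbasis {:W'}) i (b (vbasis {:W})`_j) *: tprodR V (vbasis {:W'})`_i)%VF.
  apply/lfunP=> v; rewrite comp_lfunE tprodRE tmapE id_lfunE sum_lfunE.
  rewrite [in LHS](coord_vbasis (memvf (b _))) tprod_sumr; apply: eq_bigr => i _.
  by rewrite tprodZr scale_lfunE tprodRE.
rewrite -!comp_lfunA e !comp_lfun_sumr; apply: eq_bigr => i _.
by rewrite -!comp_lfunZr -!comp_lfunZl comp_lfunA.
Qed.

Lemma tmap_comp V V' V'' W W' W'' (a' : 'Hom(V', V'')) (a : 'Hom(V, V'))
    (b' : 'Hom(W', W'')) (b : 'Hom(W, W')) :
  (tmap a' b' \o tmap a b = tmap (a' \o a) (b' \o b))%VF.
Proof. by apply: tens_ext => v w; rewrite !(comp_lfunE, tmapE). Qed.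

(** The partial trace over the second factor has the same trace, because the
    identity of [V ⊗ W] is the sum of the maps [t ↦ contract j t ⊗ e_j]. *)
Lemma ltr_ptr V W (f : 'End(tensV V W)) : ltr (ptr f) = ltr f.
Proof.
have id_dec : (\1 : 'End(tensV V W))%VF =
    \sum_(j < \dim {:W}) (tprodR V (vbasis {:W})`_j \o contract V j)%VF.
  apply: tens_ext => v w; rewrite id_lfunE sum_lfunE.
  rewrite {1}(coord_vbasis (memvf w)) tprod_sumr; apply: eq_bigr => j _.
  by rewrite comp_lfunE contractE tprodRE tprodZr tprodZl.
rewrite -[in RHS](comp_lfun1r f) id_dec comp_lfun_sumr !linear_sum.
by apply: eq_bigr => j _; rewrite comp_lfunA [RHS]ltr_comm comp_lfunA.
Qed.

End Trace.

(** * Direct sums in linear categories *)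

Section Linear.
Variables (k : fieldType) (C : category k).

Lemma mcomp0l (X Y Z : C) (f : Mor X Y) : (0 : Mor Y Z) ∘ f = 0.
Proof. exact: (linear_fun0 (mcomp_linl f (Z := Z))). Qed.
Lemma mcomp0r (X Y Z : C) (g : Mor Y Z) : g ∘ (0 : Mor X Y) = 0.
Proof. exact: (linear_fun0 (mcomp_linr g (X := X))). Qed.
Lemma mcompDl (X Y Z : C) (f : Mor X Y) (g h : Mor Y Z) :
  (g + h) ∘ f = g ∘ f + h ∘ f.
Proof. by have := mcomp_linl f 1 g h; rewrite !scale1r. Qed.
Lemma mcompDr (X Y Z : C) (g : Mor Y Z) (f h : Mor X Y) :
  g ∘ (f + h) = g ∘ f + g ∘ h.
Proof. by have := mcomp_linr g 1 f h; rewrite !scale1r. Qed.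
Lemma mcompZl (X Y Z : C) a (f : Mor X Y) (g : Mor Y Z) :
  (a *: g) ∘ f = a *: (g ∘ f).
Proof. by have := mcomp_linl f a g 0; rewrite !addr0 mcomp0l addr0. Qed.
Lemma mcompZr (X Y Z : C) a (g : Mor Y Z) (f : Mor X Y) :
  g ∘ (a *: f) = a *: (g ∘ f).
Proof. by have := mcomp_linr g a f 0; rewrite !addr0 mcomp0r addr0. Qed.
Lemma mcompNl (X Y Z : C) (f : Mor X Y) (g : Mor Y Z) : (- g) ∘ f = - (g ∘ f).
Proof. by rewrite -scaleN1r mcompZl scaleN1r. Qed.
Lemma mcompNr (X Y Z : C) (g : Mor Y Z) (f : Mor X Y) : g ∘ (- f) = - (g ∘ f).
Proof. by rewrite -scaleN1r mcompZr scaleN1r. Qed.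
Lemma mcomp_suml (X Y Z : C) I (r : seq I) (P : pred I) (F : I -> Mor Y Z)
    (f : Mor X Y) :
  (\sum_(i <- r | P i) F i) ∘ f = \sum_(i <- r | P i) (F i ∘ f).
Proof. by apply: (big_morph (fun g => g ∘ f)) => [g h|]; rewrite ?mcompDl ?mcomp0l. Qed.
Lemma mcomp_sumr (X Y Z : C) I (r : seq I) (P : pred I) (F : I -> Mor X Y)
    (g : Mor Y Z) :
  g ∘ (\sum_(i <- r | P i) F i) = \sum_(i <- r | P i) (g ∘ F i).
Proof. by apply: (big_morph (fun f => g ∘ f)) => [f h|]; rewrite ?mcompDr ?mcomp0r. Qed.

Lemma mono_comp0 (X Y Z : C) (i : Mor X Y) (f : Mor Z X) :
  is_mono i -> i ∘ f = 0 -> f = 0.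
Proof. by move=> mi e; apply: mi; rewrite e mcomp0r. Qed.

Lemma epi_comp0 (X Y Z : C) (p : Mor X Y) (f : Mor Y Z) :
  is_epi p -> f ∘ p = 0 -> f = 0.
Proof. by move=> ep e; apply: ep; rewrite e mcomp0l. Qed.

Lemma split_mono (X Y : C) (i : Mor X Y) (p : Mor Y X) : p ∘ i = idm X -> is_mono i.
Proof. by move=> e Z g h /(congr1 (mcomp p)); rewrite !mcompA e !mcomp1m. Qed.

Lemma split_epi (X Y : C) (i : Mor X Y) (p : Mor Y X) : p ∘ i = idm X -> is_epi p.
Proof. by move=> e Z g h /(congr1 (mcomp^~ i)); rewrite -!mcompA e !mcompm1. Qed.

Lemma is_iso_comp (X Y Z : C) (g : Mor Y Z) (f : Mor X Y) :
  is_iso g -> is_iso f -> is_iso (g ∘ f).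
Proof.
move=> [g' [g'g gg']] [f' [f'f ff']]; exists (f' ∘ g'); split.
  by rewrite -mcompA (mcompA g') g'g mcomp1m.
by rewrite -mcompA (mcompA f) ff' mcomp1m.
Qed.

Lemma isomorphic_sym (X Y : C) : isomorphic X Y -> isomorphic Y X.
Proof. by move=> [f [g [gf fg]]]; exists g, f. Qed.
Lemma isomorphic_trans (X Y Z : C) :
  isomorphic X Y -> isomorphic Y Z -> isomorphic X Z.
Proof. by move=> [f ff] [g gg]; exists (g ∘ f); apply: is_iso_comp. Qed.
Lemma isomorphic_refl (X : C) : isomorphic X X.
Proof. by exists (idm X), (idm X); rewrite mcomp1m. Qed.

(** A direct sum decomposition amounts to a complete family of orthogonal idempotents,
    each split through its summand. In this form no map depends on the index
    through its source, so that decompositions can be pasted together. *)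
Lemma direct_sumI n (S : 'I_n -> C) (X : C) (e : 'I_n -> Mor X X) :
  (forall a, exists (i : Mor (S a) X) (p : Mor X (S a)),
     p ∘ i = idm (S a) /\ i ∘ p = e a) ->
  (forall a b, a != b -> e a ∘ e b = 0) -> \sum_a e a = idm X ->
  is_direct_sum S X.
Proof.
move=> spl orth sum1.
pose i a := projT1 (cid (spl a)); pose p a := projT1 (cid (projT2 (cid (spl a)))).
have pi a : p a ∘ i a = idm (S a) := proj1 (projT2 (cid (projT2 (cid (spl a))))).
have ip a : i a ∘ p a = e a := proj2 (projT2 (cid (projT2 (cid (spl a))))).
exists i, p; split=> // [a b ne|]; last by rewrite -sum1; apply: eq_bigr.
apply: (mono_comp0 (split_mono (pi a))); apply: (epi_comp0 (split_epi (pi b))).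
by rewrite mcompA ip -mcompA ip orth.
Qed.

Definition biproduct (X Y Z : C) := exists (i : Mor X Z) (p : Mor Z X)
    (j : Mor Y Z) (q : Mor Z Y),
  [/\ p ∘ i = idm X, q ∘ j = idm Y, p ∘ j = 0, q ∘ i = 0
    & i ∘ p + j ∘ q = idm Z].

Lemma direct_sum_cat n1 n2 (S : 'I_(n1 + n2) -> C) (X Y Z : C) :
  is_direct_sum (fun a => S (lshift n2 a)) X ->
  is_direct_sum (fun a => S (rshift n1 a)) Y -> biproduct X Y Z ->
  is_direct_sum S Z.
Proof.
move=> [i1 [p1 [pi1 o1 s1]]] [i2 [p2 [pi2 o2 s2]]] [i [p [j [q [pi qj pj qi s]]]]].
pose e a := match split a with
  | inl b => i ∘ (i1 b ∘ p1 b) ∘ p | inr b => j ∘ (i2 b ∘ p2 b) ∘ q end.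
have el b : e (lshift n2 b) = i ∘ (i1 b ∘ p1 b) ∘ p by rewrite /e (unsplitK (inl b)).
have er b : e (rshift n1 b) = j ∘ (i2 b ∘ p2 b) ∘ q by rewrite /e (unsplitK (inr b)).
apply: (direct_sumI (e := e)).
- move=> a; case: (split_ordP a) => b ->; rewrite ?el ?er.
    exists (i ∘ i1 b), (p1 b ∘ p); split; last by rewrite !mcompA.
    by rewrite -mcompA (mcompA p) pi mcomp1m pi1.
  exists (j ∘ i2 b), (p2 b ∘ q); split; last by rewrite !mcompA.
  by rewrite -mcompA (mcompA q) qj mcomp1m pi2.
- move=> a b; case: (split_ordP a) => {}a ->; case: (split_ordP b) => {}b ->;
    rewrite ?(inj_eq (@lshift_inj _ _)) ?(inj_eq (@rshift_inj _ _)) ?el ?er => ne.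
  + rewrite -!mcompA (mcompA p) pi mcomp1m.
    by rewrite (mcompA (p1 a)) o1 // mcomp0l !mcomp0r.
  + by rewrite -!mcompA (mcompA p) pj mcomp0l !mcomp0r.
  + by rewrite -!mcompA (mcompA q) qi mcomp0l !mcomp0r.
  + rewrite -!mcompA (mcompA q) qj mcomp1m.
    by rewrite (mcompA (p2 a)) o2 // mcomp0l !mcomp0r.
- rewrite big_split_ord /=; under eq_bigr => b _ do rewrite el.
  under [X in _ + X]eq_bigr => b _ do rewrite er.
  by rewrite -!mcomp_suml -!mcomp_sumr s1 s2 !mcompm1.
Qed.

Lemma direct_sum0 (S : 'I_0 -> C) (X : C) : is_zero X -> is_direct_sum S X.
Proof.
move=> X0; apply: (direct_sumI (e := fun _ => 0)); try by case.
by rewrite big_ord0 -X0.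
Qed.

Lemma direct_sum1 (S : 'I_1 -> C) : is_direct_sum S (S ord0).
Proof.
apply: (direct_sumI (e := fun _ => idm _)) => [a|a b|]; last by rewrite big_ord1.
  by rewrite [a]ord1; exists (idm _), (idm _); rewrite mcomp1m.
by rewrite [a]ord1 [b]ord1.
Qed.

Lemma direct_sum_join n1 n2 (S1 : 'I_n1 -> C) (S2 : 'I_n2 -> C) (X Y Z : C) :
  is_direct_sum S1 X -> is_direct_sum S2 Y -> biproduct X Y Z ->
  is_direct_sum (fun a => match split a with inl b => S1 b | inr b => S2 b end) Z.
Proof.
move=> d1 d2; apply: direct_sum_cat.
  suff -> : (fun a => match split (lshift n2 a) with inl b => S1 b | inr b => S2 b end) = S1.
    by [].
  by apply: funext => a; rewrite (unsplitK (inl a)).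
suff -> : (fun a => match split (rshift n1 a) with inl b => S1 b | inr b => S2 b end) = S2.
  by [].
by apply: funext => a; rewrite (unsplitK (inr a)).
Qed.

Lemma all_direct_sums : (exists Z : C, is_zero Z) ->
  (forall X Y : C, exists Z, biproduct X Y Z) ->
  forall n (S : 'I_n -> C), exists X, is_direct_sum S X.
Proof.
move=> [Z Z0] bip; elim=> [|n IH] S; first by exists Z; apply: direct_sum0.
have [Y dY] := IH (fun a => S (rshift 1 a)).
have [W bW] := bip (S (@lshift 1 n ord0)) Y.
exists W; apply: (direct_sum_cat (n1 := 1) (n2 := n)) dY bW.
exact: (direct_sum1 (fun a => S (@lshift 1 n a))).
Qed.

End Linear.

(** * Categories of representations of a separable algebra *)

(** A category whose objects are finite dimensional vector spaces with a family of
    operators and whose morphisms are the linear maps commuting with them, for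
    operators that generate a finite dimensional separable algebra. The operators
    [cc_A t] and [cc_B t] are the components of a symmetric separability
    idempotent, by which any linear map is averaged into a morphism. The field
    [cc_lift] says that the defining relations of the operators are inherited by
    every space that embeds into finitely many objects, which covers subobjects
    (one object), direct sums (two objects) and the zero object (none). The object
    of [cc_gen] plays the role of the regular representation. *)
Record concrete (k : fieldType) (C : category k) := Concrete {
  cc_und : C -> vectType k;
  cc_map : forall M N : C, Mor M N -> 'Hom(cc_und M, cc_und N);
  cc_inj : forall M N : C, injective (@cc_map M N);
  cc_linear : forall M N : C, linear (@cc_map M N);
  cc_id : forall M : C, cc_map (idm M) = \1%VF;
  cc_comp : forall (M N P : C) (g : Mor N P) (f : Mor M N),
    cc_map (g ∘ f) = (cc_map g \o cc_map f)%VF;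
  cc_ops : Type;
  cc_op : forall M : C, cc_ops -> 'End(cc_und M);
  cc_nat : forall (M N : C) (f : Mor M N) j,
    (cc_map f \o cc_op M j = cc_op N j \o cc_map f)%VF;
  cc_full : forall (M N : C) (f : 'Hom(cc_und M, cc_und N)),
    (forall j, f \o cc_op M j = cc_op N j \o f)%VF -> exists g, cc_map g = f;
  cc_lift : forall (W : vectType k) (T : cc_ops -> 'End(W)) n (M : 'I_n -> C)
      (i : forall a, 'Hom(W, cc_und (M a))),
    (forall a j, i a \o T j = cc_op (M a) j \o i a)%VF ->
    (forall w, (forall a, i a w = 0) -> w = 0) ->
    exists (N : C) (f : 'Hom(cc_und N, W)) (g : 'Hom(W, cc_und N)),
      [/\ (f \o g = \1)%VF, (g \o f = \1)%VF
        & forall j, (f \o cc_op N j = T j \o f)%VF];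
  cc_idx : finType;
  cc_A : forall M : C, cc_idx -> 'End(cc_und M);
  cc_B : forall M : C, cc_idx -> 'End(cc_und M);
  cc_natA : forall (M N : C) (f : Mor M N) t,
    (cc_map f \o cc_A M t = cc_A N t \o cc_map f)%VF;
  cc_natB : forall (M N : C) (f : Mor M N) t,
    (cc_map f \o cc_B M t = cc_B N t \o cc_map f)%VF;
  cc_avg_op : forall (M N : C) (f : 'Hom(cc_und M, cc_und N)) j,
    ((\sum_t (cc_B N t \o f \o cc_A M t)) \o cc_op M j =
     cc_op N j \o (\sum_t (cc_B N t \o f \o cc_A M t)))%VF;
  cc_BA : forall M : C, (\sum_t (cc_B M t \o cc_A M t) = \1)%VF;
  cc_AB : forall M : C, (\sum_t (cc_A M t \o cc_B M t) = \1)%VF;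
  cc_gen : exists R : C, forall M : C, ~ is_zero M -> exists f : Mor R M, f <> 0
}.

Arguments cc_op {k C} c M j : rename.
Arguments cc_A {k C} c M t : rename.
Arguments cc_B {k C} c M t : rename.
Arguments cc_BA {k C} c M : rename.
Arguments cc_AB {k C} c M : rename.
Arguments cc_full {k C} c {M N f} _ : rename.

Section Concrete.
Variables (k : fieldType) (C : category k) (cc : concrete C).
Local Notation und := (cc_und cc).
Local Notation map := (cc_map cc).
Implicit Types M N P : C.

HB.instance Definition _ M N := GRing.isLinear.Build k (Mor M N) 'Hom(und M, und N)
  *:%R (@cc_map _ _ cc M N) (@cc_linear _ _ cc M N).

Definition inj_mor M N (f : Mor M N) := lker (map f) == 0%VS.
Definition surj_mor M N (f : Mor M N) := limg (map f) == fullv.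

Lemma inj_morP M N (f : Mor M N) : reflect (injective (map f)) (inj_mor f).
Proof. exact: lker0P. Qed.

Lemma inj_mono M N (f : Mor M N) : inj_mor f -> is_mono f.
Proof.
move=> fi Z g h /(congr1 (@cc_map _ _ cc _ _)); rewrite !cc_comp => e.
apply: (@cc_inj _ _ cc); apply/lfunP=> v; apply: (inj_morP _ fi).
by rewrite -!comp_lfunE e.
Qed.

Lemma surj_epi M N (f : Mor M N) : surj_mor f -> is_epi f.
Proof.
move=> /eqP fs Z g h /(congr1 (@cc_map _ _ cc _ _)); rewrite !cc_comp => e.
apply: (@cc_inj _ _ cc); apply/lfunP=> v.
have /memv_imgP[u _ ->] : v \in limg (map f) by rewrite fs memvf.
by rewrite -!comp_lfunE e.
Qed.

Lemma subobject M (W : {vspace und M}) :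
  (forall j v, v \in W -> cc_op cc M j v \in W) ->
  exists (N : C) (i : Mor N M), inj_mor i /\ limg (map i) = W.
Proof.
move=> stab; pose inc : 'Hom(subvs_of W, und M) := linfun vsval.
have incE w : inc w = vsval w by rewrite lfunE.
have [T nat] : exists T : cc_ops cc -> 'End(subvs_of W), forall j,
    (inc \o T j = cc_op cc M j \o inc)%VF.
  exists (fun j => linfun (vsproj W) \o cc_op cc M j \o inc)%VF => j.
  apply/lfunP=> w; rewrite !comp_lfunE incE [linfun _ _]lfunE /=.
  by rewrite vsprojK // stab // incE subvsP.
have [|w /(_ ord0)|N [f [g [fg gf fT]]]] :=
    @cc_lift _ _ cc _ T 1 (fun=> M) (fun=> inc).
- by move=> _; apply: nat.
- by rewrite incE => e; apply: val_inj.
have [|i ei] := @cc_full _ _ cc N M (inc \o f)%VF.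
  by move=> j; rewrite -comp_lfunA fT !comp_lfunA nat.
exists N, i; split.
  apply/inj_morP=> x y; rewrite ei !comp_lfunE !incE => /val_inj e.
  by rewrite -[x]id_lfunE -[y]id_lfunE -gf !comp_lfunE e.
apply/vspaceP=> v; rewrite ei; apply/memv_imgP/idP => [[u _ ->]|vW].
  by rewrite comp_lfunE incE subvsP.
exists (g (vsproj W v)); rewrite ?memvf // -comp_lfunE -comp_lfunA fg comp_lfun1r.
by rewrite incE vsprojK.
Qed.

Lemma lift_inj M N P (i : Mor N M) (g : Mor P M) : inj_mor i ->
  (limg (map g) <= limg (map i))%VS -> exists h, i ∘ h = g.
Proof.
move=> ii /subvP le; have [h ih] : exists h, (map i \o h = map g)%VF.
  exists ((map i)^-1 \o map g)%VF.
  by apply/lfunP=> v; rewrite !comp_lfunE limg_lfunVK // le // memv_img ?memvf.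
have [|h' e] := @cc_full _ _ cc _ _ h.
  move=> j; apply/lfunP=> v; apply: (inj_morP _ ii); rewrite -!comp_lfunE.
  by rewrite !comp_lfunA ih !cc_nat -comp_lfunA ih.
by exists h'; apply: (@cc_inj _ _ cc); rewrite cc_comp e.
Qed.

Lemma desc_surj M N P (p : Mor M N) (g : Mor M P) : surj_mor p ->
  (lker (map p) <= lker (map g))%VS -> exists h, h ∘ p = g.
Proof.
move=> ps /subvP le; have pV v : map p ((map p)^-1%VF v) = v.
  by rewrite limg_lfunVK // (eqP ps) memvf.
have [h hp] : exists h, (h \o map p = map g)%VF.
  exists (map g \o (map p)^-1)%VF.
  apply/lfunP=> v; rewrite !comp_lfunE; apply/eqP; rewrite -subr_eq0 -linearB.
  by rewrite -memv_ker le // memv_ker linearB /= pV subrr.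
have [|h' e] := @cc_full _ _ cc _ _ h.
  move=> j; apply/lfunP=> v; rewrite -(pV v) -!(comp_lfunE _ (map p)).
  rewrite -!comp_lfunA hp -cc_nat comp_lfunA hp.
  by rewrite cc_nat.
by exists h'; apply: (@cc_inj _ _ cc); rewrite cc_comp e.
Qed.

Lemma image_factor M N (f : Mor M N) :
  exists (I : C) (p : Mor M I) (i : Mor I N),
    [/\ surj_mor p, inj_mor i, i ∘ p = f & limg (map i) = limg (map f)].
Proof.
have [j v /memv_imgP[u _ ->]|I [i [ii li]]] := @subobject N (limg (map f)).
  by rewrite -comp_lfunE -cc_nat comp_lfunE memv_img ?memvf.
have [|p ip] := @lift_inj _ _ _ i f ii; first by rewrite li.
exists I, p, i; split=> //; rewrite /surj_mor; apply/eqP/vspaceP=> v; rewrite memvf.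
have /memv_imgP[u _] : map i v \in limg (map f) by rewrite -li memv_img ?memvf.
rewrite -ip cc_comp comp_lfunE => /(inj_morP _ ii) ->.
by rewrite memv_img ?memvf.
Qed.

Lemma kernel M N (f : Mor M N) : exists (K : C) (i : Mor K M),
  [/\ inj_mor i, limg (map i) = lker (map f) & is_ker f i].
Proof.
have [j v|K [i [ii li]]] := @subobject M (lker (map f)).
  by rewrite !memv_ker -comp_lfunE cc_nat comp_lfunE => /eqP ->; rewrite linear0.
exists K, i; split=> //; split=> [|Z g fg].
  apply: (@cc_inj _ _ cc); rewrite cc_comp linear0; apply/lfunP=> v.
  by rewrite comp_lfunE zero_lfunE; apply/eqP; rewrite -memv_ker -li memv_img ?memvf.
have [|h ih] := @lift_inj _ _ _ i g ii.
  rewrite li; apply/subvP=> _ /memv_imgP[u _ ->].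
  by rewrite memv_ker -comp_lfunE -cc_comp fg linear0 zero_lfunE.
by exists h; split=> // h' ih'; apply: (inj_mono ii); rewrite ih ih'.
Qed.

Definition avg M N (f : 'Hom(und M, und N)) : 'Hom(und M, und N) :=
  (\sum_t (cc_B cc N t \o f \o cc_A cc M t))%VF.

Lemma avg_mor M N (f : 'Hom(und M, und N)) : exists g : Mor M N, map g = avg f.
Proof. by apply: cc_full => j; apply: cc_avg_op. Qed.

(** Averaging a linear projection onto the image of [f], as in the proof of
    Maschke's theorem. *)
Lemma image_projection M N (f : Mor M N) : exists q : Mor N N,
  limg (map q) = limg (map f) /\ (forall v, v \in limg (map f) -> map q v = v).
Proof.
pose W := limg (map f); have [q eq] := avg_mor (projv W).
have stA t v : v \in W -> cc_A cc N t v \in W.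
  by case/memv_imgP=> u _ ->; rewrite -comp_lfunE -cc_natA comp_lfunE memv_img ?memvf.
have stB t v : v \in W -> cc_B cc N t v \in W.
  by case/memv_imgP=> u _ ->; rewrite -comp_lfunE -cc_natB comp_lfunE memv_img ?memvf.
have qW v : map q v \in W.
  rewrite eq sum_lfunE; apply: memv_suml => t _.
  by rewrite !comp_lfunE stB // memv_proj.
have qid v : v \in W -> map q v = v.
  move=> vW; rewrite eq sum_lfunE -[RHS]id_lfunE -(cc_BA cc N) sum_lfunE.
  by apply: eq_bigr => t _; rewrite !comp_lfunE projv_id // stA.
exists q; split=> //; apply/vspaceP=> v; apply/memv_imgP/idP => [[u _ ->] //|vW].
by exists v; rewrite ?memvf // qid.
Qed.

Lemma cokernel M N (f : Mor M N) : exists (Q : C) (p : Mor N Q),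
  [/\ surj_mor p, lker (map p) = limg (map f) & is_coker f p].
Proof.
have [q [lq qid]] := image_projection f.
have [Q [p [i [ps ii ip _]]]] := image_factor (idm N - q).
have kp : lker (map p) = limg (map f).
  apply/vspaceP=> v; rewrite memv_ker -(inj_eq (inj_morP _ ii)) linear0 -comp_lfunE.
  rewrite -cc_comp ip linearB /= cc_id add_lfunE opp_lfunE id_lfunE subr_eq0.
  apply/eqP/idP => [->|/qid //]; by rewrite -lq memv_img ?memvf.
exists Q, p; split=> //; split=> [|Z g gf].
  apply: (@cc_inj _ _ cc); rewrite cc_comp linear0; apply/lfunP=> v.
  by rewrite comp_lfunE zero_lfunE; apply/eqP; rewrite -memv_ker kp memv_img ?memvf.
have [|h hp] := @desc_surj _ _ _ p g ps.
  rewrite kp; apply/subvP=> _ /memv_imgP[u _ ->].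
  by rewrite memv_ker -comp_lfunE -cc_comp gf linear0 zero_lfunE.
by exists h; split=> // h' hp'; apply: (surj_epi ps); rewrite hp hp'.
Qed.

Lemma mono_inj M N (f : Mor M N) : is_mono f -> inj_mor f.
Proof.
move=> fm; have [K [i [_ li [fi _]]]] := kernel f.
rewrite /inj_mor -li (mono_comp0 fm fi) linear0 -subv0.
by apply/subvP=> _ /memv_imgP[u _ ->]; rewrite zero_lfunE mem0v.
Qed.

Lemma epi_surj M N (f : Mor M N) : is_epi f -> surj_mor f.
Proof.
move=> fe; have [Q [p [_ kp [pf _]]]] := cokernel f.
rewrite /surj_mor -kp (epi_comp0 fe pf) linear0.
by apply/eqP/vspaceP=> v; rewrite memvf memv_ker zero_lfunE eqxx.
Qed.

Lemma bij_iso M N (f : Mor M N) : inj_mor f -> surj_mor f -> is_iso f.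
Proof.
move=> fi fs; have [|g fg] := @lift_inj _ _ _ f (idm N) fi.
  by rewrite (eqP fs) subvf.
by exists g; split=> //; apply: (inj_mono fi); rewrite mcompA fg mcompm1 mcomp1m.
Qed.

Lemma dim_zero M : \dim {:und M} = 0%N -> is_zero M.
Proof.
move=> /eqP; rewrite dimv_eq0 => /eqP M0; apply: (@cc_inj _ _ cc).
apply/lfunP=> v; have : v \in {:und M}%VS by rewrite memvf.
by rewrite M0 memv0 => /eqP ->; rewrite !linear0.
Qed.

Lemma zero_exists : exists Z : C, is_zero Z.
Proof.
have [R _] := cc_gen cc.
have [[//]|w _|N [f [g [_ gf _]]]] :=
    @cc_lift _ _ cc (subvs_of (0%VS : {vspace k^o})) (fun=> 0) 0 (fun=> R) (fun=> 0).
  by apply: val_inj; apply/eqP; rewrite -memv0 subvsP.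
exists N; apply: (@cc_inj _ _ cc); rewrite cc_id linear0 -gf.
suff -> : f = 0 by rewrite comp_lfun0r.
by apply/lfunP=> v; apply: val_inj; apply/eqP; rewrite zero_lfunE -memv0 subvsP.
Qed.

Lemma biproduct_exists M N : exists P, biproduct M N P.
Proof.
pose W : vectType k := (und M * und N)%type.
pose p1 : 'Hom(W, und M) := linfun fst; pose p2 : 'Hom(W, und N) := linfun snd.
have p1E w : p1 w = w.1 by rewrite lfunE.
have p2E w : p2 w = w.2 by rewrite lfunE.
have l1 : linear (fun v : und M => (v, 0) : W).
  by move=> a x y; congr (_, _) => /=; rewrite scaler0 addr0.
have l2 : linear (fun v : und N => (0, v) : W).
  by move=> a x y; congr (_, _) => /=; rewrite scaler0 addr0.
pose L1 := GRing.isLinear.Build k (und M) W *:%R _ l1.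
pose L2 := GRing.isLinear.Build k (und N) W *:%R _ l2.
pose F1 : {linear und M -> W} := HB.pack (fun v : und M => (v, 0) : W) L1.
pose F2 : {linear und N -> W} := HB.pack (fun v : und N => (0, v) : W) L2.
pose i1 : 'Hom(und M, W) := linfun F1; pose i2 : 'Hom(und N, W) := linfun F2.
have i1E v : i1 v = (v, 0) by rewrite (lfunE F1).
have i2E v : i2 v = (0, v) by rewrite (lfunE F2).
have [T [T1 T2]] : exists T : cc_ops cc -> 'End(W),
    (forall j, p1 \o T j = cc_op cc M j \o p1)%VF /\
    (forall j, p2 \o T j = cc_op cc N j \o p2)%VF.
  exists (fun j => (i1 \o cc_op cc M j \o p1) + (i2 \o cc_op cc N j \o p2))%VF.
  by split=> j; apply/lfunP=> w; rewrite comp_lfunE add_lfunE !comp_lfunE i1E i2E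
    ?p1E ?p2E /= ?addr0 ?add0r.
have Ti j : (T j \o i1 = i1 \o cc_op cc M j)%VF.
  apply/lfunP=> v; rewrite comp_lfunE [LHS]surjective_pairing -p1E -p2E -!comp_lfunE.
  rewrite T1 T2 !comp_lfunE p1E p2E i1E /= linear0.
  by rewrite i1E.
have Tj j : (T j \o i2 = i2 \o cc_op cc N j)%VF.
  apply/lfunP=> v; rewrite comp_lfunE [LHS]surjective_pairing -p1E -p2E -!comp_lfunE.
  rewrite T1 T2 !comp_lfunE p1E p2E i2E /= linear0.
  by rewrite i2E.
have [|w e|P [f [g [fg gf fT]]]] := @cc_lift _ _ cc W T 2 (fun a => if a == ord0 then M else N)
    (fun a => if a == ord0 as b return 'Hom(W, und (if b then M else N)) then p1 else p2).
- by move=> a j; case: (a == ord0).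
- rewrite [w]surjective_pairing -p1E -p2E.
  by rewrite (e ord0) (e (Ordinal (isT : 1 < 2)%N)).
have gT j : (g \o T j = cc_op cc P j \o g)%VF.
  rewrite -[RHS]comp_lfun1l -gf -[RHS]comp_lfunA [X in _ = (_ \o X)%VF]comp_lfunA fT.
  by rewrite -[X in _ = (_ \o X)%VF]comp_lfunA fg comp_lfun1r.
have [j|i ei] := @cc_full _ _ cc M P (g \o i1)%VF.
  by rewrite -comp_lfunA -Ti !comp_lfunA gT.
have [j|p ep] := @cc_full _ _ cc P M (p1 \o f)%VF.
  by rewrite -comp_lfunA fT !comp_lfunA T1.
have [j|j ej] := @cc_full _ _ cc N P (g \o i2)%VF.
  by rewrite -comp_lfunA -Tj !comp_lfunA gT.
have [j'|q eq] := @cc_full _ _ cc P N (p2 \o f)%VF.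
  by rewrite -comp_lfunA fT !comp_lfunA T2.
exists P, i, p, j, q; split; apply: (@cc_inj _ _ cc); rewrite ?cc_comp ?cc_id ?linear0;
  rewrite ?linearD /= ?cc_comp ?ei ?ep ?ej ?eq.
- rewrite -comp_lfunA (comp_lfunA f) fg comp_lfun1l; apply/lfunP=> v.
  by rewrite comp_lfunE i1E p1E id_lfunE.
- rewrite -comp_lfunA (comp_lfunA f) fg comp_lfun1l; apply/lfunP=> v.
  by rewrite comp_lfunE i2E p2E id_lfunE.
- rewrite -comp_lfunA (comp_lfunA f) fg comp_lfun1l; apply/lfunP=> v.
  by rewrite comp_lfunE i2E p1E zero_lfunE.
- rewrite -comp_lfunA (comp_lfunA f) fg comp_lfun1l; apply/lfunP=> v.
  by rewrite comp_lfunE i1E p2E zero_lfunE.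
- rewrite -gf -!comp_lfunA -comp_lfunDr; congr (_ \o _)%VF.
  apply/lfunP=> v; rewrite add_lfunE !comp_lfunE i1E i2E p1E p2E.
  by rewrite [RHS]surjective_pairing; congr (_, _); rewrite /= ?addr0 ?add0r.
Qed.

Lemma concrete_abelian : abelian_category C.
Proof.
split=> [n S|M N f|M N f|M N f fm|M N f fe].
- by apply: all_direct_sums; [apply: zero_exists | apply: biproduct_exists].
- by have [K [i [_ _ ki]]] := kernel f; exists K, i.
- by have [Q [p [_ _ cp]]] := cokernel f; exists Q, p.
- have [Q [p [_ kp [pf _]]]] := cokernel f; exists Q, p; split=> // Z g pg.
  have fi := mono_inj fm; have [|h fh] := @lift_inj _ _ _ f g fi.
    rewrite -kp; apply/subvP=> _ /memv_imgP[u _ ->].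
    by rewrite memv_ker -comp_lfunE -cc_comp pg linear0 zero_lfunE.
  by exists h; split=> // h' fh'; apply: fm; rewrite fh fh'.
- have [K [i [_ li [fi _]]]] := kernel f; exists K, i; split=> // Z g gi.
  have fs := epi_surj fe; have [|h hf] := @desc_surj _ _ _ f g fs.
    rewrite -li; apply/subvP=> _ /memv_imgP[u _ ->].
    by rewrite memv_ker -comp_lfunE -cc_comp gi linear0 zero_lfunE.
  by exists h; split=> // h' hf'; apply: fe; rewrite hf hf'.
Qed.

Lemma inj_noniso_dim M N (f : Mor M N) :
  inj_mor f -> ~ is_iso f -> (\dim {:und M} < \dim {:und N})%N.
Proof.
move=> fi fn; rewrite -(limg_dim_eq (f := map f)); last first.
  by rewrite (eqP fi) capv0.
rewrite ltn_neqAle dimvS ?subvf // andbT; apply/negP=> e; apply: fn; apply: bij_iso => //.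
by rewrite /surj_mor eqEdim subvf (eqP e) leqnn.
Qed.

(** An averaged projection onto the image of [i] splits [i]. *)
Lemma mono_biproduct M N (i : Mor M N) : is_mono i ->
  exists (P : C) (p : Mor N M) (j : Mor P N) (q : Mor N P),
  [/\ p ∘ i = idm M, q ∘ j = idm P, p ∘ j = 0, q ∘ i = 0 & i ∘ p + j ∘ q = idm N].
Proof.
move=> im; have ii := mono_inj im; have [r [lr rid]] := image_projection i.
have [|p ip] := @lift_inj _ _ _ i r ii; first by rewrite lr.
have ri : r ∘ i = i.
  apply: (@cc_inj _ _ cc); apply/lfunP=> v.
  by rewrite cc_comp comp_lfunE rid // memv_img ?memvf.
have rr : r ∘ r = r by rewrite -{2}ip mcompA ri.
have [P [q [j [qs ji jq _]]]] := image_factor (idm N - r).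
have [jm qe] := (inj_mono ji, surj_epi qs).
have sum1 : i ∘ p + j ∘ q = idm N by rewrite ip jq addrC subrK.
have pi : p ∘ i = idm M by apply: im; rewrite mcompA ip ri mcompm1.
have qi : q ∘ i = 0.
  by apply: jm; rewrite mcompA jq mcomp0r mcompDl mcomp1m mcompNl ri subrr.
have r0 : r ∘ (idm N - r) = 0.
  by rewrite mcompDr mcompm1 mcompNr rr subrr.
exists P, p, j, q; split=> //.
  apply: jm; apply: qe; rewrite mcompA jq mcompm1 -mcompA jq.
  by rewrite mcompDl mcomp1m mcompNl r0 oppr0 addr0.
by apply: qe; apply: im; rewrite -mcompA jq mcomp0l mcomp0r mcompA ip.
Qed.
End Concrete.

(** * Simple objects and their characters *)

Section Simple.
Variables (k : fieldType) (C : category k) (cc : concrete C).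
Local Notation und := (cc_und cc).
Local Notation map := (cc_map cc).
Implicit Types M N P : C.

Lemma simple_direct_sum M : exists n (S : 'I_n -> C),
  (forall a, simple_object (S a)) /\ is_direct_sum S M.
Proof.
have [m] := ubnP (\dim {:und M}); elim: m M => // m IH M; rewrite ltnS => le_m.
have [M0|nM0] := pselect (is_zero M).
  by exists 0%N, (fun=> M); split; [case | apply: direct_sum0].
have [sM|nsM] := pselect (simple_object M).
  by exists 1%N, (fun=> M); split=> //; apply: (direct_sum1 (fun=> M)).
have [Y [i [im i0 ni]]] : exists (Y : C) (i : Mor Y M),
    [/\ is_mono i, i <> 0 & ~ is_iso i].
  apply/not_existsP => nY; apply: nsM; split=> // Y i im.
  have [|i0] := pselect (i = 0); first by left.
  have [|ni] := pselect (is_iso i); first by right.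
  by case: (nY Y); exists i.
have [Z [p [j [q [pi qj pj qi s]]]]] := mono_biproduct cc im.
have nj : ~ is_iso j.
  move=> [j' [_ jj']]; apply: i0; have p0 : p = 0.
    by rewrite -[p]mcompm1 -jj' mcompA pj mcomp0l.
  by rewrite -[i]mcompm1 -pi p0 mcomp0l mcomp0r.
have dY := inj_noniso_dim (mono_inj cc im) ni.
have dZ := inj_noniso_dim (mono_inj cc (split_mono qj)) nj.
have [n1 [S1 [s1 d1]]] := IH Y (leq_trans dY le_m).
have [n2 [S2 [s2 d2]]] := IH Z (leq_trans dZ le_m).
exists (n1 + n2)%N, (fun a => match split a with inl b => S1 b | inr b => S2 b end).
split; first by move=> a; case: (split a).
by apply: direct_sum_join d1 d2 _; exists i, p, j, q.
Qed.

Lemma concrete_semisimple : semisimple_category C.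
Proof. by move=> M; have [n [S [sS dS]]] := simple_direct_sum M; exists n, S. Qed.

(** The kernel of a nonzero morphism out of a simple object vanishes; a monomorphism into
    a simple object is invertible. *)
Lemma schur M N (f : Mor M N) : simple_object M -> simple_object N -> f <> 0 -> is_iso f.
Proof.
move=> [_ sM] [_ sN] f0; have [K [i [ii li _]]] := kernel cc f.
have fi : inj_mor cc f.
  case: (sM K i (inj_mono ii)) => [i0|[j [_ ij]]].
    rewrite /inj_mor -li i0 linear0 -subv0.
    by apply/subvP=> _ /memv_imgP[u _ ->]; rewrite zero_lfunE mem0v.
  case: f0; apply: (@cc_inj _ _ cc); rewrite linear0; apply/lfunP=> v.
  rewrite zero_lfunE; apply/eqP; rewrite -memv_ker -li.
  by rewrite -[v]id_lfunE -(cc_id cc) -ij cc_comp comp_lfunE memv_img ?memvf.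
by case: (sN M f (inj_mono fi)).
Qed.

Lemma simple_dim M : simple_object M -> (0 < \dim {:und M})%N.
Proof. by move=> [nz _]; rewrite lt0n; apply/eqP => /(@dim_zero _ _ cc _). Qed.

(** The simple summands of the generating object exhaust the simple objects, by
    Schur's lemma; it remains to discard repetitions. *)
Lemma finite_simples : exists n (L : 'I_n -> C), simple_representatives L.
Proof.
have [R gen] := cc_gen cc; have [n [S [sS [i [p [pi o s]]]]]] := simple_direct_sum R.
pose e a b := `[<isomorphic (S a) (S b)>].
pose A := [set a : 'I_n | [forall b : 'I_n, (b < a)%N ==> ~~ e a b]].
exists #|A|, (fun a => S (enum_val a)); split=> [a|a b iso|M sM]; first exact: sS.
- apply: enum_val_inj; apply/eqP; apply/negP=> /negP ne.
  have := enum_valP a; have := enum_valP b; rewrite !inE.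
  move=> /forallP/(_ (enum_val a)) eb /forallP/(_ (enum_val b)) ea.
  case: (ltngtP (enum_val a) (enum_val b)) => [lt|lt|/val_inj eq].
  + by move: eb; rewrite lt /= => /asboolP; apply; apply: isomorphic_sym.
  + by move: ea; rewrite lt /= => /asboolP; apply.
  + by rewrite eq eqxx in ne.
- have [f f0] := gen M sM.1.
  have [a fa] : exists a, f ∘ i a <> 0.
    apply/not_existsP=> z; apply: f0; rewrite -[f]mcompm1 -s mcomp_sumr big1 // => a _.
    by rewrite mcompA (contrapT (z a)) mcomp0l.
  have Ma : isomorphic M (S a).
    by apply: isomorphic_sym; exists (f ∘ i a); apply: schur.
  have [b eb minb] := @arg_minnP _ a (e a) val (asboolT (isomorphic_refl (S a))).
  have bA : b \in A.
    rewrite inE; apply/forallP=> c; apply/implyP=> lt; apply/asboolP=> bc.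
    have /minb : e a c by apply/asboolP; apply: isomorphic_trans (asboolW eb) bc.
    by rewrite leqNgt lt.
  exists (enum_rank_in bA b); rewrite enum_rankK_in //.
  exact: isomorphic_trans Ma (asboolW eb).
Qed.

(** Every object is a direct sum of simple ones, and naturality moves [h M] past the
    inclusions of the summands. *)
Lemma natural_zero (h : forall M, 'End(und M)) :
  (forall M N (f : Mor M N), map f \o h M = h N \o map f)%VF ->
  (forall M, simple_object M -> h M = 0) -> forall M, h M = 0.
Proof.
move=> nat hs M; have [n [S [sS [i [p [_ _ s]]]]]] := simple_direct_sum M.
rewrite -[LHS]comp_lfun1r -(cc_id cc) -s linear_sum comp_lfun_sumr big1 // => a _.
by rewrite /= cc_comp comp_lfunA -nat hs // comp_lfun0r comp_lfun0l.
Qed.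

(** The sum of products of traces is the sum of the diagonal entries of the averages of all
    rank one maps; these averages are morphisms, so that Schur's lemma applies to them. *)
Lemma avg_matrix M N : \sum_t ltr (cc_A cc M t) * ltr (cc_B cc N t) =
  \sum_i \sum_j coord (vbasis {:und N}) j
    (avg (cc := cc) (elem_map i j : 'Hom(und M, und N)) (vbasis {:und M})`_i).
Proof.
transitivity (\sum_t \sum_i \sum_j coord (vbasis {:und M}) i (cc_A cc M t (vbasis {:und M})`_i)
    * coord (vbasis {:und N}) j (cc_B cc N t (vbasis {:und N})`_j)).
  apply: eq_bigr => t _; rewrite /ltr mulr_suml.
  by apply: eq_bigr => i _; rewrite mulr_sumr.
rewrite exchange_big; apply: eq_bigr => i _ /=.
rewrite exchange_big; apply: eq_bigr => j _ /=.
rewrite sum_lfunE linear_sum; apply: eq_bigr => t _ /=.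
by rewrite !comp_lfunE elem_mapE !linearZ.
Qed.

Lemma trace_orth_neq M N : simple_object M -> simple_object N -> ~ isomorphic M N ->
  \sum_t ltr (cc_A cc M t) * ltr (cc_B cc N t) = 0.
Proof.
move=> sM sN niso; rewrite avg_matrix big1 // => i _; rewrite big1 // => j _.
have [g <-] := avg_mor (elem_map i j : 'Hom(und M, und N)).
have -> : g = 0.
  by apply: contrapT => g0; apply: niso; exists g; apply: schur.
by rewrite linear0 zero_lfunE linear0.
Qed.

End Simple.

Section SchurClosed.
Variables (k : closedFieldType) (C : category k) (cc : concrete C).
Local Notation und := (cc_und cc).
Local Notation map := (cc_map cc).
Implicit Types M N P : C.

Lemma eigenvector (V : vectType k) (f : 'End(V)) : (0 < \dim {:V})%N ->
  exists c v, v != 0 /\ f v = c *: v.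
Proof.
move=> d; pose e := vbasis {:V}; have eb := vbasisP {:V}.
have /closed_rootP[c rc] : size (char_poly (passmx.mxof e e f)) != 1%N.
  by rewrite size_char_poly; case: (\dim _) d.
have : eigenvalue (passmx.mxof e e f) c by rewrite eigenvalue_root_char.
rewrite /eigenvalue -(passmx.vsof_eq0 eb) -passmx.leigenspaceE // => nz.
exists c, (vpick (passmx.leigenspace f c)); rewrite vpick0; split=> //.
apply/eqP; have := memv_pick (passmx.leigenspace f c).
by rewrite memv_ker add_lfunE opp_lfunE scale_lfunE id_lfunE subr_eq0.
Qed.

Lemma schur_scalar M (f : Mor M M) : simple_object M -> exists c, f = c *: idm M.
Proof.
move=> sM; have [c [v [v0 fv]]] := eigenvector (map f) (simple_dim cc sM).
exists c; apply/eqP; rewrite -subr_eq0; apply/eqP; apply: contrapT => nz.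
have [g [gf _]] := schur cc sM sM nz.
have : map (g ∘ (f - c *: idm M)) v = v by rewrite gf cc_id id_lfunE.
rewrite cc_comp comp_lfunE linearB linearZ /= cc_id add_lfunE opp_lfunE scale_lfunE.
by rewrite id_lfunE fv subrr linear0 => /esym/eqP; rewrite (negbTE v0).
Qed.

(** The average of a rank one map is a scalar by Schur's lemma, and averaging preserves the
    trace, which determines the scalar. *)
Lemma trace_orth_eq M : simple_object M ->
  \sum_t ltr (cc_A cc M t) * ltr (cc_B cc M t) = 1.
Proof.
move=> sM; have d := simple_dim cc sM; rewrite avg_matrix.
have E i j : exists2 c, avg (cc := cc) (elem_map i j : 'End(und M)) = c *: \1%VF
    & c * (\dim {:und M})%:R = (i == j)%:R.
  have [g eg] := avg_mor (elem_map i j : 'End(und M)).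
  have [c gc] := schur_scalar g sM.
  exists c; first by rewrite -eg gc linearZ /= cc_id.
  rewrite -ltr1 -(ltr_elem_map i j); transitivity (ltr (avg (cc := cc) (elem_map i j : 'End(und M)))).
    by rewrite -eg gc linearZ /= cc_id linearZ.
  rewrite linear_sum -[in RHS](comp_lfun1r (elem_map i j)) -(cc_AB cc) comp_lfun_sumr linear_sum.
  by apply: eq_bigr => t _; rewrite /= -comp_lfunA ltr_comm comp_lfunA.
have d0 : (\dim {:und M})%:R != 0 :> k.
  have [c _ ec] := E (Ordinal d) (Ordinal d).
  by apply/eqP => z; move/eqP: ec; rewrite z mulr0 eqxx eq_sym oner_eq0.
have F i j : coord (vbasis {:und M}) j
    (avg (cc := cc) (elem_map i j : 'End(und M)) (vbasis {:und M})`_i) =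
    (i == j)%:R / (\dim {:und M})%:R.
  have [c -> ec] := E i j; rewrite scale_lfunE id_lfunE linearZ /= coord_basis.
  rewrite -[X in _ = X / _]ec mulfK // eq_sym; case: eqP ec => [|_ /eqP]; first by rewrite mulr1.
  by rewrite mulf_eq0 (negbTE d0) orbF => /eqP ->; rewrite mul0r.
transitivity (\sum_(i < \dim {:und M}) (\dim {:und M})%:R^-1 : k).
  apply: eq_bigr => i _; rewrite (bigD1 i) //= F eqxx mul1r big1 ?addr0 // => j ne.
  by rewrite F eq_sym (negbTE ne) mul0r.
by rewrite sumr_const card_ord -[LHS]mulr_natr mulVf.
Qed.

End SchurClosed.

(** * The category of graded representations is premodular *)

Section FreeVector.
Variables (k : fieldType) (I : finType).

Definition freeV : vectType k := {ffun I -> k^o}.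
Definition freeb (i : I) : freeV := [ffun j => (j == i)%:R].

Definition fext_fun (U : vectType k) (f : I -> U) (x : freeV) : U :=
  \sum_i (x : {ffun _ -> _}) i *: f i.
Fact fext_fun_linear (U : vectType k) (f : I -> U) : linear (fext_fun f).
Proof.
move=> a x y; rewrite /fext_fun scaler_sumr -big_split; apply: eq_bigr => p _ /=.
by rewrite !ffunE scalerDl scalerA.
Qed.
HB.instance Definition _ (U : vectType k) (f : I -> U) :=
  GRing.isLinear.Build k freeV U *:%R (fext_fun f) (fext_fun_linear f).
Definition fext (U : vectType k) (f : I -> U) : 'Hom(freeV, U) := linfun (fext_fun f).

Lemma fextE (U : vectType k) (f : I -> U) i : fext f (freeb i) = f i.
Proof.
rewrite /fext lfunE /= /fext_fun (bigD1 i) //= ffunE eqxx scale1r big1 ?addr0 //.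
by move=> q ne; rewrite ffunE (negbTE ne) scale0r.
Qed.

Lemma free_dec (x : freeV) : x = \sum_i (x : {ffun _ -> k}) i *: freeb i.
Proof.
apply/ffunP=> q; rewrite sum_ffunE (bigD1 q) //= !ffunE eqxx big1 ?addr0.
  by rewrite /GRing.scale /= mulr1.
by move=> p ne; rewrite !ffunE eq_sym (negbTE ne) scaler0.
Qed.

Lemma free_ext (U : vectType k) (f g : 'Hom(freeV, U)) :
  (forall i, f (freeb i) = g (freeb i)) -> f = g.
Proof.
move=> e; apply/lfunP=> x; rewrite (free_dec x) !linear_sum.
by apply: eq_bigr => i _; rewrite !linearZ /= e.
Qed.

End FreeVector.

Section GradedReps.
Variables (k : fieldType) (X : crossed_module).
Local Notation X1 := (cm1 X).
Local Notation X2 := (cm2 X).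
Local Notation act := (cm_act X).
Local Notation C := (catM k X).
Implicit Types V W : C.

Lemma gPPE V m n (v : gV V) : gP V m (gP V n v) = if m == n then gP V m v else 0.
Proof. by rewrite -comp_lfunE gP_orth; case: eqP => _; rewrite ?zero_lfunE. Qed.
Lemma gPQE V m g (v : gV V) : gP V m (gQ V g v) = gQ V g (gP V (act m g) v).
Proof. by rewrite -!comp_lfunE gPQ. Qed.
Lemma gQPE V m g (v : gV V) : gQ V g (gP V m v) = gP V (act m g^-1%g) (gQ V g v).
Proof. by rewrite gPQE cm_actKV. Qed.
Lemma gQQE V g h (v : gV V) : gQ V g (gQ V h v) = gQ V (g * h)%g v.
Proof. by rewrite gQM comp_lfunE. Qed.
Lemma gQ1E V (v : gV V) : gQ V 1%g v = v.
Proof. by rewrite gQ1 id_lfunE. Qed.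

(** The free graded representation on generators of each degree: [freeb (n, g)] is
    the image under [g] of the generator of degree [n]. *)
Definition regP (m : X2) : 'End(freeV k (X2 * X1)%type) :=
  fext (fun p => if act m p.2 == p.1 then freeb k p else 0).
Definition regQ (g : X1) : 'End(freeV k (X2 * X1)%type) :=
  fext (fun p => freeb k (p.1, (g * p.2)%g)).

Fact regP_orth m n : (regP m \o regP n)%VF = if m == n then regP m else 0.
Proof.
apply: free_ext => -[l g]; rewrite comp_lfunE [X in regP m X]fextE /=.
case: (m =P n) => [<-|ne]; rewrite ?zero_lfunE.
  by rewrite (fun_if (regP m)) linear0 fextE /=; case: eqP.
case: eqP => [e|_]; rewrite ?linear0 // fextE /=; case: eqP => // e'.
by case: ne; apply: (act_inj act g); rewrite e e'.
Qed.
Fact regP_sum : \sum_m regP m = \1%VF.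
Proof.
apply: free_ext => -[l g]; rewrite sum_lfunE id_lfunE.
under eq_bigr => m _ do rewrite fextE.
rewrite -big_mkcond (big_pred1 (act l g^-1%g)) // => m /=.
by apply/eqP/eqP => [<-|->]; rewrite ?cm_actK ?cm_actKV.
Qed.
Fact regQ1 : regQ 1%g = \1%VF.
Proof. by apply: free_ext => -[l g]; rewrite fextE id_lfunE mul1g. Qed.
Fact regQM g h : regQ (g * h)%g = (regQ g \o regQ h)%VF.
Proof. by apply: free_ext => -[l f]; rewrite comp_lfunE !fextE mulgA. Qed.
Fact regPQ m g : (regP m \o regQ g = regQ g \o regP (act m g))%VF.
Proof.
apply: free_ext => -[l h]; rewrite !comp_lfunE !fextE /= -cm_actM.
by case: eqP => _; rewrite ?linear0 // fextE.
Qed.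
Definition reg_obj : C := GObj regP_orth regP_sum regQ1 regQM regPQ.

Definition reg_elt_fun (V : C) (v : gV V) : 'Hom(gV reg_obj, gV V) :=
  fext (fun p : X2 * X1 => gQ V p.2 (gP V p.1 v)).
Fact reg_elt_subproof (V : C) (v : gV V) : reg_elt_fun v \in is_ghom reg_obj V.
Proof.
rewrite unfold_in; apply/andP; split; apply/forallP=> x; apply/eqP;
  apply: free_ext => -[n g]; rewrite !comp_lfunE !fextE /=; last first.
  by rewrite gQM comp_lfunE.
rewrite (fun_if (reg_elt_fun v)) linear0 fextE /= gPQE.
by rewrite (homogP _ (gP_homog _ _)); case: eqP => _; rewrite ?linear0.
Qed.
Definition reg_elt (V : C) (v : gV V) : Mor reg_obj V := GHom (reg_elt_subproof v).

Lemma reg_gen V : ~ is_zero V -> exists f : Mor reg_obj V, f <> 0.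
Proof.
move=> nz; apply: contrapT => /forallNP z; apply: nz; apply: ghom_eq; apply/lfunP=> v.
rewrite id_lfunE zero_lfunE (homog_dec v) big1 // => m _.
have /(congr1 (@gfun _ _ _ _))/lfunP/(_ (freeb k (m, 1%g))) := contrapT (z (reg_elt v)).
by rewrite fextE zero_lfunE /= gQ1 id_lfunE.
Qed.

Definition catM_op (V : C) (j : X2 + X1) : 'End(gV V) :=
  match j with inl m => gP V m | inr g => gQ V g end.

Lemma catM_nat V W (f : Mor V W) j : (gfun f \o catM_op V j = catM_op W j \o gfun f)%VF.
Proof.
by case: j => x; apply/lfunP=> v; rewrite !comp_lfunE /= ?ghomP ?ghomQ.
Qed.

Lemma catM_full V W (f : 'Hom(gV V, gV W)) :
  (forall j, f \o catM_op V j = catM_op W j \o f)%VF -> exists g : Mor V W, gfun g = f.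
Proof.
move=> e; have fP : f \in is_ghom V W.
  by rewrite unfold_in; apply/andP; split; apply/forallP=> x; apply/eqP;
    [exact: (e (inl x)) | exact: (e (inr x))].
by exists (GHom fP).
Qed.

Section Lift.
Variables (W : vectType k) (T : X2 + X1 -> 'End(W)) (n : nat) (M : 'I_n -> C).
Variable i : forall a, 'Hom(W, gV (M a)).
Hypothesis iT : forall a j, (i a \o T j = catM_op (M a) j \o i a)%VF.
Hypothesis i_inj : forall w, (forall a, i a w = 0) -> w = 0.

Lemma lift_eq (f g : 'End(W)) : (forall a, i a \o f = i a \o g)%VF -> f = g.
Proof.
move=> e; apply/lfunP=> w; apply/eqP; rewrite -subr_eq0; apply/eqP/i_inj => a.
by rewrite linearB /= -!comp_lfunE e subrr.
Qed.

Definition lift_obj : C.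
Proof.
refine (@GObj k X W (fun m => T (inl m)) (fun g => T (inr g)) _ _ _ _ _).
- move=> m l; apply: lift_eq => a; rewrite comp_lfunA !iT -comp_lfunA iT comp_lfunA /=.
  by rewrite gP_orth; case: eqP => _; rewrite ?iT ?comp_lfun0l ?comp_lfun0r.
- apply: lift_eq => a; rewrite comp_lfun_sumr comp_lfun1r.
  by under eq_bigr => m _ do rewrite iT; rewrite -comp_lfun_suml gP_sum comp_lfun1l.
- by apply: lift_eq => a; rewrite iT /= gQ1 comp_lfun1l comp_lfun1r.
- by move=> g h; apply: lift_eq => a; rewrite comp_lfunA !iT -comp_lfunA iT comp_lfunA /= gQM.
- by move=> m g; apply: lift_eq => a;
    rewrite !comp_lfunA !iT -!comp_lfunA !iT !comp_lfunA /= gPQ.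
Defined.

Lemma catM_lift : exists (N : C) (f : 'Hom(gV N, W)) (g : 'Hom(W, gV N)),
  [/\ (f \o g = \1)%VF, (g \o f = \1)%VF & forall j, (f \o catM_op N j = T j \o f)%VF].
Proof.
exists lift_obj, \1%VF, \1%VF; rewrite !comp_lfun1l; split=> // -[x|x];
  by rewrite comp_lfun1l comp_lfun1r.
Qed.
End Lift.

Hypothesis char0 : [pchar k] =i pred0.

Lemma natr_card_neq0 (gT : finGroupType) (G : {group gT}) : #|G|%:R != 0 :> k.
Proof. by have -> := proj1 (pcharf0P k) char0 #|G|; rewrite -lt0n cardG_gt0. Qed.

Definition catM_B V (t : X1 * X2) : 'End(gV V) := (gQ V t.1 \o gP V t.2)%VF.
Definition catM_A V (t : X1 * X2) : 'End(gV V) :=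
  #|[set: X1]|%:R^-1 *: (gP V t.2 \o gQ V t.1^-1%g)%VF.

(** The average [|X1|^-1 \sum Q(g) P(m) f P(m) Q(g^-1)]. *)
Lemma catM_avgE V W (f : 'Hom(gV V, gV W)) v :
  (\sum_t (catM_B W t \o f \o catM_A V t))%VF v = #|[set: X1]|%:R^-1 *:
    \sum_g \sum_m gQ W g (gP W m (f (gP V m (gQ V g^-1%g v)))).
Proof.
rewrite pair_bigA scaler_sumr sum_lfunE; apply: eq_bigr => -[g m] _ /=.
by rewrite !comp_lfunE scale_lfunE comp_lfunE !linearZ.
Qed.

Lemma catM_avg_op V W (f : 'Hom(gV V, gV W)) j :
  ((\sum_t (catM_B W t \o f \o catM_A V t)) \o catM_op V j =
   catM_op W j \o (\sum_t (catM_B W t \o f \o catM_A V t)))%VF.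
Proof.
apply/lfunP=> v; rewrite !comp_lfunE !catM_avgE linearZ; congr (_ *: _).
rewrite linear_sum; case: j => [l|h] /=.
  apply: eq_bigr => g _; rewrite linear_sum; apply: eq_bigr => m _ /=.
  rewrite [gQ V _ _]gQPE invgK [gP V _ _]gPPE [gP W l _]gPQE [gP W _ (gP W _ _)]gPPE eq_sym.
  by case: eqP => [->|_]; rewrite ?linear0.
rewrite (reindex_inj (mulgI h)); apply: eq_bigr => g _.
rewrite linear_sum; apply: eq_bigr => m _ /=.
by rewrite !gQQE invMg mulgKV.
Qed.

Lemma sum_card_inv (V : lmodType k) (gT : finGroupType) (v : V) :
  #|[set: gT]|%:R^-1 *: (\sum_(g : gT) v) = v.
Proof.
rewrite sumr_const -cardsT -scaler_nat scalerA mulVf ?scale1r //.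
exact: (natr_card_neq0 [set: gT]%G).
Qed.

Lemma catM_BA V : (\sum_t (catM_B V t \o catM_A V t) = \1)%VF.
Proof.
apply/lfunP=> v; rewrite sum_lfunE id_lfunE -[RHS](@sum_card_inv _ X1) -(pair_bigA _ (fun g m =>
  (catM_B V (g, m) \o catM_A V (g, m))%VF v)) scaler_sumr; apply: eq_bigr => g _ /=.
rewrite -[v in RHS](gQKV g) [gQ V g^-1%g v in RHS]homog_dec linear_sum scaler_sumr.
apply: eq_bigr => m _ /=.
by rewrite !comp_lfunE scale_lfunE comp_lfunE !linearZ /= gPPE eqxx.
Qed.

Lemma catM_AB V : (\sum_t (catM_A V t \o catM_B V t) = \1)%VF.
Proof.
apply/lfunP=> v; rewrite sum_lfunE id_lfunE -[RHS](@sum_card_inv _ X1) -(pair_bigA _ (fun g m =>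
  (catM_A V (g, m) \o catM_B V (g, m))%VF v)) scaler_sumr; apply: eq_bigr => g _ /=.
rewrite [v in RHS]homog_dec scaler_sumr; apply: eq_bigr => m _.
by rewrite comp_lfunE scale_lfunE !comp_lfunE /= gQQE mulVg gQ1E gPPE eqxx.
Qed.

Definition catM_concrete : concrete C.
Proof.
refine (@Concrete k C (fun V => gV V) (fun V W f => gfun f) _ _ _ _ _ catM_op catM_nat
  catM_full catM_lift _ catM_A catM_B _ _ catM_avg_op catM_BA catM_AB _) => //.
- by move=> V W f g; apply: ghom_eq.
- move=> V W f t; apply/lfunP=> v.
  by rewrite comp_lfunE !scale_lfunE !comp_lfunE scale_lfunE comp_lfunE linearZ /= ghomP ghomQ.
- by move=> V W f t; apply/lfunP=> v; rewrite !comp_lfunE ghomQ ghomP.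
- by exists reg_obj; apply: reg_gen.
Defined.

Lemma end_unit_catM : bijective (fun c : k => c *: idm (𝟙 : C)).
Proof.
exists (fun f => (f : ghom (gone k X) (gone k X)) (1 : k^o)) => [c|f].
  by rewrite scale_lfunE id_lfunE /GRing.scale /= mulr1.
apply: ghom_eq; apply/lfunP=> c /=; rewrite scale_lfunE id_lfunE [c in RHS]scale1o.
by rewrite linearZ /= /GRing.scale /= mulrC.
Qed.

Lemma catM_premodular : premodular C.
Proof.
split; [exact: concrete_abelian catM_concrete | exact: concrete_semisimple catM_concrete
  | exact: end_unit_catM | exact: finite_simples catM_concrete].
Qed.

End GradedReps.

(** * Modules over the vacuum as spaces with operators *)

Section VacuumModules.
Variables (k : fieldType) (X : crossed_module).
Local Notation X1 := (cm1 X).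
Local Notation bd := (cm_bd X).
Local Notation C := (catM k X).
Local Notation A := (vacuum k X).
Local Notation idx := (vac_index X).
Local Notation "⌊ M ⌋" := (mod_obj (M : left_module A)) (M at level 99).
Local Notation und M := (gV ⌊M⌋).
Implicit Types M N : Mod A.

(** The basis of the vacuum is indexed by the pairs of an element of [K] and a point of [C];
    for each point of [C] the elements of [K] form a group under [vmul]. *)
Definition vinv (p : idx) : idx := (p.1^-1%g, p.2).
Definition vmul (p q : idx) : idx := ((p.1 * q.1)%g, p.2).
Definition vact (g : X1) (p : idx) : idx := (p.1, (coset (cmI X) g * p.2)%g).
Local Notation vdeg := (@vac_degree X).

Lemma vinvK : involutive vinv.
Proof. by case=> x c; rewrite /vinv /= invgK. Qed.
Lemma vdeg_inv p : vdeg (vinv p) = (vdeg p)^-1%g.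
Proof. by rewrite /vac_degree /= cm_act_inv. Qed.
Lemma vact_bd m p : vact (bd m) p = p.
Proof.
case: p => x c; rewrite /vact /=; congr (_, _).
by rewrite [coset _ _](coset_id _) ?mul1g // mem_morphim ?inE.
Qed.

Lemma vact_inj g : injective (vact g).
Proof.
case=> x c [y d] e; have /= -> := congr1 fst e.
by have /= /mulgI -> := congr1 snd e.
Qed.

Fact rho_subproof M (p : idx) :
  {f : 'End(und M) | forall v, f v = mod_act M (tprod (vacb k p) v)}.
Proof.
exists (gfun (mod_act M) \o tprodL (und M) (vacb k p))%VF => v.
by rewrite comp_lfunE tprodLE.
Qed.
(** The action of the basis vector [vacb p]. A module over the vacuum is the same as a
    graded representation with operators subject to [rhoM], [rho1], [rho_homog] and
    [Qrho]. *)
Definition rho M (p : idx) : 'End(und M) := sval (rho_subproof M p).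

Lemma rhoE M p v : rho M p v = mod_act M (tprod (vacb k p) v).
Proof. exact: (svalP (rho_subproof M p)). Qed.

Lemma rhoM M p q v : rho M p (rho M q v) = if p.2 == q.2 then rho M (vmul p q) v else 0.
Proof.
rewrite !rhoE; have := congr1 (@gfun _ _ _ _) (mod_actA M).
move/lfunP/(_ (tprod (tprod (vacb k p) (vacb k q)) v)).
rewrite !comp_lfunE tmapE id_lfunE tassocE tmapE id_lfunE vac_mulE => <-.
by rewrite /vac_mulb; case: eqP => _; rewrite ?tprod0l ?linear0.
Qed.

Lemma rho1 M v : \sum_c rho M (1%g, c) v = v.
Proof.
have := congr1 (@gfun _ _ _ _) (mod_act1 M); move/lfunP/(_ (tprod (1 : k^o) v)).
rewrite !comp_lfunE tmapE id_lfunE tlunitE scale1r vac_oneE scale1r tprod_suml linear_sum.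
by move=> e; rewrite -[RHS]e; apply: eq_bigr => c _; rewrite rhoE.
Qed.

Lemma rho_homog M p m v : homog m v -> homog (vdeg p * m)%g (rho M p v).
Proof.
by move=> hv; rewrite rhoE; apply: ghom_homog; apply: homog_tprod (vac_homog k p) hv.
Qed.

Lemma rhoP M p m v : rho M p (gP ⌊M⌋ m v) = gP ⌊M⌋ (vdeg p * m)%g (rho M p v).
Proof.
rewrite [in RHS](homog_dec v) !linear_sum (bigD1 m) //= big1 ?addr0 => [|n ne].
  by rewrite rho_homog //; apply: gP_homog.
by rewrite (homogP _ (rho_homog _ (gP_homog _ _))) (inj_eq (mulgI _)) eq_sym (negbTE ne).
Qed.

Lemma Prho M p m v : gP ⌊M⌋ m (rho M p v) = rho M p (gP ⌊M⌋ ((vdeg p)^-1 * m)%g v).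
Proof. by rewrite rhoP mulKVg. Qed.

Lemma Qrho M g p v : gQ ⌊M⌋ g (rho M p v) = rho M (vact g p) (gQ ⌊M⌋ g v).
Proof. by rewrite !rhoE -ghomQ [X in mod_act M X](tensQE (V := vac_obj k X)) /= vextE. Qed.

Lemma rhoQ_bd M m p v : rho M p (gQ ⌊M⌋ (bd m) v) = gQ ⌊M⌋ (bd m) (rho M p v).
Proof. by rewrite Qrho vact_bd. Qed.

Lemma homrho M N (f : Mor M N) p v :
  (mod_mor f : ghom _ _) (rho M p v) = rho N p ((mod_mor f : ghom _ _) v).
Proof.
rewrite !rhoE; have := congr1 (@gfun _ _ _ _) (mod_hom_act f).
by move/lfunP/(_ (tprod (vacb k p) v)); rewrite !comp_lfunE tmapE id_lfunE.
Qed.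

Lemma vac_tens_homog_ext (V : C) (U : vectType k) (f g : 'Hom(tensV (vacV k X) (gV V), U)) :
  (forall p m v, homog m v -> f (tprod (vacb k p) v) = g (tprod (vacb k p) v)) -> f = g.
Proof.
move=> e; apply: vac_tens_extl => p v; rewrite (homog_dec v) tprod_sumr !linear_sum.
by apply: eq_bigr => m _; apply: e (gP_homog _ _).
Qed.

(** Conversely, such operators on a graded representation define a module. *)
Section MakeModule.
Variables (V : C) (R : idx -> 'End(gV V)).
Hypothesis RM : forall p q v, R p (R q v) = if p.2 == q.2 then R (vmul p q) v else 0.
Hypothesis R1 : forall v, \sum_c R (1%g, c) v = v.
Hypothesis RP : forall p m v, homog m v -> homog (vdeg p * m)%g (R p v).
Hypothesis RQ : forall g p v, gQ V g (R p v) = R (vact g p) (gQ V g v).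

Definition mk_act : 'Hom(tensV (vacV k X) (gV V), gV V) :=
  tlift (fun (phi : vacV k X) v => vext (fun p => R p v) phi).
Lemma mk_actE p v : mk_act (tprod (vacb k p) v) = R p v.
Proof.
rewrite /mk_act tliftE ?vextE //; split=> [w|phi] a x y; first exact: linearP.
rewrite /vext !lfunE /= /vext_fun scaler_sumr -big_split; apply: eq_bigr => q _ /=.
by rewrite linearP scalerDr !scalerA mulrC.
Qed.
Fact mk_act_subproof : mk_act \in is_ghom (gtens (vac_obj k X) V) V.
Proof.
rewrite unfold_in; apply/andP; split; apply/forallP=> x; apply/eqP;
  apply: vac_tens_homog_ext => p m v hv; rewrite !comp_lfunE.
  rewrite [X in mk_act X = _](tensPE _ (vac_homog k p) hv) mk_actE (homogP _ (RP _ hv)).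
  by rewrite (fun_if mk_act) linear0 mk_actE.
by rewrite [X in mk_act X = _](tensQE (V := vac_obj k X)) /= vextE !mk_actE RQ.
Qed.
Definition mk_actm : Mor ((A : C) ⊗ V) V := GHom mk_act_subproof.
Fact mk_actA : mk_actm ∘ (alg_mul A ⊠ idm V) = mk_actm ∘ (idm (A : C) ⊠ mk_actm) ∘ assoc (A : C) A V.
Proof.
apply: ghom_eq; apply: tens_ext => t v; rewrite /=.
suff /lfunP/(_ t) : (mk_act \o tmap (vac_mul k X) \1 \o tprodR _ v =
    mk_act \o tmap \1 mk_act \o tassoc _ _ _ \o tprodR _ v)%VF.
  by rewrite !comp_lfunE tprodRE.
apply: vac_tens_ext => p q; rewrite !comp_lfunE tprodRE tmapE id_lfunE tassocE tmapE id_lfunE.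
rewrite mk_actE mk_actE RM vac_mulE /vac_mulb.
by case: eqP => _; rewrite ?tprod0l ?linear0 ?mk_actE.
Qed.
Fact mk_act1 : mk_actm ∘ (alg_one A ⊠ idm V) = lunit V.
Proof.
apply: ghom_eq; apply: tens_ext => c v; rewrite /=.
rewrite !comp_lfunE tmapE id_lfunE tlunitE vac_oneE tprodZl linearZ; congr (_ *: _).
rewrite tprod_suml linear_sum -[RHS]R1; apply: eq_bigr => d _.
by rewrite /= mk_actE.
Qed.
Definition mk_mod : Mod A := LeftModule mk_actA mk_act1.
Lemma rho_mk p v : rho mk_mod p v = R p v.
Proof. by rewrite rhoE /= mk_actE. Qed.
End MakeModule.

Section MakeHom.
Variables (M N : Mod A) (f : 'Hom(und M, und N)).
Hypothesis fP : forall m v, homog m v -> homog (V := ⌊N⌋) m (f v).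
Hypothesis fQ : forall g v, f (gQ ⌊M⌋ g v) = gQ ⌊N⌋ g (f v).
Hypothesis fR : forall p v, f (rho M p v) = rho N p (f v).

Fact mk_hom_ghom : f \in is_ghom ⌊M⌋ ⌊N⌋.
Proof. by apply: is_ghomI => [|g m v _]; [exact: fP | exact: fQ]. Qed.
Fact mk_hom_subproof : (GHom mk_hom_ghom : Mor ⌊M⌋ ⌊N⌋) \in mod_linear M N.
Proof.
rewrite unfold_in; apply/eqP/ghom_eq/vac_tens_extl => p v.
by rewrite !comp_lfunE tmapE id_lfunE -!rhoE fR.
Qed.
Definition mk_hom : Mor M N := ModHom mk_hom_subproof.
End MakeHom.

End VacuumModules.

Section Averaging.
Variables (k : fieldType) (X : crossed_module).
Local Notation X1 := (cm1 X).
Local Notation X2 := (cm2 X).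
Local Notation C := (catM k X).
Local Notation A := (vacuum k X).
Local Notation idx := (vac_index X).
Local Notation "⌊ M ⌋" := (mod_obj (M : left_module A)) (M at level 99).
Local Notation und M := (gV ⌊M⌋).
Local Notation vdeg := (@vac_degree X).
Implicit Types (M N P : Mod A) (p q : idx).

Lemma cmK_mulC (x y : subg_of (cmK X)) : (x * y = y * x)%g.
Proof. by apply: val_inj => /=; rewrite conjgC cmK_conj ?subgP. Qed.

Lemma vmulC p q : p.2 = q.2 -> vmul p q = vmul q p.
Proof. by move=> e; rewrite /vmul e cmK_mulC. Qed.

(** The element [\sum p ⊗ p^*] of [A ⊗ A] is a Casimir element: both sides are the sum
    over pairs [(r, s)] in the fibre of [q] with [r * s = q]. *)
Lemma casimir (V : nmodType) (G : idx -> idx -> V) q :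
  \sum_(p | p.2 == q.2) G (vmul p q) (vinv p) =
  \sum_(p | p.2 == q.2) G p (vmul (vinv p) q).
Proof.
rewrite (reindex_onto (fun p => vmul p (vinv q)) (fun p => vmul p q)) /=; last first.
  by case=> x c _; rewrite /vmul /= mulgK.
apply: eq_big => [[x c]|[x c] _]; first by rewrite /vmul /= mulgKV eqxx andbT.
by rewrite /vmul /vinv /= mulgKV invMg invgK cmK_mulC.
Qed.

Lemma rho_comm M p q v : rho M p (rho M q v) = rho M q (rho M p v).
Proof. by rewrite !rhoM eq_sym; case: eqP => // e; rewrite vmulC. Qed.

Lemma rho_casimir M v :
  \sum_p rho M p (rho M (vinv p) v) = #|[set: subg_of (cmK X)]|%:R *: v.
Proof.
transitivity (\sum_x \sum_c rho M (x, c) (rho M (vinv (x, c)) v)).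
  by rewrite pair_bigA; apply: eq_bigr => -[x c].
under eq_bigr => x _ do (under eq_bigr => c _ do rewrite rhoM /= eqxx /vmul /= mulgV; rewrite rho1).
by rewrite sumr_const -cardsT scaler_nat.
Qed.

Definition vavg M N (f : 'Hom(und M, und N)) : 'Hom(und M, und N) :=
  (\sum_p (rho N p \o f \o rho M (vinv p)))%VF.

Lemma vavgE M N (f : 'Hom(und M, und N)) v :
  vavg f v = \sum_p rho N p (f (rho M (vinv p) v)).
Proof. by rewrite sum_lfunE; apply: eq_bigr => p _; rewrite 2!comp_lfunE. Qed.

(** This is the Casimir property of [\sum p ⊗ p^*]. *)
Lemma vavg_rho M N (f : 'Hom(und M, und N)) q v :
  vavg f (rho M q v) = rho N q (vavg f v).
Proof.
rewrite !vavgE linear_sum /=; transitivity (\sum_(p | p.2 == q.2)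
    rho N p (f (rho M (vmul (vinv p) q) v))).
  rewrite [RHS]big_mkcond; apply: eq_bigr => p _; rewrite rhoM /=.
  by case: eqP => _; rewrite ?linear0.
rewrite -(casimir (fun p p' => rho N p (f (rho M p' v)))) big_mkcond.
apply: eq_bigr => p _; rewrite rhoM eq_sym; case: eqP => // e.
by rewrite vmulC.
Qed.

Lemma vavg_gP M N (f : 'Hom(und M, und N)) :
  (forall m v, f (gP ⌊M⌋ m v) = gP ⌊N⌋ m (f v)) ->
  forall m v, vavg f (gP ⌊M⌋ m v) = gP ⌊N⌋ m (vavg f v).
Proof.
move=> fP m v; rewrite !vavgE linear_sum; apply: eq_bigr => p _ /=.
by rewrite rhoP fP vdeg_inv rhoP mulKVg.
Qed.

Lemma vavg_gQ M N (f : 'Hom(und M, und N)) :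
  (forall g v, f (gQ ⌊M⌋ g v) = gQ ⌊N⌋ g (f v)) ->
  forall g v, vavg f (gQ ⌊M⌋ g v) = gQ ⌊N⌋ g (vavg f v).
Proof.
move=> fQ g v; rewrite !vavgE linear_sum (reindex_inj (@vact_inj X g)).
apply: eq_bigr => p _ /=; rewrite Qrho -fQ Qrho.
by [].
Qed.

(** * Averaging over vacuum modules *)

Definition mod_op M (j : X2 + X1 + idx) : 'End(und M) :=
  match j with inl j => catM_op ⌊M⌋ j | inr p => rho M p end.

Lemma mod_nat M N (f : Mor M N) j :
  (gfun (mod_mor f) \o mod_op M j = mod_op N j \o gfun (mod_mor f))%VF.
Proof.
case: j => [j|p]; first exact: catM_nat.
by apply/lfunP=> v; rewrite 2!comp_lfunE homrho.
Qed.

Lemma mod_full M N (f : 'Hom(und M, und N)) :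
  (forall j, f \o mod_op M j = mod_op N j \o f)%VF ->
  exists g : Mor M N, gfun (mod_mor g) = f.
Proof.
move=> e; have [g gf] := catM_full (fun j => e (inl j)).
have fP m v : homog m v -> homog (V := ⌊N⌋) m (f v).
  by rewrite -gf; apply: ghom_homog.
have fQ h v : f (gQ ⌊M⌋ h v) = gQ ⌊N⌋ h (f v) by rewrite -gf ghomQ.
have fR p v : f (rho M p v) = rho N p (f v).
  by have /lfunP/(_ v) := e (inr p); rewrite 2!comp_lfunE.
by exists (mk_hom fP fQ fR).
Qed.

Section Lift.
Variables (W : vectType k) (T : X2 + X1 + idx -> 'End(W)) (n : nat) (M : 'I_n -> Mod A).
Variable i : forall a, 'Hom(W, und (M a)).
Hypothesis iT : forall a j, (i a \o T j = mod_op (M a) j \o i a)%VF.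
Hypothesis i_inj : forall w, (forall a, i a w = 0) -> w = 0.

Let iTE a j w : i a (T j w) = mod_op (M a) j (i a w).
Proof. by have /lfunP/(_ w) := iT a j; rewrite 2!comp_lfunE. Qed.
Let inj (w w' : W) : (forall a, i a w = i a w') -> w = w'.
Proof.
move=> e; apply/eqP; rewrite -subr_eq0; apply/eqP/i_inj => a.
by rewrite linearB /= e subrr.
Qed.

Let V : C := lift_obj (fun a j => iT a (inl j)) i_inj.
Let R p : 'End(gV V) := T (inr p).
Fact lift_RM p q v : R p (R q v) = if p.2 == q.2 then R (vmul p q) v else 0.
Proof.
apply: inj => a; rewrite /R !iTE [LHS]rhoM.
by case: eqP => _; rewrite ?linear0 ?iTE.
Qed.
Fact lift_R1 v : \sum_c R (1%g, c) v = v.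
Proof.
apply: inj => a; rewrite linear_sum -[RHS]rho1; apply: eq_bigr => c _.
exact: iTE.
Qed.
Fact lift_RP p m v : homog m v -> homog (vdeg p * m)%g (R p v).
Proof.
move=> hv; apply: inj => a; rewrite /homog /R /= !iTE /= Prho mulKg.
by congr (rho _ _ _); rewrite -[in RHS]hv [in RHS]iTE.
Qed.
Fact lift_RQ g p v : gQ V g (R p v) = R (vact g p) (gQ V g v).
Proof. by apply: inj => a; rewrite /R /= !iTE /= Qrho. Qed.

Lemma mod_lift : exists (N : Mod A) (f : 'Hom(und N, W)) (g : 'Hom(W, und N)),
  [/\ (f \o g = \1)%VF, (g \o f = \1)%VF & forall j, (f \o mod_op N j = T j \o f)%VF].
Proof.
exists (mk_mod lift_RM lift_R1 lift_RP lift_RQ), \1%VF, \1%VF.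
rewrite !comp_lfun1l; split=> // -[[x|x]|p]; rewrite comp_lfun1l comp_lfun1r //.
by apply/lfunP=> v; rewrite [LHS]rho_mk.
Qed.
End Lift.

Hypothesis char0 : [pchar k] =i pred0.

Definition nK : k := #|[set: subg_of (cmK X)]|%:R.
Lemma nK_neq0 : nK != 0.
Proof. exact: (natr_card_neq0 char0 [set: subg_of (cmK X)]%G). Qed.

Definition mod_B M (t : idx * (X1 * X2)) : 'End(und M) := (rho M t.1 \o catM_B ⌊M⌋ t.2)%VF.
Definition mod_A M (t : idx * (X1 * X2)) : 'End(und M) :=
  nK^-1 *: (catM_A ⌊M⌋ t.2 \o rho M (vinv t.1))%VF.

Lemma mod_avgE M N (f : 'Hom(und M, und N)) :
  (\sum_t (mod_B N t \o f \o mod_A M t))%VF =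
  nK^-1 *: vavg (\sum_t (catM_B ⌊N⌋ t \o f \o catM_A ⌊M⌋ t))%VF.
Proof.
transitivity (\sum_p \sum_t (mod_B N (p, t) \o f \o mod_A M (p, t)))%VF.
  by rewrite pair_bigA; apply: eq_bigr => -[p t].
rewrite scaler_sumr; apply: eq_bigr => p _.
rewrite comp_lfun_sumr comp_lfun_suml scaler_sumr; apply: eq_bigr => t _.
by rewrite /mod_B /mod_A /= -comp_lfunZr !comp_lfunA.
Qed.

Lemma mod_avg_op M N (f : 'Hom(und M, und N)) j :
  ((\sum_t (mod_B N t \o f \o mod_A M t)) \o mod_op M j =
   mod_op N j \o (\sum_t (mod_B N t \o f \o mod_A M t)))%VF.
Proof.
rewrite mod_avgE -comp_lfunZl -comp_lfunZr; congr (_ *: _).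
have fE j' v := congr1 (fun g : 'Hom(und M, und N) => g v) (catM_avg_op f j').
apply/lfunP=> v; rewrite !comp_lfunE; case: j => [[m|g]|q] /=; last exact: vavg_rho.
  by apply: vavg_gP => {}m w; have := fE (inl m) w; rewrite 2!comp_lfunE.
by apply: vavg_gQ => {}g w; have := fE (inr g) w; rewrite 2!comp_lfunE.
Qed.

Lemma mod_BA M : (\sum_t (mod_B M t \o mod_A M t) = \1)%VF.
Proof.
transitivity (\sum_t (mod_B M t \o \1 \o mod_A M t))%VF.
  by apply: eq_bigr => t _; rewrite comp_lfun1r.
rewrite mod_avgE.
have -> : (\sum_t (catM_B ⌊M⌋ t \o \1 \o catM_A ⌊M⌋ t) = \1 :> 'End(und M))%VF.
  by rewrite -[RHS](catM_BA char0 ⌊M⌋); apply: eq_bigr => t _; rewrite comp_lfun1r.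
apply/lfunP=> v; rewrite scale_lfunE vavgE.
under eq_bigr => p _ do rewrite id_lfunE.
by rewrite rho_casimir id_lfunE scalerA mulVf ?nK_neq0 // scale1r.
Qed.

Lemma mod_AB M : (\sum_t (mod_A M t \o mod_B M t) = \1)%VF.
Proof.
transitivity (\sum_t \sum_p (mod_A M (p, t) \o mod_B M (p, t)))%VF.
  by rewrite exchange_big pair_bigA; apply: eq_bigr => -[p t].
rewrite -[RHS](catM_AB char0 ⌊M⌋); apply: eq_bigr => t _.
apply/lfunP=> v; rewrite sum_lfunE.
pose w := catM_B ⌊M⌋ t v.
transitivity (nK^-1 *: catM_A ⌊M⌋ t (\sum_p rho M p (rho M (vinv p) w))).
  rewrite linear_sum scaler_sumr; apply: eq_bigr => p _.
  by rewrite 2!comp_lfunE scale_lfunE comp_lfunE rho_comm.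
by rewrite rho_casimir linearZ /= scalerA mulVf ?nK_neq0 // scale1r comp_lfunE.
Qed.

Lemma rho_ind_vacb (V : C) p q v :
  rho (Ind A V) p (tprod (vacb k q) v) = tprod (vac_mulb k p q) v.
Proof. by rewrite rhoE /= /free_act /= comp_lfunE tassociE tmapE vac_mulE id_lfunE. Qed.

(** The morphism out of an induced module that corresponds to [f] under the
    adjunction between induction and the forgetful functor. *)
Definition ind_adj (V : C) M (f : Mor V ⌊M⌋) : 'Hom(und (Ind A V), und M) :=
  (gfun (mod_act M) \o tmap \1%VF (gfun f))%VF.
Lemma ind_adjE (V : C) M (f : Mor V ⌊M⌋) p v :
  ind_adj f (tprod (vacb k p) v) = rho M p (gfun f v).
Proof. by rewrite rhoE comp_lfunE tmapE id_lfunE. Qed.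

Lemma ind_adj_mor (V : C) M (f : Mor V ⌊M⌋) :
  exists g : Mor (Ind A V) M, gfun (mod_mor g) = ind_adj f.
Proof.
pose h : Mor ⌊Ind A V⌋ ⌊M⌋ := mod_act M ∘ (idm (A : C) ⊠ f).
have fP m v : homog m v -> homog (V := ⌊M⌋) m (ind_adj f v).
  exact: (ghom_homog (h : ghom _ _)).
have fQ g v : ind_adj f (gQ ⌊Ind A V⌋ g v) = gQ ⌊M⌋ g (ind_adj f v).
  exact: (ghomQ (h : ghom _ _)).
have fR p v : ind_adj f (rho (Ind A V) p v) = rho M p (ind_adj f v).
  suff /lfunP/(_ v) : (ind_adj f \o rho (Ind A V) p = rho M p \o ind_adj f)%VF.
    by rewrite 2!comp_lfunE.
  apply: vac_tens_extl => q w; rewrite [LHS]comp_lfunE [RHS]comp_lfunE rho_ind_vacb.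
  rewrite [in RHS]ind_adjE rhoM /vac_mulb; case: eqP => _; first exact: ind_adjE.
  by rewrite tprod0l linear0.
by exists (mk_hom fP fQ fR).
Qed.

Lemma mod_gen M : ~ is_zero M -> exists f : Mor (Ind A (reg_obj k X)) M, f <> 0.
Proof.
move=> nz; have [|f f0] := @reg_gen k X ⌊M⌋.
  by move=> z; apply: nz; apply: mod_hom_eq.
have [g eg] := ind_adj_mor f; exists g => g0; apply: f0; apply: ghom_eq.
apply/lfunP=> v; rewrite zero_lfunE -[LHS]rho1 big1 // => c _.
by rewrite -ind_adjE -eg g0 zero_lfunE.
Qed.

(** The separability idempotent of the algebra of operators on vacuum modules combines the
    averages over [X1] and over [K]. *)
Definition mod_concrete : concrete (Mod A).
Proof.
refine (@Concrete k (Mod A) (fun M => und M) (fun M N f => gfun (mod_mor f)) _ _ _ _ _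
  mod_op mod_nat mod_full mod_lift _ mod_A mod_B _ _ mod_avg_op mod_BA mod_AB _) => //.
- by move=> M N f g e; apply: mod_hom_eq; apply: ghom_eq.
- move=> M N f [p t]; rewrite /mod_A -[LHS]comp_lfunZr -[RHS]comp_lfunZl; congr (_ *: _).
  rewrite comp_lfunA (cc_natA (c := catM_concrete X char0) (mod_mor f)) -comp_lfunA.
  by rewrite (mod_nat f (inr _)) comp_lfunA.
- move=> M N f [p t]; rewrite /mod_B comp_lfunA (mod_nat f (inr _)) -comp_lfunA.
  by rewrite (cc_natB (c := catM_concrete X char0) (mod_mor f)) comp_lfunA.
- by exists (Ind A (reg_obj k X)); apply: mod_gen.
Defined.

End Averaging.

(** * The tensor product over the vacuum *)

Section TensorOver.
Variables (k : fieldType) (char0 : [pchar k] =i pred0) (X : crossed_module).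
Local Notation X1 := (cm1 X).
Local Notation X2 := (cm2 X).
Local Notation bd := (cm_bd X).
Local Notation C := (catM k X).
Local Notation A := (vacuum k X).
Local Notation idx := (vac_index X).
Local Notation "⌊ M ⌋" := (mod_obj (M : left_module A)) (M at level 99).
Local Notation und M := (gV ⌊M⌋).
Local Notation vdeg := (@vac_degree X).
Local Notation nK := (nK k X).
Implicit Types (M N P : Mod A) (p q : idx).

Lemma bd_vdegM p m : bd (vdeg p * m)%g = bd m.
Proof. by rewrite cm_bdM vac_degreeK mul1g. Qed.

Lemma vdeg_central p (m : X2) : (m * vdeg p = vdeg p * m)%g.
Proof.
have e : (vdeg p ^ m = vdeg p)%g by apply: cmK_conj; apply/cmK_P/vac_degreeK.
by rewrite [RHS]conjgC e.
Qed.

Lemma proj_tens_ext (V W T U : vectType k) (pr : 'Hom(tensV V W, T))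
    (inc : 'Hom(T, tensV V W)) (f g : 'Hom(T, U)) : (forall t, pr (inc t) = t) ->
  (forall v w, f (pr (tprod v w)) = g (pr (tprod v w))) -> f = g.
Proof.
move=> prK e; apply/lfunP=> t; rewrite -(prK t) -[LHS]comp_lfunE -[RHS]comp_lfunE.
by congr (fun_of_lfun _ _); apply: tens_ext => m n; rewrite [LHS]comp_lfunE [RHS]comp_lfunE e.
Qed.

Lemma proj_tens_homog_ext (V W : C) (T U : vectType k) (pr : 'Hom(tensV (gV V) (gV W), T))
    (inc : 'Hom(T, tensV (gV V) (gV W))) (f g : 'Hom(T, U)) : (forall t, pr (inc t) = t) ->
  (forall l m (v : gV V) (w : gV W), homog l v -> homog m w ->
    f (pr (tprod v w)) = g (pr (tprod v w))) -> f = g.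
Proof.
move=> prK e; apply/lfunP=> t; rewrite -(prK t) -[LHS]comp_lfunE -[RHS]comp_lfunE.
congr (fun_of_lfun _ _); apply: homog_tens_ext => l m v w hv hw.
by rewrite [LHS]comp_lfunE [RHS]comp_lfunE (e _ _ _ _ hv hw).
Qed.

Section Idempotent.
Variables M N : Mod A.
Local Notation T := (tensV (und M) (und N)).

(** As [\sum p ⊗ p^*] is a Casimir element with product [#|K|], this operator is
    idempotent, and its image is a model of the cokernel that defines [M ⊗_A N]. *)
Definition ten_idem : 'End(T) :=
  nK^-1 *: \sum_p tmap (rho M p) (rho N (vinv p)).

Lemma ten_idemE m n : ten_idem (tprod m n) =
  nK^-1 *: \sum_p tprod (rho M p m) (rho N (vinv p) n).
Proof.
rewrite scale_lfunE sum_lfunE; congr (_ *: _).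
by apply: eq_bigr => p _; rewrite tmapE.
Qed.

Lemma ten_idem_balance q m n :
  ten_idem (tprod (rho M q m) n) = ten_idem (tprod m (rho N q n)).
Proof.
rewrite !ten_idemE; congr (_ *: _).
transitivity (\sum_(p | p.2 == q.2) tprod (rho M (vmul p q) m) (rho N (vinv p) n)).
  rewrite [RHS]big_mkcond; apply: eq_bigr => p _; rewrite rhoM.
  by case: eqP => _; rewrite ?tprod0l.
rewrite (casimir (fun p p' => tprod (rho M p m) (rho N p' n))) big_mkcond.
by apply: eq_bigr => p _; rewrite rhoM; case: eqP => _; rewrite ?tprod0r.
Qed.

Definition balanced (U : vectType k) (F : 'Hom(T, U)) :=
  forall q m n, F (tprod (rho M q m) n) = F (tprod m (rho N q n)).

Lemma balanced_idem (U : vectType k) (F : 'Hom(T, U)) t :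
  balanced F -> F (ten_idem t) = F t.
Proof.
move=> bF; suff /lfunP/(_ t) : (F \o ten_idem = F)%VF by rewrite comp_lfunE.
apply: tens_ext => m n; rewrite comp_lfunE ten_idemE linearZ linear_sum /=.
under eq_bigr => p _ do rewrite bF.
by rewrite -linear_sum -tprod_sumr rho_casimir tprodZr linearZ /= scalerA
  mulVf ?scale1r // nK_neq0.
Qed.

Lemma ten_idem_homog u v m n : homog u m -> homog v n ->
  gP (gtens ⌊M⌋ ⌊N⌋) (u * v)%g (ten_idem (tprod m n)) = ten_idem (tprod m n).
Proof.
move=> hm hn; rewrite ten_idemE linearZ linear_sum; congr (_ *: _).
apply: eq_bigr => p _.
rewrite [LHS](tensPE _ (rho_homog p hm) (rho_homog (vinv p) hn)) vdeg_inv.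
by rewrite -(vdeg_central p u) -!mulgA mulKVg eqxx.
Qed.

Lemma ten_idem_op j (t : T) : ten_idem (catM_op (gtens ⌊M⌋ ⌊N⌋) j t) =
  catM_op (gtens ⌊M⌋ ⌊N⌋) j (ten_idem t).
Proof.
suff /lfunP/(_ t) : (ten_idem \o catM_op (gtens ⌊M⌋ ⌊N⌋) j =
    catM_op (gtens ⌊M⌋ ⌊N⌋) j \o ten_idem)%VF by rewrite 2!comp_lfunE.
apply: (homog_tens_ext (V := ⌊M⌋) (W := ⌊N⌋)) => u v m n hm hn.
rewrite [LHS]comp_lfunE [RHS]comp_lfunE; case: j => [l|g].
  rewrite [X in ten_idem X = _](tensPE _ hm hn) -(ten_idem_homog hm hn) [RHS]gPPE.
  by case: eqP => [->|_]; rewrite ?linear0 ?ten_idem_homog.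
rewrite [X in ten_idem X = _]tensQE !ten_idemE linearZ; congr (_ *: _).
rewrite (reindex_inj (@vact_inj X g)) linear_sum; apply: eq_bigr => p _.
by rewrite [RHS]tensQE !Qrho.
Qed.

Fact ten_split : {U : vectType k & {pr : 'Hom(T, U) & {inc : 'Hom(U, T) |
  (forall t, inc (pr t) = ten_idem t) /\ (forall w, pr (inc w) = w)}}}.
Proof.
pose inc : 'Hom(subvs_of (limg ten_idem), T) := linfun vsval.
have incE w : inc w = vsval w by rewrite lfunE.
exists (subvs_of (limg ten_idem)), (linfun (vsproj (limg ten_idem)) \o ten_idem)%VF, inc.
have prE t : (linfun (vsproj (limg ten_idem)) \o ten_idem)%VF t =
    vsproj (limg ten_idem) (ten_idem t) by rewrite comp_lfunE [LHS]lfunE.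
split=> [t|w]; first by rewrite prE incE vsprojK // memv_img ?memvf.
rewrite prE incE; have /memv_imgP[t _ e] := subvsP w.
apply: val_inj; rewrite /= vsprojK ?memv_img ?memvf // e balanced_idem //.
exact: ten_idem_balance.
Qed.
Definition tenU : vectType k := projT1 ten_split.
Definition ten_proj : 'Hom(T, tenU) := projT1 (projT2 ten_split).
Definition ten_inc : 'Hom(tenU, T) := sval (projT2 (projT2 ten_split)).

Lemma ten_inc_proj t : ten_inc (ten_proj t) = ten_idem t.
Proof. exact: (proj1 (svalP (projT2 (projT2 ten_split)))). Qed.

Lemma ten_proj_inc w : ten_proj (ten_inc w) = w.
Proof. exact: (proj2 (svalP (projT2 (projT2 ten_split)))). Qed.

Lemma ten_proj_idem t : ten_proj (ten_idem t) = ten_proj t.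
Proof. by rewrite -ten_inc_proj ten_proj_inc. Qed.

Lemma ten_proj_balanced : balanced ten_proj.
Proof. by move=> q m n; rewrite -ten_proj_idem ten_idem_balance ten_proj_idem. Qed.

Definition ten (m : und M) (n : und N) : tenU := ten_proj (tprod m n).

Lemma ten_ext (U : vectType k) (f g : 'Hom(tenU, U)) :
  (forall m n, f (ten m n) = g (ten m n)) -> f = g.
Proof. exact: proj_tens_ext ten_proj_inc. Qed.

Lemma ten_homog_ext (U : vectType k) (f g : 'Hom(tenU, U)) :
  (forall u v m n, homog u m -> homog v n -> f (ten m n) = g (ten m n)) -> f = g.
Proof. exact: proj_tens_homog_ext ten_proj_inc. Qed.

Definition ten_desc (U : vectType k) (F : 'Hom(T, U)) : 'Hom(tenU, U) := (F \o ten_inc)%VF.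
Lemma ten_descE (U : vectType k) (F : 'Hom(T, U)) t :
  balanced F -> ten_desc F (ten_proj t) = F t.
Proof. by move=> bF; rewrite comp_lfunE ten_inc_proj balanced_idem. Qed.

Definition ten_op (j : X2 + X1) : 'End(tenU) :=
  (ten_proj \o catM_op (gtens ⌊M⌋ ⌊N⌋) j \o ten_inc)%VF.
Lemma ten_op_inc (a : 'I_1) j :
  (ten_inc \o ten_op j = catM_op (gtens ⌊M⌋ ⌊N⌋) j \o ten_inc)%VF.
Proof.
apply/lfunP=> w; rewrite [LHS]comp_lfunE [RHS]comp_lfunE [ten_op j w]comp_lfunE.
rewrite [(ten_proj \o _)%VF _]comp_lfunE ten_inc_proj ten_idem_op.
by rewrite -ten_inc_proj ten_proj_inc.
Qed.
Lemma ten_inc_inj w : (forall a : 'I_1, ten_inc w = 0) -> w = 0.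
Proof. by move=> /(_ ord0) e; rewrite -(ten_proj_inc w) e linear0. Qed.

Definition tenC : C := @lift_obj k X tenU ten_op 1 (fun=> gtens ⌊M⌋ ⌊N⌋) (fun=> ten_inc)
  ten_op_inc ten_inc_inj.

Lemma tenC_op j t : catM_op tenC j (ten_proj t) =
  ten_proj (catM_op (gtens ⌊M⌋ ⌊N⌋) j t).
Proof.
transitivity (ten_op j (ten_proj t)); first by case: j.
rewrite [LHS]comp_lfunE [LHS]comp_lfunE ten_inc_proj -ten_idem_op ten_proj_idem.
by [].
Qed.

Lemma homog_ten u v m n : homog u m -> homog v n -> homog (V := tenC) (u * v)%g (ten m n).
Proof.
move=> hm hn; have e := tenC_op (inl (u * v)%g) (tprod m n).
rewrite /homog [LHS]e; congr (ten_proj _); exact: (homog_tprod hm hn).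
Qed.

Lemma gQ_ten g m n : gQ tenC g (ten m n) = ten (gQ ⌊M⌋ g m) (gQ ⌊N⌋ g n).
Proof. by rewrite [LHS](tenC_op (inr g)); congr (ten_proj _); apply: tensQE. Qed.

Fact ten_rho_subproof q :
  {f : 'End(tenU) | forall m n, f (ten m n) = ten (rho M q m) n}.
Proof.
exists (ten_desc (ten_proj \o tmap (rho M q) \1)%VF) => m n.
rewrite [LHS]ten_descE; first by rewrite comp_lfunE tmapE id_lfunE.
move=> p m' n'; rewrite [LHS]comp_lfunE [RHS]comp_lfunE !tmapE !id_lfunE.
by rewrite rho_comm ten_proj_balanced.
Qed.
Definition ten_rho q : 'End(tenU) := sval (ten_rho_subproof q).
Lemma ten_rhoE q m n : ten_rho q (ten m n) = ten (rho M q m) n.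
Proof. exact: (svalP (ten_rho_subproof q)). Qed.

Fact ten_RM p q v : ten_rho p (ten_rho q v) = if p.2 == q.2 then ten_rho (vmul p q) v else 0.
Proof.
have E : (ten_rho p \o ten_rho q)%VF = if p.2 == q.2 then ten_rho (vmul p q) else 0.
  apply: ten_ext => m n; rewrite comp_lfunE !ten_rhoE rhoM.
  case: eqP => _; first by rewrite ten_rhoE.
  by rewrite zero_lfunE /ten tprod0l linear0.
by rewrite -comp_lfunE E; case: eqP => _; rewrite ?zero_lfunE.
Qed.
Fact ten_R1 v : \sum_c ten_rho (1%g, c) v = v.
Proof.
rewrite -sum_lfunE -[RHS]id_lfunE; congr (fun_of_lfun _ _).
apply: ten_ext => m n; rewrite sum_lfunE id_lfunE.
by under eq_bigr => c _ do rewrite ten_rhoE; rewrite /ten -linear_sum -tprod_suml rho1.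
Qed.
Fact ten_RP p m (v : gV tenC) : homog m v -> homog (V := tenC) (vdeg p * m)%g (ten_rho p v).
Proof.
have E : (gP tenC (vdeg p * m)%g \o ten_rho p = ten_rho p \o gP tenC m)%VF.
  apply: ten_homog_ext => u w x y hx hy; rewrite [LHS]comp_lfunE [RHS]comp_lfunE ten_rhoE.
  rewrite (homogP _ (homog_ten (rho_homog p hx) hy)) (homogP _ (homog_ten hx hy)).
  rewrite -mulgA (inj_eq (mulgI _)).
  by case: eqP => _; rewrite ?linear0 ?ten_rhoE.
move=> hv; rewrite /homog; have /lfunP/(_ v) := E.
by rewrite [(_ \o _)%VF v]comp_lfunE => ->; rewrite comp_lfunE hv.
Qed.
Fact ten_RQ g p (v : gV tenC) : gQ tenC g (ten_rho p v) = ten_rho (vact g p) (gQ tenC g v).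
Proof.
suff /lfunP/(_ v) : (gQ tenC g \o ten_rho p = ten_rho (vact g p) \o gQ tenC g)%VF.
  by rewrite [LHS]comp_lfunE => ->; rewrite comp_lfunE.
apply: ten_ext => m n; rewrite [LHS]comp_lfunE [RHS]comp_lfunE ten_rhoE gQ_ten gQ_ten.
by rewrite ten_rhoE Qrho.
Qed.

End Idempotent.

(** The properties of [M ⊗_A N] on which all later constructions rest; the model built
    from [ten_idem] serves only to show that they can be satisfied. *)
Record ten_model M N := TenModel {
  tm_mod : Mod A;
  tm_pr : 'Hom(tensV (und M) (und N), und tm_mod);
  tm_inc : 'Hom(und tm_mod, tensV (und M) (und N));
  tm_inc_pr : forall t, tm_inc (tm_pr t) = ten_idem M N t;
  tm_pr_inc : forall w, tm_pr (tm_inc w) = w;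
  tm_homog : forall u v m n, homog u m -> homog v n ->
    homog (V := ⌊tm_mod⌋) (u * v)%g (tm_pr (tprod m n));
  tm_Q : forall g m n, gQ ⌊tm_mod⌋ g (tm_pr (tprod m n)) =
    tm_pr (tprod (gQ ⌊M⌋ g m) (gQ ⌊N⌋ g n));
  tm_rho : forall q m n, rho tm_mod q (tm_pr (tprod m n)) = tm_pr (tprod (rho M q m) n)
}.

Fact ten_exists M N : ten_model M N.
Proof.
exists (@mk_mod k X (tenC M N) (@ten_rho M N) (@ten_RM M N) (@ten_R1 M N) (@ten_RP M N)
  (@ten_RQ M N)) (ten_proj M N) (ten_inc M N).
- exact: ten_inc_proj.
- exact: ten_proj_inc.
- exact: homog_ten.
- exact: gQ_ten.
- by move=> q m n; rewrite [LHS]rho_mk; apply: ten_rhoE.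
Qed.

(** The module [M ⊗_A N] with its projection and the section splitting it. *)
Definition tenM M N : Mod A := tm_mod (ten_exists M N).
Definition tpr M N : 'Hom(tensV (und M) (und N), und (tenM M N)) := tm_pr (ten_exists M N).
Definition tinc M N : 'Hom(und (tenM M N), tensV (und M) (und N)) :=
  tm_inc (ten_exists M N).
Definition tn M N (m : und M) (n : und N) : und (tenM M N) := tpr M N (tprod m n).
Arguments tn {M N} m n.
Local Notation "m # n" := (tn m n) (at level 39, left associativity).

Section TenTheory.
Variables M N : Mod A.

Lemma tinc_tpr t : tinc M N (tpr M N t) = ten_idem M N t.
Proof. exact: tm_inc_pr. Qed.
Lemma tpr_tinc w : tpr M N (tinc M N w) = w.
Proof. exact: tm_pr_inc. Qed.
Lemma tn_homog u v (m : und M) (n : und N) : homog u m -> homog v n ->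
  homog (V := ⌊tenM M N⌋) (u * v)%g (m # n).
Proof. exact: tm_homog. Qed.
Lemma tnQ g (m : und M) (n : und N) :
  gQ ⌊tenM M N⌋ g (m # n) = gQ ⌊M⌋ g m # gQ ⌊N⌋ g n.
Proof. exact: tm_Q. Qed.
Lemma tn_rho q (m : und M) (n : und N) : rho (tenM M N) q (m # n) = rho M q m # n.
Proof. exact: tm_rho. Qed.
Lemma tpr_balanced : balanced (tpr M N).
Proof.
move=> q m n; rewrite -[LHS]tpr_tinc -[RHS]tpr_tinc !tinc_tpr.
by rewrite ten_idem_balance.
Qed.
Lemma tn_balanced q (m : und M) (n : und N) : rho M q m # n = m # rho N q n.
Proof. exact: tpr_balanced. Qed.

Lemma tn_ext (U : vectType k) (f g : 'Hom(und (tenM M N), U)) :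
  (forall m n, f (m # n) = g (m # n)) -> f = g.
Proof. exact: proj_tens_ext tpr_tinc. Qed.
Lemma tn_homog_ext (U : vectType k) (f g : 'Hom(und (tenM M N), U)) :
  (forall u v m n, homog u m -> homog v n -> f (m # n) = g (m # n)) -> f = g.
Proof. exact: proj_tens_homog_ext tpr_tinc. Qed.

Definition tdesc (U : vectType k) (F : 'Hom(tensV (und M) (und N), U)) :
  'Hom(und (tenM M N), U) := (F \o tinc M N)%VF.
Lemma tdescE (U : vectType k) (F : 'Hom(tensV (und M) (und N), U)) m n :
  balanced F -> tdesc F (m # n) = F (tprod m n).
Proof. by move=> bF; rewrite comp_lfunE tinc_tpr balanced_idem. Qed.

Lemma tn_suml I (r : seq I) (Q : pred I) (F : I -> und M) (n : und N) :
  (\sum_(i <- r | Q i) F i) # n = \sum_(i <- r | Q i) (F i # n).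
Proof. by rewrite /tn tprod_suml linear_sum. Qed.
Lemma tn_sumr I (r : seq I) (Q : pred I) (F : I -> und N) (m : und M) :
  m # (\sum_(i <- r | Q i) F i) = \sum_(i <- r | Q i) (m # F i).
Proof. by rewrite /tn tprod_sumr linear_sum. Qed.
Lemma tnZl a (m : und M) (n : und N) : (a *: m) # n = a *: (m # n).
Proof. by rewrite /tn tprodZl linearZ. Qed.
Lemma tnZr a (m : und M) (n : und N) : m # (a *: n) = a *: (m # n).
Proof. by rewrite /tn tprodZr linearZ. Qed.
Section Desc.
Variables (P : Mod A) (f : 'Hom(und (tenM M N), und P)).
Hypothesis fP : forall u v m n, homog u m -> homog v n ->
  homog (V := ⌊P⌋) (u * v)%g (f (m # n)).
Hypothesis fQ : forall g u v m n, homog u m -> homog v n ->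
  f (gQ ⌊M⌋ g m # gQ ⌊N⌋ g n) = gQ ⌊P⌋ g (f (m # n)).
Hypothesis fR : forall q u v m n, homog u m -> homog v n ->
  f (rho M q m # n) = rho P q (f (m # n)).

Fact ten_homP u (w : und (tenM M N)) :
  homog (V := ⌊tenM M N⌋) u w -> homog (V := ⌊P⌋) u (f w).
Proof.
suff E : (gP ⌊P⌋ u \o f = f \o gP ⌊tenM M N⌋ u)%VF.
  move=> hw; rewrite /homog; have /lfunP/(_ w) := E.
  by rewrite [(_ \o _)%VF w]comp_lfunE => ->; rewrite comp_lfunE hw.
apply: tn_homog_ext => a b m n hm hn; rewrite [LHS]comp_lfunE [RHS]comp_lfunE.
rewrite (homogP _ (fP hm hn)) (homogP _ (tn_homog hm hn)).
by case: eqP => _; rewrite ?linear0.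
Qed.
Fact ten_homQ g (w : und (tenM M N)) : f (gQ ⌊tenM M N⌋ g w) = gQ ⌊P⌋ g (f w).
Proof.
suff /lfunP/(_ w) : (f \o gQ ⌊tenM M N⌋ g = gQ ⌊P⌋ g \o f)%VF.
  by rewrite [LHS]comp_lfunE => ->; rewrite comp_lfunE.
apply: tn_homog_ext => u v m n hm hn; rewrite [LHS]comp_lfunE [RHS]comp_lfunE tnQ.
exact: fQ hm hn.
Qed.
Fact ten_homR q (w : und (tenM M N)) : f (rho (tenM M N) q w) = rho P q (f w).
Proof.
suff /lfunP/(_ w) : (f \o rho (tenM M N) q = rho P q \o f)%VF.
  by rewrite [LHS]comp_lfunE => ->; rewrite comp_lfunE.
apply: tn_homog_ext => u v m n hm hn; rewrite [LHS]comp_lfunE [RHS]comp_lfunE tn_rho.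
exact: fR hm hn.
Qed.
Definition ten_hom : Mor (tenM M N) P := mk_hom ten_homP ten_homQ ten_homR.
End Desc.

End TenTheory.
End TensorOver.

(** * The monoidal category of vacuum modules *)

Section ModMonoidal.
Variables (k : fieldType) (char0 : [pchar k] =i pred0) (X : crossed_module).
Local Notation A := (vacuum k X).
Local Notation idx := (vac_index X).
Local Notation "⌊ M ⌋" := (mod_obj (M : left_module A)) (M at level 99).
Local Notation und M := (gV ⌊M⌋).
Local Notation "f ♭" := (gfun (mod_mor f)) (at level 2, format "f ♭").
Local Notation T := (@tenM k char0 X).
Local Notation "m # n" := (tn char0 m n) (at level 39, left associativity).
Implicit Types M N P : Mod A.

Lemma mod_eq M N (f g : Mor M N) : f♭ = g♭ -> f = g.
Proof. by move=> e; apply: mod_hom_eq; apply: ghom_eq. Qed.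

Lemma mod_compE M N P (g : Mor N P) (f : Mor M N) v : (g ∘ f)♭ v = g♭ (f♭ v).
Proof. by rewrite [LHS]comp_lfunE. Qed.
Lemma mod_idE M v : (idm M)♭ v = v.
Proof. by rewrite id_lfunE. Qed.

Lemma mod_iso M N (f : Mor M N) (g : 'Hom(und N, und M)) :
  (forall v, g (f♭ v) = v) -> (forall v, f♭ (g v) = v) -> is_iso f.
Proof.
move=> gf fg; have [|h hg] := @mod_full k X N M g.
  move=> j; apply/lfunP=> v; rewrite [LHS]comp_lfunE [RHS]comp_lfunE.
  have nat w : f♭ (mod_op M j w) = mod_op N j (f♭ w).
    by have /lfunP/(_ w) := mod_nat f j; rewrite 2!comp_lfunE.
  by rewrite -[v in LHS]fg -nat gf.
by exists h; split; apply: mod_eq; apply/lfunP=> v; rewrite mod_compE mod_idE hg.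
Qed.

Lemma tn_ext3l M N P (U : vectType k) (f g : 'Hom(und (T (T M N) P), U)) :
  (forall m n p, f ((m # n) # p) = g ((m # n) # p)) -> f = g.
Proof.
move=> e; apply: tn_ext => w x.
suff /lfunP/(_ w) : (f \o (tpr char0 (T M N) P \o tprodR _ x) =
    g \o (tpr char0 (T M N) P \o tprodR _ x))%VF.
  by rewrite [LHS]comp_lfunE [RHS]comp_lfunE [(_ \o _)%VF w]comp_lfunE tprodRE.
apply: tn_ext => m n; rewrite [LHS]comp_lfunE [RHS]comp_lfunE.
by rewrite [(_ \o tprodR _ _)%VF _]comp_lfunE tprodRE; apply: e.
Qed.

Lemma tn_ext3r M N P (U : vectType k) (f g : 'Hom(und (T M (T N P)), U)) :
  (forall m n p, f (m # (n # p)) = g (m # (n # p))) -> f = g.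
Proof.
move=> e; apply: tn_ext => x w.
suff /lfunP/(_ w) : (f \o (tpr char0 M (T N P) \o tprodL _ x) =
    g \o (tpr char0 M (T N P) \o tprodL _ x))%VF.
  by rewrite [LHS]comp_lfunE [RHS]comp_lfunE [(_ \o _)%VF w]comp_lfunE tprodLE.
apply: tn_ext => m n; rewrite [LHS]comp_lfunE [RHS]comp_lfunE.
by rewrite [(_ \o tprodL _ _)%VF _]comp_lfunE tprodLE; apply: e.
Qed.

Lemma tn_ext4l M N P Q (U : vectType k) (f g : 'Hom(und (T (T (T M N) P) Q), U)) :
  (forall m n p q, f (((m # n) # p) # q) = g (((m # n) # p) # q)) -> f = g.
Proof.
move=> e; apply: tn_ext => w x.
suff /lfunP/(_ w) : (f \o (tpr char0 (T (T M N) P) Q \o tprodR _ x) =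
    g \o (tpr char0 (T (T M N) P) Q \o tprodR _ x))%VF.
  by rewrite [LHS]comp_lfunE [RHS]comp_lfunE [(_ \o _)%VF w]comp_lfunE tprodRE.
apply: tn_ext3l => m n y; rewrite [LHS]comp_lfunE [RHS]comp_lfunE.
by rewrite [(_ \o tprodR _ _)%VF _]comp_lfunE tprodRE; apply: e.
Qed.

Section Tensm.
Variables (M M' N N' : Mod A) (f : Mor M M') (g : Mor N N').
Let F := (tpr char0 M' N' \o tmap f♭ g♭)%VF.
Fact tensm_balanced : balanced F.
Proof.
move=> q m n; rewrite [LHS]comp_lfunE [RHS]comp_lfunE !tmapE !homrho.
exact: tn_balanced.
Qed.
Definition tensmf : 'Hom(und (T M N), und (T M' N')) := tdesc char0 F.
Lemma tensmfE m n : tensmf (m # n) = f♭ m # g♭ n.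
Proof. by rewrite [LHS](tdescE _ _ _ tensm_balanced) [LHS]comp_lfunE tmapE. Qed.
Definition mtensm : Mor (T M N) (T M' N').
Proof.
apply: (@ten_hom k char0 X M N (T M' N') tensmf).
- move=> u v m n hm hn; rewrite tensmfE.
  by apply: tn_homog; apply: ghom_homog.
- by move=> h u v m n _ _; rewrite !tensmfE !ghomQ tnQ.
- by move=> q u v m n _ _; rewrite !tensmfE homrho tn_rho.
Defined.
Lemma mtensmE m n : mtensm♭ (m # n) = f♭ m # g♭ n.
Proof. exact: tensmfE. Qed.
End Tensm.

Section Assoc.
Variables M N P : Mod A.
Let F : 'Hom(tensV (und (T M N)) (und P), und (T M (T N P))) :=
  (tpr char0 M (T N P) \o tmap \1 (tpr char0 N P) \o tassoc _ _ _ \o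
    tmap (tinc char0 M N) \1)%VF.
(** The section [tinc] replaces [m ⊗ n] by its average over [K], on which a balanced map
    takes the same value. *)
Fact assocF m n p : F (tprod (m # n) p) = m # (n # p).
Proof.
rewrite [LHS]comp_lfunE tmapE id_lfunE tinc_tpr.
pose G : 'Hom(tensV (und M) (und N), und (T M (T N P))) :=
  (tpr char0 M (T N P) \o tmap \1 (tpr char0 N P) \o tassoc _ _ _ \o tprodR _ p)%VF.
have GE x y : G (tprod x y) = x # (y # p).
  rewrite [LHS]comp_lfunE tprodRE [LHS]comp_lfunE tassocE [LHS]comp_lfunE tmapE.
  by rewrite id_lfunE.
have bG : balanced G by move=> q x y; rewrite !GE tn_balanced tn_rho.
by have := balanced_idem char0 (tprod m n) bG; rewrite GE [LHS]comp_lfunE tprodRE.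
Qed.
Fact assocF_balanced : balanced F.
Proof.
move=> q t p; suff /lfunP/(_ t) : (F \o tprodR _ p \o rho (T M N) q =
    F \o tprodR _ (rho P q p))%VF.
  by rewrite [LHS]comp_lfunE [LHS]comp_lfunE [RHS]comp_lfunE !tprodRE.
apply: tn_ext => m n; rewrite [LHS]comp_lfunE [LHS]comp_lfunE [RHS]comp_lfunE.
by rewrite !tprodRE tn_rho !assocF tn_balanced tn_rho tn_balanced.
Qed.
Definition massocf : 'Hom(und (T (T M N) P), und (T M (T N P))) := tdesc char0 F.
Lemma massocfE m n p : massocf ((m # n) # p) = m # (n # p).
Proof. by rewrite [LHS](tdescE _ _ _ assocF_balanced) assocF. Qed.

Let F' : 'Hom(tensV (und M) (und (T N P)), und (T (T M N) P)) :=
  (tpr char0 (T M N) P \o tmap (tpr char0 M N) \1 \o tassoci _ _ _ \o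
    tmap \1 (tinc char0 N P))%VF.
Fact associF m n p : F' (tprod m (n # p)) = (m # n) # p.
Proof.
rewrite [LHS]comp_lfunE tmapE id_lfunE tinc_tpr.
pose G : 'Hom(tensV (und N) (und P), und (T (T M N) P)) :=
  (tpr char0 (T M N) P \o tmap (tpr char0 M N) \1 \o tassoci _ _ _ \o tprodL _ m)%VF.
have GE x y : G (tprod x y) = (m # x) # y.
  rewrite [LHS]comp_lfunE tprodLE [LHS]comp_lfunE tassociE [LHS]comp_lfunE tmapE.
  by rewrite id_lfunE.
have bG : balanced G.
  by move=> q x y; rewrite !GE -[in RHS]tn_balanced tn_rho tn_balanced.
by have := balanced_idem char0 (tprod n p) bG; rewrite GE [LHS]comp_lfunE tprodLE.
Qed.
Fact associF_balanced : balanced F'.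
Proof.
move=> q m t; suff /lfunP/(_ t) : (F' \o tprodL _ (rho M q m) =
    F' \o tprodL _ m \o rho (T N P) q)%VF.
  by rewrite [LHS]comp_lfunE [RHS]comp_lfunE [RHS]comp_lfunE !tprodLE.
apply: tn_ext => n p; rewrite [LHS]comp_lfunE [RHS]comp_lfunE [RHS]comp_lfunE.
by rewrite !tprodLE tn_rho !associF tn_balanced.
Qed.
Definition massocif : 'Hom(und (T M (T N P)), und (T (T M N) P)) := tdesc char0 F'.
Lemma massocifE m n p : massocif (m # (n # p)) = (m # n) # p.
Proof. by rewrite [LHS](tdescE _ _ _ associF_balanced) associF. Qed.

Lemma massocK t : massocif (massocf t) = t.
Proof.
suff /lfunP/(_ t) : (massocif \o massocf = \1)%VF by rewrite comp_lfunE id_lfunE.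
by apply: tn_ext3l => m n p; rewrite comp_lfunE massocfE massocifE id_lfunE.
Qed.
Lemma massociK t : massocf (massocif t) = t.
Proof.
suff /lfunP/(_ t) : (massocf \o massocif = \1)%VF by rewrite comp_lfunE id_lfunE.
by apply: tn_ext3r => m n p; rewrite comp_lfunE massocifE massocfE id_lfunE.
Qed.
End Assoc.

Section Desc3.
Variables (M N P Q : Mod A) (f : 'Hom(und (T (T M N) P), und Q)).
Hypothesis fP : forall u v w m n p, homog u m -> homog v n -> homog w p ->
  homog (V := ⌊Q⌋) (u * v * w)%g (f ((m # n) # p)).
Hypothesis fQ : forall g m n p,
  f ((gQ ⌊M⌋ g m # gQ ⌊N⌋ g n) # gQ ⌊P⌋ g p) = gQ ⌊Q⌋ g (f ((m # n) # p)).
Hypothesis fR : forall q m n p, f ((rho M q m # n) # p) = rho Q q (f ((m # n) # p)).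

Let tR p : 'Hom(und (T M N), und (T (T M N) P)) := (tpr char0 (T M N) P \o tprodR _ p)%VF.
Let tRE p t : tR p t = t # p.
Proof. by rewrite [LHS]comp_lfunE tprodRE. Qed.

Definition ten_hom3 : Mor (T (T M N) P) Q.
Proof.
apply: (@ten_hom k char0 X (T M N) P Q f).
- move=> u v t p ht hp.
  suff /lfunP/(_ t) : (gP ⌊Q⌋ (u * v)%g \o (f \o tR p) = f \o tR p \o gP ⌊T M N⌋ u)%VF.
    rewrite [LHS]comp_lfunE [(f \o _)%VF t]comp_lfunE tRE /homog => ->.
    by rewrite [LHS]comp_lfunE ht [LHS]comp_lfunE tRE.
  apply: tn_homog_ext => a b m n hm hn; rewrite [LHS]comp_lfunE [RHS]comp_lfunE.
  rewrite [X in gP _ _ X = _]comp_lfunE tRE (homogP _ (fP hm hn hp)).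
  rewrite (homogP _ (tn_homog char0 hm hn)) (inj_eq (mulIg _)).
  by case: eqP => _; rewrite ?linear0 // [RHS]comp_lfunE tRE.
- move=> g u v t p _ _.
  suff /lfunP/(_ t) : (f \o tR (gQ ⌊P⌋ g p) \o gQ ⌊T M N⌋ g = gQ ⌊Q⌋ g \o (f \o tR p))%VF.
    rewrite [LHS]comp_lfunE [LHS]comp_lfunE [RHS]comp_lfunE [X in _ = gQ _ _ X]comp_lfunE.
    by rewrite !tRE.
  apply: tn_ext => m n; rewrite [LHS]comp_lfunE [LHS]comp_lfunE [RHS]comp_lfunE.
  by rewrite [X in _ = gQ _ _ X]comp_lfunE !tRE tnQ fQ.
- move=> q u v t p _ _.
  suff /lfunP/(_ t) : (f \o tR p \o rho (T M N) q = rho Q q \o (f \o tR p))%VF.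
    rewrite [LHS]comp_lfunE [LHS]comp_lfunE [RHS]comp_lfunE [X in _ = rho _ _ X]comp_lfunE.
    by rewrite !tRE.
  apply: tn_ext => m n; rewrite [LHS]comp_lfunE [LHS]comp_lfunE [RHS]comp_lfunE.
  by rewrite [X in _ = rho _ _ X]comp_lfunE !tRE tn_rho fR.
Defined.
End Desc3.

Definition massoc M N P : Mor (T (T M N) P) (T M (T N P)).
Proof.
apply: (@ten_hom3 M N P (T M (T N P)) (massocf M N P)).
- move=> u v w m n p hm hn hp; rewrite massocfE -mulgA.
  by do 2 apply: tn_homog => //.
- by move=> g m n p; rewrite !massocfE !tnQ.
- by move=> q m n p; rewrite !massocfE tn_rho.
Defined.
Lemma massocE M N P m n p : (massoc M N P)♭ ((m # n) # p) = m # (n # p).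
Proof. exact: massocfE. Qed.

Lemma mod_inv M N (f : Mor M N) (g : 'Hom(und N, und M)) :
  (forall v, g (f♭ v) = v) -> (forall v, f♭ (g v) = v) -> {h : Mor N M | h♭ = g}.
Proof.
move=> gf fg; apply: cid; have [h [hf fh]] := mod_iso gf fg.
exists h; apply/lfunP=> v; rewrite -[v in LHS]fg.
by rewrite -mod_compE hf mod_idE.
Qed.

Definition massoci M N P : Mor (T M (T N P)) (T (T M N) P) :=
  sval (mod_inv (f := massoc M N P) (@massocK M N P) (@massociK M N P)).
Lemma massociE M N P m n p : (massoci M N P)♭ (m # (n # p)) = (m # n) # p.
Proof. by rewrite /massoci (svalP (mod_inv _ _)) massocifE. Qed.

Definition Aone : Mod A := regular_module A.
Local Notation vb := (@vacb k X : idx -> und Aone).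
(** The unit element of the vacuum; it generates the regular module by [rho_vone]. *)
Definition vone : und Aone := \sum_c vb (1%g, c).

Lemma rho_one q r : rho Aone q (vb r) = vac_mulb k q r.
Proof. by rewrite rhoE /= vac_mulE. Qed.

Lemma rho_vone q : rho Aone q vone = vb q.
Proof.
rewrite linear_sum (bigD1 q.2) //= rho_one /vac_mulb eqxx mulg1 big1 ?addr0.
  by case: q.
by move=> c ne; rewrite rho_one /vac_mulb eq_sym (negbTE ne).
Qed.

Lemma gQ_vb g q : gQ ⌊Aone⌋ g (vb q) = vb (vact g q).
Proof. by rewrite [LHS]vextE. Qed.
Lemma vone_homog : homog (V := vac_obj k X) 1%g (vone : vacV k X).
Proof.
have := ghom_homog (vac_onem k X) (homog_one X (1 : k^o)).
by rewrite /= vac_oneE scale1r.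
Qed.
Lemma gQ_vone g : gQ ⌊Aone⌋ g vone = vone.
Proof.
have := ghomQ (vac_onem k X) g (1 : k^o).
by rewrite id_lfunE /= vac_oneE scale1r.
Qed.
Lemma vac_tn_ext M (U : vectType k) (f g : 'Hom(und (T Aone M), U)) :
  (forall q m, f (vb q # m) = g (vb q # m)) -> f = g.
Proof.
move=> e; apply: tn_ext => a m; rewrite (vac_dec a) tn_suml !linear_sum.
by apply: eq_bigr => q _; rewrite tnZl !linearZ /= e.
Qed.
Lemma tn_vac_ext M (U : vectType k) (f g : 'Hom(und (T M Aone), U)) :
  (forall q m, f (m # vb q) = g (m # vb q)) -> f = g.
Proof.
move=> e; apply: tn_ext => m a; rewrite (vac_dec a) tn_sumr !linear_sum.
by apply: eq_bigr => q _; rewrite tnZr !linearZ /= e.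
Qed.

Section Units.
Variable M : Mod A.

Fact lunit_balanced : balanced (N := M) (M := Aone) (gfun (mod_act M)).
Proof.
move=> q a m; suff /lfunP/(_ a) : (gfun (mod_act M) \o tprodR _ m \o rho Aone q =
    gfun (mod_act M) \o tprodR _ (rho M q m))%VF.
  by rewrite [LHS]comp_lfunE [LHS]comp_lfunE [RHS]comp_lfunE !tprodRE.
apply: vac_ext => r; rewrite [LHS]comp_lfunE [LHS]comp_lfunE [RHS]comp_lfunE !tprodRE.
rewrite rho_one -rhoE rhoM /vac_mulb eq_sym.
case: eqP => [e|_]; last by rewrite tprod0l linear0.
by rewrite -rhoE vmulC.
Qed.
Definition mlunitf : 'Hom(und (T Aone M), und M) := tdesc char0 (M := Aone) (gfun (mod_act M)).
Lemma mlunitfE a m : mlunitf (a # m) = mod_act M (tprod a m).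
Proof. by rewrite [LHS](tdescE _ _ _ lunit_balanced). Qed.

Definition mlunit : Mor (T Aone M) M.
Proof.
apply: (@ten_hom k char0 X Aone M M mlunitf).
- move=> u v a m ha hm; rewrite mlunitfE; apply: ghom_homog.
  exact: (homog_tprod (V := vac_obj k X) ha hm).
- move=> g u v a m _ _; rewrite !mlunitfE -ghomQ; congr (mod_act M _).
  by rewrite [RHS](tensQE (V := vac_obj k X)).
- move=> q u v a m _ _; rewrite tn_balanced !mlunitfE.
  suff /lfunP/(_ a) : (gfun (mod_act M) \o tprodR _ (rho M q m) =
      rho M q \o (gfun (mod_act M) \o tprodR _ m))%VF.
    by rewrite [LHS]comp_lfunE [RHS]comp_lfunE [X in _ = rho _ _ X]comp_lfunE !tprodRE.
  apply: vac_ext => r; rewrite [LHS]comp_lfunE [RHS]comp_lfunE [X in _ = rho _ _ X]comp_lfunE.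
  by rewrite !tprodRE -!rhoE rho_comm.
Defined.
Lemma mlunitE q m : mlunit♭ (vb q # m) = rho M q m.
Proof. by rewrite [LHS]mlunitfE rhoE. Qed.
Lemma mlunit_act a m : mlunit♭ (a # m) = mod_act M (tprod a m).
Proof. exact: mlunitfE. Qed.

Fact mlunit_iso : is_iso mlunit.
Proof.
apply: (@mod_iso _ _ _ (tpr char0 Aone M \o tprodL _ vone)%VF) => w.
  suff /lfunP/(_ w) : ((tpr char0 Aone M \o tprodL _ vone) \o mlunit♭ = \1)%VF.
    by rewrite [LHS]comp_lfunE id_lfunE.
  apply: vac_tn_ext => q m; rewrite [LHS]comp_lfunE mlunitE [LHS]comp_lfunE tprodLE id_lfunE.
  by rewrite -[LHS]/(_ # _) -tn_balanced rho_vone.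
rewrite comp_lfunE tprodLE -/(_ # _) tn_suml linear_sum -[RHS]rho1.
by apply: eq_bigr => c _; rewrite [LHS]mlunitE.
Qed.

Lemma braid_vac (m : und M) q : tbraid ⌊M⌋ (vac_obj k X) (tprod m (vb q)) = tprod (vb q) m.
Proof.
suff /lfunP/(_ m) : (tbraid ⌊M⌋ (vac_obj k X) \o tprodR _ (vacb k q) = tprodL _ (vacb k q))%VF.
  by rewrite [LHS]comp_lfunE tprodRE tprodLE.
apply: (homog_ext (V := ⌊M⌋)) => u {}m hm; rewrite [LHS]comp_lfunE tprodRE tprodLE.
by rewrite (tbraidE (W := vac_obj k X) _ hm) [gQ _ _ _]vextE -/(vact _ _) vact_bd.
Qed.

Let F : 'Hom(tensV (und M) (und Aone), und M) :=
  (gfun (mod_act M) \o tbraid ⌊M⌋ (vac_obj k X))%VF.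
Lemma runitF m q : F (tprod m (vb q)) = rho M q m.
Proof. by rewrite [LHS]comp_lfunE braid_vac rhoE. Qed.
Fact runit_balanced : balanced (M := M) (N := Aone) F.
Proof.
move=> q m a; suff /lfunP/(_ a) : (F \o tprodL _ (rho M q m) =
    F \o tprodL _ m \o rho Aone q)%VF.
  by rewrite [LHS]comp_lfunE [RHS]comp_lfunE [RHS]comp_lfunE !tprodLE.
apply: vac_ext => r; rewrite [LHS]comp_lfunE [RHS]comp_lfunE [RHS]comp_lfunE !tprodLE.
rewrite runitF rho_one rhoM /vac_mulb eq_sym.
case: eqP => [e|_]; last by rewrite tprod0r linear0.
by rewrite runitF vmulC.
Qed.
Definition mrunitf : 'Hom(und (T M Aone), und M) := tdesc char0 (N := Aone) F.
Lemma mrunitfF m a : mrunitf (m # a) = F (tprod m a).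
Proof. by rewrite [LHS](tdescE _ _ _ runit_balanced). Qed.

Definition mrunit : Mor (T M Aone) M.
Proof.
apply: (@ten_hom k char0 X M Aone M mrunitf).
- move=> u v m a hm ha; rewrite mrunitfF.
  exact: (@ghom_homog k X (gtens ⌊M⌋ (vac_obj k X)) ⌊M⌋
    (mod_act M ∘ braid ⌊M⌋ (vac_obj k X)) _ _ (homog_tprod hm ha)).
- move=> g u v m a _ _; rewrite !mrunitfF.
  apply: etrans (ghomQ (mod_act M ∘ braid ⌊M⌋ (vac_obj k X) : ghom _ _) g (tprod m a)).
  by congr (F _); rewrite [RHS](tensQE (W := vac_obj k X)).
- move=> q u v m a _ _; rewrite !mrunitfF.
  suff /lfunP/(_ a) : (F \o tprodL _ (rho M q m) = rho M q \o (F \o tprodL _ m))%VF.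
    by rewrite [LHS]comp_lfunE [RHS]comp_lfunE [X in _ = rho _ _ X]comp_lfunE !tprodLE.
  apply: vac_ext => r; rewrite [LHS]comp_lfunE [RHS]comp_lfunE [X in _ = rho _ _ X]comp_lfunE.
  by rewrite !tprodLE !runitF rho_comm.
Defined.
Lemma mrunitE q m : mrunit♭ (m # vb q) = rho M q m.
Proof. by rewrite [LHS]mrunitfF runitF. Qed.
Lemma mrunit_act m a : mrunit♭ (m # a) = mod_act M (tbraid ⌊M⌋ (vac_obj k X) (tprod m a)).
Proof. by rewrite [LHS]mrunitfF [LHS]comp_lfunE. Qed.

Fact mrunit_iso : is_iso mrunit.
Proof.
apply: (@mod_iso _ _ _ (tpr char0 M Aone \o tprodR _ vone)%VF) => w.
  suff /lfunP/(_ w) : ((tpr char0 M Aone \o tprodR _ vone) \o mrunit♭ = \1)%VF.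
    by rewrite [LHS]comp_lfunE id_lfunE.
  apply: tn_vac_ext => q m; rewrite [LHS]comp_lfunE mrunitE [LHS]comp_lfunE tprodRE id_lfunE.
  by rewrite -[LHS]/(_ # _) tn_balanced rho_vone.
rewrite comp_lfunE tprodRE -/(_ # _) tn_sumr linear_sum -[RHS]rho1.
by apply: eq_bigr => c _; rewrite [LHS]mrunitE.
Qed.
End Units.

Fact mtensm1 M N : mtensm (idm M) (idm N) = idm (T M N).
Proof. by apply: mod_eq; apply: tn_ext => m n; rewrite mtensmE !mod_idE. Qed.
Fact mtensmM M M' M'' N N' N'' (f' : Mor M' M'') (f : Mor M M') (g' : Mor N' N'')
  (g : Mor N N') : mtensm (f' ∘ f) (g' ∘ g) = mtensm f' g' ∘ mtensm f g.
Proof.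
apply: mod_eq; apply: tn_ext => m n.
by rewrite mod_compE !mtensmE !mod_compE.
Qed.

Lemma mod_linE M N a (f g : Mor M N) v : (a *: f + g)♭ v = a *: f♭ v + g♭ v.
Proof. by rewrite -scale_lfunE -add_lfunE. Qed.

Fact mtensm_linl M M' N N' (g : Mor N N') : linear (fun f : Mor M M' => mtensm f g).
Proof.
move=> a f f'; apply: mod_eq; apply: tn_ext => m n.
by rewrite mod_linE !mtensmE mod_linE /tn tprodPl linearP.
Qed.
Fact mtensm_linr M M' N N' (f : Mor M M') : linear (fun g : Mor N N' => mtensm f g).
Proof.
move=> a g g'; apply: mod_eq; apply: tn_ext => m n.
by rewrite mod_linE !mtensmE mod_linE /tn tprodPr linearP.
Qed.
Fact massoc_inv1 M N P : massoci M N P ∘ massoc M N P = idm _.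
Proof.
apply: mod_eq; apply: tn_ext3l => m n p.
by rewrite mod_compE massocE massociE mod_idE.
Qed.
Fact massoc_inv2 M N P : massoc M N P ∘ massoci M N P = idm _.
Proof.
apply: mod_eq; apply: tn_ext3r => m n p.
by rewrite mod_compE massociE massocE mod_idE.
Qed.
Fact massoc_nat M M' N N' P P' (f : Mor M M') (g : Mor N N') (h : Mor P P') :
  massoc M' N' P' ∘ mtensm (mtensm f g) h = mtensm f (mtensm g h) ∘ massoc M N P.
Proof.
apply: mod_eq; apply: tn_ext3l => m n p.
by rewrite !mod_compE massocE !mtensmE massocE.
Qed.
Fact mlunit_nat M N (f : Mor M N) : mlunit N ∘ mtensm (idm Aone) f = f ∘ mlunit M.
Proof.
apply: mod_eq; apply: vac_tn_ext => q m.
by rewrite !mod_compE mtensmE mod_idE !mlunitE homrho.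
Qed.
Fact mrunit_nat M N (f : Mor M N) : mrunit N ∘ mtensm f (idm Aone) = f ∘ mrunit M.
Proof.
apply: mod_eq; apply: tn_vac_ext => q m.
by rewrite !mod_compE mtensmE mod_idE !mrunitE homrho.
Qed.
Fact mod_pentagon M N P Q : massoc M N (T P Q) ∘ massoc (T M N) P Q =
  mtensm (idm M) (massoc N P Q) ∘ massoc M (T N P) Q ∘ mtensm (massoc M N P) (idm Q).
Proof.
apply: mod_eq; apply: tn_ext4l => m n p q.
by rewrite !mod_compE mtensmE !massocE mtensmE massocE !mod_idE.
Qed.
Fact mod_triangle M N :
  mtensm (idm M) (mlunit N) ∘ massoc M Aone N = mtensm (mrunit M) (idm N).
Proof.
apply: mod_eq; apply: tn_ext3l => m a n.
rewrite mod_compE massocE !mtensmE mod_idE mod_idE (vac_dec a).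
rewrite tn_suml tn_sumr !linear_sum tn_sumr tn_suml; apply: eq_bigr => q _.
by rewrite tnZl tnZr !linearZ tnZl tnZr /= mlunitE mrunitE tn_balanced.
Qed.

Definition mod_monoidal : monoidal (Mod A) := @Monoidal k (Mod A) T Aone mtensm massoc
  massoci mlunit mrunit mtensm1 mtensmM mtensm_linl mtensm_linr massoc_inv1 massoc_inv2
  mlunit_iso mrunit_iso massoc_nat mlunit_nat mrunit_nat mod_pentagon mod_triangle.
End ModMonoidal.

(** * Braiding and twist *)

Section ModRibbon.
Variables (k : fieldType) (char0 : [pchar k] =i pred0) (X : crossed_module).
Local Notation act := (cm_act X).
Local Notation bd := (cm_bd X).
Local Notation C := (catM k X).
Local Notation A := (vacuum k X).
Local Notation "⌊ M ⌋" := (mod_obj (M : left_module A)) (M at level 99).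
Local Notation und M := (gV ⌊M⌋).
Local Notation "f ♭" := (gfun (mod_mor f)) (at level 2, format "f ♭").
Local Notation T := (@tenM k char0 X).
Local Notation "m # n" := (tn char0 m n) (at level 39, left associativity).
Implicit Types M N P : Mod A.

Local Notation mtensm := (@mtensm k char0 X _ _ _ _).
Local Notation massoc := (@massoc k char0 X).
Local Notation massoci := (@massoci k char0 X).

Lemma tn_ext3l_homog M N P (U : vectType k) (f g : 'Hom(und (T (T M N) P), U)) :
  (forall u v m n p, homog u m -> homog v n ->
    f ((m # n) # p) = g ((m # n) # p)) -> f = g.
Proof.
move=> e; apply: tn_ext3l => m n p.
rewrite (homog_dec m) !tn_suml !linear_sum; apply: eq_bigr => u _.
rewrite (homog_dec n) tn_sumr !tn_suml !linear_sum; apply: eq_bigr => v _.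
by apply: (e u v); apply: gP_homog.
Qed.

Lemma tn_ext3r_homog M N P (U : vectType k) (f g : 'Hom(und (T M (T N P)), U)) :
  (forall u v m n p, homog u m -> homog v n ->
    f (m # (n # p)) = g (m # (n # p))) -> f = g.
Proof.
move=> e; apply: tn_ext3r => m n p.
rewrite (homog_dec m) !tn_suml !linear_sum; apply: eq_bigr => u _.
rewrite (homog_dec n) !tn_suml !tn_sumr !linear_sum; apply: eq_bigr => v _.
by apply: (e u v); apply: gP_homog.
Qed.

Section Braid.
Variables M N : Mod A.
Let F := (tpr char0 N M \o tbraid ⌊M⌋ ⌊N⌋)%VF.
Let FE u m n : homog u m -> F (tprod m n) = gQ ⌊N⌋ (bd u) n # m.
Proof. by move=> hm; rewrite [LHS]comp_lfunE (tbraidE _ hm). Qed.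

(** The vacuum is transparent: its elements have degrees in the kernel of the boundary
    map, and the image of the boundary map acts on it trivially. Hence the braiding
    descends to the tensor product of modules. *)
Fact braid_balanced : balanced F.
Proof.
move=> q m n; suff /lfunP/(_ m) : (F \o tprodR _ n \o rho M q =
    F \o tprodR _ (rho N q n))%VF.
  by rewrite [LHS]comp_lfunE [LHS]comp_lfunE [RHS]comp_lfunE !tprodRE.
apply: (homog_ext (V := ⌊M⌋)) => u {}m hm.
rewrite [LHS]comp_lfunE [LHS]comp_lfunE [RHS]comp_lfunE !tprodRE.
rewrite (FE _ hm) (FE _ (rho_homog q hm)) bd_vdegM -tn_balanced.
by rewrite rhoQ_bd.
Qed.
Definition mbraidf : 'Hom(und (T M N), und (T N M)) := tdesc char0 F.
Lemma mbraidfE u m n : homog u m -> mbraidf (m # n) = gQ ⌊N⌋ (bd u) n # m.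
Proof. by move=> hm; rewrite [LHS](tdescE _ _ _ braid_balanced) (FE _ hm). Qed.

Definition mbraid : Mor (T M N) (T N M).
Proof.
apply: (@ten_hom k char0 X M N (T N M) mbraidf).
- move=> u v m n hm hn; rewrite (mbraidfE _ hm).
  have -> : (u * v)%g = (act v (bd u)^-1 * u)%g by rewrite cm_act_bdV mulgKV.
  by apply: tn_homog => //; apply: gQ_homog.
- move=> g u v m n hm hn; rewrite (mbraidfE _ hm) (mbraidfE _ (gQ_homog g hm)) tnQ.
  by rewrite !gQQE cm_bd_act conjgE invgK !mulgA mulgKV.
- move=> q u v m n hm hn; rewrite (mbraidfE _ hm) (mbraidfE _ (rho_homog q hm)).
  by rewrite bd_vdegM tn_rho tn_balanced.
Defined.
Lemma mbraidE u m n : homog u m -> mbraid♭ (m # n) = gQ ⌊N⌋ (bd u) n # m.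
Proof. exact: mbraidfE. Qed.

Let F' := (tpr char0 M N \o tbraidi ⌊M⌋ ⌊N⌋)%VF.
Let FE' u m n : homog u m -> F' (tprod n m) = m # gQ ⌊N⌋ (bd u)^-1%g n.
Proof. by move=> hm; rewrite [LHS]comp_lfunE (tbraidiE _ hm). Qed.
Let F'_balanced : balanced F'.
Proof.
move=> q n m; suff /lfunP/(_ m) : (F' \o tprodL _ (rho N q n) =
    F' \o tprodL _ n \o rho M q)%VF.
  by rewrite [LHS]comp_lfunE [RHS]comp_lfunE [RHS]comp_lfunE !tprodLE.
apply: (homog_ext (V := ⌊M⌋)) => u {}m hm.
rewrite [LHS]comp_lfunE [RHS]comp_lfunE [RHS]comp_lfunE !tprodLE.
rewrite (FE' _ hm) (FE' _ (rho_homog q hm)) bd_vdegM tn_balanced.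
by rewrite -cm_bdV rhoQ_bd.
Qed.
Let inv : 'Hom(und (T N M), und (T M N)) := tdesc char0 F'.
Let invE u m n : homog u m -> inv (n # m) = m # gQ ⌊N⌋ (bd u)^-1%g n.
Proof. by move=> hm; rewrite [LHS](tdescE _ _ _ F'_balanced) (FE' _ hm). Qed.

Fact mbraid_iso : is_iso mbraid.
Proof.
apply: (mod_iso (g := inv)) => w.
  suff /lfunP/(_ w) : (inv \o mbraid♭ = \1)%VF by rewrite [LHS]comp_lfunE id_lfunE.
  apply: tn_homog_ext => u v m n hm hn; rewrite [LHS]comp_lfunE (mbraidE _ hm) id_lfunE.
  by rewrite (invE _ hm) gQK.
suff /lfunP/(_ w) : (mbraid♭ \o inv = \1)%VF by rewrite [LHS]comp_lfunE id_lfunE.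
apply: tn_homog_ext => u v n m hn hm; rewrite [LHS]comp_lfunE (invE _ hm) id_lfunE.
by rewrite (mbraidE _ hm) gQKV.
Qed.
End Braid.

Fact mbraid_nat M M' N N' (f : Mor M M') (g : Mor N N') :
  mbraid M' N' ∘ mtensm f g = mtensm g f ∘ mbraid M N.
Proof.
apply: mod_eq; apply: tn_homog_ext => u v m n hm hn.
by rewrite !mod_compE mtensmE (mbraidE _ hm) mtensmE (mbraidE _ (ghom_homog _ hm)) ghomQ.
Qed.

Fact mod_hexagonr M N P : massoc N P M ∘ mbraid M (T N P) ∘ massoc M N P =
  mtensm (idm N) (mbraid M P) ∘ massoc N M P ∘ mtensm (mbraid M N) (idm P).
Proof.
apply: mod_eq; apply: tn_ext3l_homog => u v m n p hm hn.
rewrite !mod_compE massocE (mbraidE _ hm) tnQ massocE mtensmE (mbraidE _ hm) massocE.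
by rewrite mtensmE (mbraidE _ hm) !mod_idE.
Qed.

Fact mod_hexagonl M N P : massoci P M N ∘ mbraid (T M N) P ∘ massoci M N P =
  mtensm (mbraid M P) (idm N) ∘ massoci M P N ∘ mtensm (idm M) (mbraid N P).
Proof.
apply: mod_eq; apply: tn_ext3r_homog => u v m n p hm hn.
rewrite !mod_compE massociE (mbraidE _ (tn_homog char0 hm hn)) massociE mtensmE mod_idE.
by rewrite (mbraidE _ hn) massociE mtensmE (mbraidE _ hm) mod_idE gQQE cm_bdM.
Qed.

Definition mod_braided : @braided k (Mod A) (mod_monoidal char0 X) :=
  @Braided k (Mod A) (mod_monoidal char0 X) mbraid mbraid_iso mbraid_nat mod_hexagonr
    mod_hexagonl.

Section Twist.
Variable M : Mod A.
Lemma ttwist_rho q v : ttwist ⌊M⌋ (rho M q v) = rho M q (ttwist ⌊M⌋ v).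
Proof.
suff /lfunP/(_ v) : (ttwist ⌊M⌋ \o rho M q = rho M q \o ttwist ⌊M⌋)%VF.
  by rewrite [LHS]comp_lfunE [RHS]comp_lfunE.
apply: (homog_ext (V := ⌊M⌋)) => u w hw; rewrite [LHS]comp_lfunE [RHS]comp_lfunE.
by rewrite (ttwistE hw) (ttwistE (rho_homog q hw)) bd_vdegM rhoQ_bd.
Qed.
Definition mtwist : Mor M M.
Proof.
apply: (@mk_hom k X M M (ttwist ⌊M⌋)).
- by move=> u v hv; rewrite (ttwistE hv); apply: ttwist_homog.
- by move=> g v; apply: (ghomQ (gtwist ⌊M⌋)).
- exact: ttwist_rho.
Defined.
Lemma mtwistE u v : homog (V := ⌊M⌋) u v -> mtwist♭ v = gQ ⌊M⌋ (bd u) v.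
Proof. exact: ttwistE. Qed.

Fact mtwist_iso : is_iso mtwist.
Proof.
have [h [hf fh]] := gtwist_iso (⌊M⌋ : C).
apply: (mod_iso (g := gfun h)) => v.
  have /lfunP/(_ v) := congr1 (@gfun _ _ _ _) hf.
  by rewrite [LHS]comp_lfunE id_lfunE.
have /lfunP/(_ v) := congr1 (@gfun _ _ _ _) fh.
by rewrite [LHS]comp_lfunE id_lfunE.
Qed.
End Twist.

Fact mtwist_nat M N (f : Mor M N) : mtwist N ∘ f = f ∘ mtwist M.
Proof.
apply: mod_eq; apply: (homog_ext (V := ⌊M⌋)) => u v hv.
by rewrite !mod_compE (mtwistE hv) (mtwistE (ghom_homog _ hv)) ghomQ.
Qed.

Fact mtwist_tens M N : mtwist (T M N) =
  mbraid N M ∘ mbraid M N ∘ mtensm (mtwist M) (mtwist N).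
Proof.
apply: mod_eq; apply: tn_homog_ext => u v m n hm hn.
rewrite !mod_compE (mtwistE (tn_homog char0 hm hn)) mtensmE (mtwistE hm) (mtwistE hn).
rewrite (mbraidE _ (ttwist_homog hm)) (mbraidE _ (gQ_homog (bd u) (ttwist_homog hn))).
by rewrite tnQ !gQQE -!cm_bdM cm_act_bdV mulgKV.
Qed.
End ModRibbon.

(** * Duals *)

Section ModDual.
Variables (k : fieldType) (char0 : [pchar k] =i pred0) (X : crossed_module).
Local Notation A := (vacuum k X).
Local Notation idx := (vac_index X).
Local Notation "⌊ M ⌋" := (mod_obj (M : left_module A)) (M at level 99).
Local Notation und M := (gV ⌊M⌋).
Local Notation vdeg := (@vac_degree X).
Local Notation "f ♭" := (gfun (mod_mor f)) (at level 2, format "f ♭").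
Local Notation T := (@tenM k char0 X).
Local Notation "m # n" := (tn char0 m n) (at level 39, left associativity).
Implicit Types M N P : Mod A.

Local Notation Aone := (@Aone k X).
Local Notation vb := (@vacb k X : idx -> und Aone).
Local Notation mtensm := (@mtensm k char0 X _ _ _ _).
Local Notation massoc := (@massoc k char0 X).
Local Notation massoci := (@massoci k char0 X).
Local Notation mlunit := (@mlunit k char0 X).
Local Notation mrunit := (@mrunit k char0 X).

Local Notation mtwist := (@mtwist k X).
Local Notation nK := (nK k X).

Section Dual.
Variable M : Mod A.
Local Notation D := (gdual ⌊M⌋).
Definition dual_rho (q : idx) : 'End(gV D) := transp (rho M q).
Lemma dual_rhoE q (phi : dualV (und M)) v :
  (dual_rho q phi : 'Hom(und M, k^o)) v = (phi : 'Hom(und M, k^o)) (rho M q v).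
Proof. exact: transpE. Qed.

Fact dual_RM p q (phi : gV D) :
  dual_rho p (dual_rho q phi) = if p.2 == q.2 then dual_rho (vmul p q) phi else 0.
Proof.
apply/lfunP=> v; rewrite dual_rhoE dual_rhoE rhoM eq_sym.
case: eqP => [e|_]; last by rewrite linear0 zero_lfunE.
by rewrite dual_rhoE vmulC.
Qed.
Fact dual_R1 (phi : gV D) : \sum_c dual_rho (1%g, c) phi = phi.
Proof.
apply/lfunP=> v; rewrite sum_lfunE -[in RHS](rho1 v) linear_sum.
by apply: eq_bigr => c _; rewrite dual_rhoE.
Qed.
Fact dual_RP q u (phi : gV D) : homog u phi -> homog (V := D) (vdeg q * u)%g (dual_rho q phi).
Proof.
move=> hp; apply/lfunP=> v; rewrite /= transpE !dual_rhoE rhoP -{2}hp /= transpE.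
by rewrite -(vdeg_central q u) invMg mulKVg.
Qed.
Fact dual_RQ g q (phi : gV D) : gQ D g (dual_rho q phi) = dual_rho (vact g q) (gQ D g phi).
Proof.
apply/lfunP=> v; rewrite [LHS]transpE !dual_rhoE [RHS]transpE; congr (fun_of_lfun _ _).
rewrite Qrho; congr (rho _ _ _); case: q => x c; rewrite /vact /=.
by rewrite mulgA -cmI_cosetM mulVg morph1 mul1g.
Qed.
Definition mdual : Mod A := mk_mod dual_RM dual_R1 dual_RP dual_RQ.
Local Notation phiv phi v := ((phi : 'Hom(und M, k^o)) v).

Lemma mdual_rho q (phi : und mdual) v : phiv (rho mdual q phi) v = phiv phi (rho M q v).
Proof. by rewrite rho_mk; apply: dual_rhoE. Qed.
Lemma mdual_Q g (phi : und mdual) v : phiv (gQ ⌊mdual⌋ g phi) v = phiv phi (gQ ⌊M⌋ g^-1%g v).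
Proof. exact: transpE. Qed.
Lemma mdual_homog u w (phi : und mdual) v : homog u phi -> homog w v ->
  u != w^-1%g -> phiv phi v = 0.
Proof.
move=> hp hv ne; rewrite -hp [LHS]transpE (homogP _ hv) -(inj_eq invg_inj) invgK.
by rewrite (negbTE ne) linear0.
Qed.

(** Linearity over the vacuum forces the coordinate at [q] of the evaluation to pair [phi]
    with the action of the element dual to [q]. *)
Let F : 'Hom(tensV (und mdual) (und M), und Aone) :=
  (\sum_q (linfun (scalev (vacb k q)) \o tev (und M) \o tmap \1 (rho M (vinv q))))%VF.
Let FE phi m : F (tprod phi m) = \sum_q phiv phi (rho M (vinv q) m) *: vb q.
Proof.
rewrite sum_lfunE; apply: eq_bigr => q _.
by rewrite 2!comp_lfunE tmapE id_lfunE tevE lfunE.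
Qed.
Fact ev_balanced : balanced (M := mdual) (N := M) F.
Proof.
move=> q phi m; rewrite !FE; apply: eq_bigr => p _.
by rewrite mdual_rho rho_comm.
Qed.
Definition mevf : 'Hom(und (T mdual M), und Aone) := tdesc char0 F.
Lemma mevfE phi m : mevf (phi # m) = \sum_q phiv phi (rho M (vinv q) m) *: vb q.
Proof. by rewrite [LHS](tdescE _ _ _ ev_balanced) FE. Qed.

Definition mev : Mor (T mdual M) Aone.
Proof.
apply: (@ten_hom k char0 X mdual M Aone mevf).
- move=> u v phi m hp hm; rewrite mevfE /homog linear_sum; apply: eq_bigr => q _.
  rewrite linearZ /= [X in _ *: X](homogP (V := vac_obj k X) _ (vac_homog k q)).
  case: eqP => [//|ne]; rewrite (mdual_homog hp (rho_homog _ hm)) ?scale0r //.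
  rewrite vdeg_inv; apply/eqP => e; apply: ne.
  by rewrite e invMg invgK vdeg_central mulgKV.
- move=> g u v phi m _ _; rewrite !mevfE linear_sum (reindex_inj (@vact_inj X g)).
  apply: eq_bigr => q _; rewrite linearZ mdual_Q -[vinv (vact g q)]/(vact g (vinv q)).
  by rewrite -Qrho gQK; congr (_ *: _); rewrite [RHS]gQ_vb.
- move=> q u v phi m _ _; rewrite !mevfE linear_sum.
  transitivity (\sum_(p | p.2 == q.2) phiv phi (rho M (vmul (vinv p) q) m) *: vb p).
    rewrite [RHS]big_mkcond; apply: eq_bigr => p _; rewrite mdual_rho rhoM eq_sym /=.
    case: eqP => [e|_]; last by rewrite linear0 scale0r.
    by rewrite vmulC.
  rewrite -(casimir (fun p p' => phiv phi (rho M p' m) *: vb p)) big_mkcond.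
  apply: eq_bigr => p _; rewrite linearZ /= rho_one /vac_mulb eq_sym.
  by case: eqP => [e|_]; rewrite ?scaler0 // -/(vmul _ _) vmulC.
Defined.
Lemma mevE phi m : mev♭ (phi # m) = \sum_q phiv phi (rho M (vinv q) m) *: vb q.
Proof. exact: mevfE. Qed.

Definition coev1 : und (T M mdual) := tpr char0 M mdual (tcoev1 (und M)).
Lemma coev1E : coev1 = \sum_(i < \dim {:und M}) (vbasis {:und M})`_i # (dbasis i : und mdual).
Proof. by rewrite /coev1 /tcoev1 linear_sum. Qed.

Lemma tpr_op N P j t : catM_op ⌊T N P⌋ j (tpr char0 N P t) =
  tpr char0 N P (catM_op (gtens ⌊N⌋ ⌊P⌋) j t).
Proof.
suff /lfunP/(_ t) : (catM_op ⌊T N P⌋ j \o tpr char0 N P =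
    tpr char0 N P \o catM_op (gtens ⌊N⌋ ⌊P⌋) j)%VF.
  by rewrite [LHS]comp_lfunE [RHS]comp_lfunE.
apply: (homog_tens_ext (V := ⌊N⌋) (W := ⌊P⌋)) => u v n p hn hp.
rewrite [LHS]comp_lfunE [RHS]comp_lfunE -/(_ # _); case: j => [l|g] /=.
  rewrite (homogP _ (tn_homog char0 hn hp)) (tensPE _ hn hp).
  by case: eqP => _; rewrite ?linear0.
by rewrite tnQ [X in tpr _ _ _ X]tensQE.
Qed.

Lemma coev1_homog : homog (V := ⌊T M mdual⌋) 1%g coev1.
Proof.
rewrite /homog [LHS](tpr_op (inl 1%g)); congr (tpr _ _ _ _).
have := ghom_homog (gcoev ⌊M⌋) (homog_one X (1 : k^o)).
by rewrite /homog /= tcoevE scale1r.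
Qed.
Lemma coev1_Q g : gQ ⌊T M mdual⌋ g coev1 = coev1.
Proof.
rewrite [LHS](tpr_op (inr g)); congr (tpr _ _ _ _).
have := ghomQ (gcoev ⌊M⌋) g (1 : k^o).
by rewrite id_lfunE /= tcoevE scale1r.
Qed.

(** The factor [nK^-1] compensates for the sum over [K] that the evaluation produces in the
    zigzag identities. *)
Definition mcoevf : 'Hom(und Aone, und (T M mdual)) :=
  vext (fun q => nK^-1 *: rho (T M mdual) q coev1).
Lemma mcoevfE q : mcoevf (vb q) = nK^-1 *: rho (T M mdual) q coev1.
Proof. exact: vextE. Qed.

Definition mcoev : Mor Aone (T M mdual).
Proof.
apply: (@mk_hom k X Aone (T M mdual) mcoevf).
- move=> u a ha; rewrite /homog.
  suff /lfunP/(_ a) : (gP ⌊T M mdual⌋ u \o mcoevf = mcoevf \o gP ⌊Aone⌋ u)%VF.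
    by rewrite [LHS]comp_lfunE => ->; rewrite [LHS]comp_lfunE ha.
  apply: vac_ext => q; rewrite [LHS]comp_lfunE [RHS]comp_lfunE mcoevfE.
  rewrite (homogP _ (homogZ _ (rho_homog q coev1_homog))) mulg1.
  rewrite [X in _ = mcoevf X](homogP (V := vac_obj k X) _ (vac_homog k q)).
  by case: eqP => _; rewrite ?linear0 ?mcoevfE.
- move=> g a; suff /lfunP/(_ a) : (mcoevf \o gQ ⌊Aone⌋ g = gQ ⌊T M mdual⌋ g \o mcoevf)%VF.
    by rewrite [LHS]comp_lfunE [RHS]comp_lfunE.
  apply: vac_ext => q; rewrite [LHS]comp_lfunE [RHS]comp_lfunE gQ_vb !mcoevfE.
  by rewrite linearZ /= Qrho coev1_Q.
- move=> q a; suff /lfunP/(_ a) : (mcoevf \o rho Aone q = rho (T M mdual) q \o mcoevf)%VF.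
    by rewrite [LHS]comp_lfunE [RHS]comp_lfunE.
  apply: vac_ext => p; rewrite [LHS]comp_lfunE [RHS]comp_lfunE rho_one mcoevfE.
  rewrite linearZ /= rhoM /vac_mulb.
  by case: eqP => _; rewrite ?linear0 ?scaler0 ?mcoevfE.
Defined.
Lemma mcoevE q : mcoev♭ (vb q) = nK^-1 *: \sum_(i < \dim {:und M})
  rho M q (vbasis {:und M})`_i # (dbasis i : und mdual).
Proof.
rewrite [LHS]mcoevfE coev1E linear_sum; congr (_ *: _).
by apply: eq_bigr => i _; rewrite [LHS]tn_rho.
Qed.

Fact mod_zigzagr : mrunit M ∘ mtensm (idm M) mev ∘ massoc M mdual M ∘
  mtensm mcoev (idm M) = mlunit M.
Proof.
apply: mod_eq; apply: vac_tn_ext => q m.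
rewrite !mod_compE mtensmE mcoevE mod_idE mlunitE tnZl tn_suml !linearZ !linear_sum /=.
transitivity (nK^-1 *: \sum_p rho M p (rho M (vinv p) (rho M q m))).
  congr (_ *: _); transitivity (\sum_(i < \dim {:und M}) \sum_p
      coord (vbasis {:und M}) i (rho M (vinv p) m) *: rho M p (rho M q (vbasis {:und M})`_i)).
    apply: eq_bigr => i _; rewrite massocE mtensmE mod_idE mevE tn_sumr linear_sum.
    apply: eq_bigr => p _; rewrite tnZr linearZ /= mrunitE.
    by rewrite dbasisE.
  rewrite exchange_big; apply: eq_bigr => p _ /=.
  rewrite (rho_comm (vinv p)) [in RHS](coord_vbasis (memvf (rho M (vinv p) m))) !linear_sum.
  by apply: eq_bigr => i _; rewrite !linearZ.
by rewrite rho_casimir scalerA mulVf ?scale1r // nK_neq0.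
Qed.

Fact mod_zigzagl : mlunit mdual ∘ mtensm mev (idm mdual) ∘ massoci mdual M mdual ∘
  mtensm (idm mdual) mcoev = mrunit mdual.
Proof.
apply: mod_eq; apply: tn_vac_ext => q phi.
rewrite !mod_compE mtensmE mcoevE mod_idE mrunitE tnZr tn_sumr !linearZ !linear_sum /=.
transitivity (nK^-1 *: \sum_p rho mdual p (rho mdual (vinv p) (rho mdual q phi))).
  congr (_ *: _); transitivity (\sum_(i < \dim {:und M}) \sum_p
      phiv phi (rho M (vinv p) (rho M q (vbasis {:und M})`_i)) *:
        rho mdual p (dbasis i : und mdual)).
    apply: eq_bigr => i _; rewrite massociE mtensmE mod_idE mevE tn_suml linear_sum.
    by apply: eq_bigr => p _; rewrite tnZl linearZ /= mlunitE.
  rewrite exchange_big; apply: eq_bigr => p _ /=.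
  rewrite [X in _ = rho mdual p X](dbasis_sum (rho mdual (vinv p) (rho mdual q phi))).
  rewrite linear_sum; apply: eq_bigr => i _; rewrite linearZ; congr (_ *: _).
  by rewrite !mdual_rho rho_comm.
by rewrite rho_casimir scalerA mulVf ?scale1r // nK_neq0.
Qed.

Fact mod_twist_dual : mev ∘ mtensm (mtwist mdual) (idm M) =
  mev ∘ mtensm (idm mdual) (mtwist M).
Proof.
apply: mod_eq; apply: tn_homog_ext => u v phi m hp hm.
rewrite !mod_compE !mtensmE !mod_idE !mevE (mtwistE hp) (mtwistE hm).
apply: eq_bigr => q _; congr (_ *: _); rewrite mdual_Q rhoQ_bd.
have hm' := rho_homog (vinv q) hm; have [e|ne] := eqVneq u (vdeg (vinv q) * v)^-1%g.
  by rewrite e cm_bdV bd_vdegM invgK.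
rewrite -cm_bdV (mdual_homog hp (gQ_homog _ hm')); last first.
  rewrite -cm_bdV invgK cm_peiffer; apply: contra_neq ne => e.
  by apply: (conjg_inj u); rewrite conjVg -e conjgE mulKg.
by rewrite -(bd_vdegM (vinv q)) (mdual_homog hp (ttwist_homog hm')).
Qed.
End Dual.

Definition mod_ribbon : @ribbon k (Mod A) (mod_monoidal char0 X) (mod_braided char0 X) :=
  @Ribbon k (Mod A) (mod_monoidal char0 X) (mod_braided char0 X) mtwist (@mtwist_iso k X)
    (@mtwist_nat k X) (@mtwist_tens k char0 X) mdual mev mcoev mod_zigzagr mod_zigzagl
    mod_twist_dual.
End ModDual.

(** * Comparison with the structure of the category of graded representations *)

Section Relative.
Variables (k : fieldType) (char0 : [pchar k] =i pred0) (X : crossed_module).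
Local Notation C := (catM k X).
Local Notation A := (vacuum k X).
Local Notation "⌊ M ⌋" := (mod_obj (M : left_module A)) (M at level 99).
Local Notation und M := (gV ⌊M⌋).
Local Notation T := (@tenM k char0 X).
Local Notation "m # n" := (tn char0 m n) (at level 39, left associativity).
Implicit Types M N P : Mod A.

Local Notation Aone := (@Aone k X).
Local Notation mlunit := (@mlunit k char0 X).
Local Notation mrunit := (@mrunit k char0 X).

Local Notation mbraid := (@mbraid k char0 X).
Local Notation mdual := (@mdual k X).

Lemma mod_act_dec M (a : vacV k X) (m : und M) :
  mod_act M (tprod a m) = \sum_q (a : {ffun _ -> k}) q *: rho M q m.
Proof.
rewrite [in LHS](vac_dec a) tprod_suml linear_sum; apply: eq_bigr => q _.
by rewrite tprodZl linearZ /= rhoE.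
Qed.

Fact rel_proj_subproof M N : tpr char0 M N \in is_ghom (gtens ⌊M⌋ ⌊N⌋) ⌊T M N⌋.
Proof.
apply: is_ghom_tensI => [u v m n hm hn|g u v m n hm hn]; first exact: tn_homog.
by rewrite -[LHS]tnQ.
Qed.
Definition rel_projm M N : Mor ((⌊M⌋ : C) ⊗ ⌊N⌋) ⌊T M N⌋ := GHom (rel_proj_subproof M N).

Fact rel_inc_subproof M N : tinc char0 M N \in is_ghom ⌊T M N⌋ (gtens ⌊M⌋ ⌊N⌋).
Proof.
have E j w : tinc char0 M N (catM_op ⌊T M N⌋ j w) =
    catM_op (gtens ⌊M⌋ ⌊N⌋) j (tinc char0 M N w).
  rewrite -{1}(tpr_tinc w) tpr_op tinc_tpr ten_idem_op -[X in catM_op _ _ X]tinc_tpr.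
  by rewrite tpr_tinc.
rewrite unfold_in; apply/andP; split; apply/forallP=> x; apply/eqP/lfunP=> w;
  rewrite [LHS]comp_lfunE [RHS]comp_lfunE; [exact: (E (inl x)) | exact: (E (inr x))].
Qed.
Definition rel_incm M N : Mor ⌊T M N⌋ ((⌊M⌋ : C) ⊗ ⌊N⌋) := GHom (rel_inc_subproof M N).

Lemma tens_balanceE M N m a n : gfun (tens_balance M N) (tprod (tprod m a) n) =
  \sum_q (a : {ffun _ -> k}) q *: (tprod (rho M q m) n - tprod m (rho N q n)).
Proof.
rewrite add_lfunE opp_lfunE comp_lfunE tassocE !tmapE !id_lfunE mod_act_dec.
rewrite comp_lfunE.
have -> : tbraid ⌊M⌋ (vac_obj k X) (tprod m a) = tprod a m.
  rewrite (vac_dec a) tprod_suml tprod_sumr linear_sum; apply: eq_bigr => q _.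
  by rewrite tprodZr tprodZl linearZ /= braid_vac.
rewrite mod_act_dec tprod_suml tprod_sumr -sumrB; apply: eq_bigr => q _.
by rewrite tprodZl tprodZr scalerBr.
Qed.

Fact rel_cokerm M N : is_coker (tens_balance M N) (rel_projm M N).
Proof.
split=> [|Z g gb].
  apply: ghom_eq; apply: tens_ext3l => m a n; rewrite [LHS]comp_lfunE tens_balanceE.
  rewrite linear_sum zero_lfunE big1 // => q _; rewrite linearZ linearB /=.
  by rewrite -!/(_ # _) tn_balanced subrr scaler0.
have bg : balanced (gfun g).
  move=> q m n; have /(congr1 (@gfun _ _ _ _))/lfunP := gb.
  move/(_ (tprod (tprod m (vacb k q)) n)); rewrite comp_lfunE tens_balanceE zero_lfunE.
  rewrite (bigD1 q) //= ffunE eqxx scale1r big1 ?addr0 => [|p ne].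
    by rewrite linearB => /eqP; rewrite subr_eq0 => /eqP.
  by rewrite ffunE (negbTE ne) scale0r.
have gE : g ∘ rel_incm M N ∘ rel_projm M N = g.
  apply: ghom_eq; apply/lfunP=> t; rewrite [LHS]comp_lfunE [LHS]comp_lfunE tinc_tpr.
  exact: balanced_idem.
exists (g ∘ rel_incm M N); split=> // h hp; rewrite -hp -mcompA.
suff -> : rel_projm M N ∘ rel_incm M N = idm _ by rewrite mcompm1.
by apply: ghom_eq; apply/lfunP=> w; rewrite [LHS]comp_lfunE tpr_tinc id_lfunE.
Qed.

Fact rel_actm M N : mod_act (T M N) ∘ (idm (A : C) ⊠ rel_projm M N) ∘ assoc (A : C) ⌊M⌋ ⌊N⌋ =
  rel_projm M N ∘ (mod_act M ⊠ idm (⌊N⌋ : C)).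
Proof.
apply: ghom_eq; apply: tens_ext3l => a m n.
rewrite [LHS]comp_lfunE [LHS]comp_lfunE [RHS]comp_lfunE tassocE !tmapE !id_lfunE.
rewrite !mod_act_dec tprod_suml linear_sum; apply: eq_bigr => q _.
by rewrite tprodZl linearZ /= [in LHS]tn_rho.
Qed.

Fact rel_lunitm M : mod_mor (mlunit M) ∘ rel_projm Aone M ∘
  (mod_mor (idm Aone) ⊠ idm (⌊M⌋ : C)) = mod_act M.
Proof.
apply: ghom_eq; apply: tens_ext => a m.
rewrite [LHS]comp_lfunE [LHS]comp_lfunE tmapE !id_lfunE.
exact: mlunit_act.
Qed.

Fact rel_runitm M : mod_mor (mrunit M) ∘ rel_projm M Aone ∘
  (idm (⌊M⌋ : C) ⊠ mod_mor (idm Aone)) = mod_act M ∘ braid (⌊M⌋ : C) A.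
Proof.
apply: ghom_eq; apply: tens_ext => m a.
rewrite [LHS]comp_lfunE [LHS]comp_lfunE [RHS]comp_lfunE tmapE !id_lfunE.
exact: mrunit_act.
Qed.

Fact rel_braidm M N : mod_mor (mbraid M N) ∘ rel_projm M N =
  rel_projm N M ∘ braid (⌊M⌋ : C) ⌊N⌋.
Proof.
apply: ghom_eq; apply: (homog_tens_ext (V := ⌊M⌋) (W := ⌊N⌋)) => u v m n hm hn.
rewrite [LHS]comp_lfunE [RHS]comp_lfunE [X in _ = tpr _ _ _ X](tbraidE _ hm).
exact: mbraidE.
Qed.

Lemma vac_tens3l_ext (V W U : vectType k)
    (f g : 'Hom(tensV (tensV (vacV k X) V) W, U)) :
  (forall q v w, f (tprod (tprod (vacb k q) v) w) = g (tprod (tprod (vacb k q) v) w)) ->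
  f = g.
Proof.
move=> e; apply: tens_ext => t w.
suff /lfunP/(_ t) : (f \o tprodR _ w = g \o tprodR _ w)%VF.
  by rewrite [LHS]comp_lfunE [RHS]comp_lfunE !tprodRE.
by apply: vac_tens_extl => q v; rewrite [LHS]comp_lfunE [RHS]comp_lfunE !tprodRE e.
Qed.

Fact rel_dual_actm M :
  ev (⌊M⌋ : C) ∘ ((idm (ldual (⌊M⌋ : C)) ∘ mod_act (mdual M)) ⊠ idm (⌊M⌋ : C)) =
  ev (⌊M⌋ : C) ∘ (idm (ldual (⌊M⌋ : C)) ⊠ mod_act M) ∘ assoc (ldual (⌊M⌋ : C)) A ⌊M⌋
    ∘ ((braid (A : C) (ldual (⌊M⌋ : C)) ∘ (idm (A : C) ⊠ idm (ldual (⌊M⌋ : C))))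
        ⊠ idm (⌊M⌋ : C)).
Proof.
apply: ghom_eq; apply: vac_tens3l_ext => q phi m.
rewrite [LHS]comp_lfunE [RHS]comp_lfunE [RHS]comp_lfunE [RHS]comp_lfunE !tmapE !id_lfunE.
rewrite [X in tev _ (tprod X _) = _]comp_lfunE id_lfunE.
rewrite [X in _ = tev _ (tmap _ _ (tassoc _ _ _ (tprod X _)))]comp_lfunE tmapE !id_lfunE.
rewrite [X in tev _ (tprod X _) = _](esym (rhoE (M := mdual M) q phi)).
rewrite [X in tassoc _ _ _ (tprod X _)](tbraidE (V := vac_obj k X) (W := gdual ⌊M⌋) _ (vac_homog k q)).
rewrite vac_degreeK gQ1E tassocE tmapE id_lfunE !tevE -rhoE.
exact: mdual_rho.
Qed.

Definition mod_relative : relative_ribbon A (mod_monoidal char0 X) (mod_braided char0 X)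
  (mod_ribbon char0 X).
Proof.
refine (@RelativeRibbon k C _ _ _ A (mod_monoidal char0 X) (mod_braided char0 X)
  (mod_ribbon char0 X) rel_projm rel_cokerm rel_actm _ _ (idm Aone) _ rel_lunitm
  rel_runitm rel_braidm _ (fun M => idm (ldual (⌊M⌋ : C))) _ rel_dual_actm).
- move=> M M' N N' f g; apply: ghom_eq; apply: tens_ext => m n.
  by rewrite [LHS]comp_lfunE [RHS]comp_lfunE tmapE; apply: mtensmE.
- move=> M N P; apply: ghom_eq; apply: tens_ext3l => m n p.
  rewrite [LHS]comp_lfunE [LHS]comp_lfunE [RHS]comp_lfunE [RHS]comp_lfunE tassocE !tmapE.
  by rewrite !id_lfunE; apply: massocE.
- by exists (idm Aone); rewrite mcomp1m.
- by move=> M; apply: ghom_eq.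
- by move=> M; exists (idm _); rewrite mcomp1m.
Defined.
End Relative.

(** * Induction is a dominant ribbon functor *)

Section Induction.
Variables (k : fieldType) (char0 : [pchar k] =i pred0) (X : crossed_module).
Local Notation bd := (cm_bd X).
Local Notation C := (catM k X).
Local Notation A := (vacuum k X).
Local Notation idx := (vac_index X).
Local Notation "⌊ M ⌋" := (mod_obj (M : left_module A)) (M at level 99).
Local Notation und M := (gV ⌊M⌋).
Local Notation vdeg := (@vac_degree X).
Local Notation "f ♭" := (gfun (mod_mor f)) (at level 2, format "f ♭").
Local Notation T := (@tenM k char0 X).
Local Notation "m # n" := (tn char0 m n) (at level 39, left associativity).
Implicit Types M N P : Mod A.

Local Notation Aone := (@Aone k X).
Local Notation vb := (@vacb k X : idx -> und Aone).
Local Notation vone := (@vone k X).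
Local Notation mtensm := (@mtensm k char0 X _ _ _ _).
Local Notation massoc := (@massoc k char0 X).
Local Notation mlunit := (@mlunit k char0 X).
Local Notation mrunit := (@mrunit k char0 X).

Local Notation mbraid := (@mbraid k char0 X).
Local Notation mtwist := (@mtwist k X).
Local Notation nK := (nK k X).
Implicit Types V W Z : C.
Local Notation Ind := (@Ind k C _ _ A).
Local Notation "a · b" := (vac_mul k X (tprod a b)) (at level 40, left associativity).

Lemma vmulA_vac (a b c : vacV k X) : (a · b) · c = a · (b · c).
Proof.
have := congr1 (@gfun _ _ _ _) (alg_mulA A).
move/lfunP/(_ (tprod (tprod a b) c)); rewrite [LHS]comp_lfunE [RHS]comp_lfunE.
by rewrite [X in _ = X -> _]comp_lfunE tassocE !tmapE !id_lfunE.
Qed.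

Lemma vac_braid W (a : vacV k X) (w : gV W) :
  tbraid (vac_obj k X) W (tprod a w) = tprod w a.
Proof.
rewrite (vac_dec a) tprod_suml tprod_sumr linear_sum; apply: eq_bigr => q _.
rewrite tprodZl tprodZr linearZ /= (tbraidE _ (vac_homog k q)) vac_degreeK.
by rewrite gQ1E.
Qed.

Lemma vmulC_vac (a b : vacV k X) : a · b = b · a.
Proof.
have := congr1 (@gfun _ _ _ _) (alg_mulC A).
move/lfunP/(_ (tprod a b)); rewrite [LHS]comp_lfunE => <-; congr (fun_of_lfun _ _).
by rewrite [LHS]vac_braid.
Qed.

Lemma vmul1_vac (a : vacV k X) : vone · a = a.
Proof.
have := congr1 (@gfun _ _ _ _) (alg_mul1m A).
move/lfunP/(_ (tprod (1 : k^o) a)); rewrite [LHS]comp_lfunE tmapE id_lfunE tlunitE.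
by rewrite scale1r vac_oneE scale1r.
Qed.

Lemma rho_ind V q (a : vacV k X) (v : gV V) :
  rho (Ind V) q (tprod a v) = tprod (vacb k q · a) v.
Proof. by rewrite rhoE /= /free_act /= comp_lfunE tassociE tmapE id_lfunE. Qed.

Lemma ind_tn_ext V W (U : vectType k) (f g : 'Hom(und (T (Ind V) (Ind W)), U)) :
  (forall p q u u' (v : gV V) (w : gV W), homog u v -> homog u' w ->
     f ((tprod (vacb k p) v : und (Ind V)) # (tprod (vacb k q) w : und (Ind W)))
     = g ((tprod (vacb k p) v : und (Ind V)) # (tprod (vacb k q) w : und (Ind W)))) -> f = g.
Proof.
move=> e; apply: tn_ext => s t.
suff /lfunP/(_ s) : (f \o (tpr char0 _ _ \o tprodR _ t) = g \o (tpr char0 _ _ \o tprodR _ t))%VF.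
  by rewrite [LHS]comp_lfunE [RHS]comp_lfunE [(_ \o _)%VF s]comp_lfunE tprodRE.
apply: vac_tens_homog_ext => p u v hv.
rewrite [LHS]comp_lfunE [RHS]comp_lfunE [(_ \o tprodR _ _)%VF _]comp_lfunE tprodRE.
suff /lfunP/(_ t) : (f \o (tpr char0 _ _ \o tprodL _ (tprod (vacb k p) v : und (Ind V))) =
    g \o (tpr char0 _ _ \o tprodL _ (tprod (vacb k p) v : und (Ind V))))%VF.
  by rewrite [LHS]comp_lfunE [RHS]comp_lfunE [(_ \o _)%VF t]comp_lfunE tprodLE.
apply: vac_tens_homog_ext => q u' w hw.
rewrite [LHS]comp_lfunE [RHS]comp_lfunE [(_ \o tprodL _ _)%VF _]comp_lfunE tprodLE.
exact: e hv hw.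
Qed.

Definition tswap (U V : vectType k) : 'Hom(tensV U V, tensV V U) :=
  tlift (fun u v => tprod v u).
Lemma tswapE (U V : vectType k) u v : tswap U V (tprod u v) = tprod v u.
Proof.
rewrite /tswap tliftE //; split=> [w|w] a x y; first exact: tprodPr.
exact: tprodPl.
Qed.

Section IndTens.
Variables V W : C.
Fact ind_tens_lin :
  {F : 'Hom(tensV (und (Ind V)) (und (Ind W)), und (Ind ((V : C) ⊗ W))) |
    forall (a b : vacV k X) (v : gV V) (w : gV W),
    F (tprod (tprod a v) (tprod b w)) = tprod (a · b) (tprod v w)}.
Proof.
exists (tmap (vac_mul k X) \1 \o tassoci _ _ _ \o tmap \1 (tassoc _ _ _)
  \o tmap \1 (tmap (tswap _ _) \1) \o tmap \1 (tassoci _ _ _) \o tassoc _ _ _)%VF.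
move=> a b v w; do 5! rewrite [LHS]comp_lfunE.
by rewrite !(tassocE, tmapE, tassociE, tswapE, id_lfunE).
Qed.
Let F := sval ind_tens_lin.
Let FE := svalP ind_tens_lin.
Fact ind_tens_balanced : balanced (M := Ind V) (N := Ind W) F.
Proof.
move=> q s t; suff /lfunP/(_ (tprod s t)) : (F \o tmap (rho (Ind V) q) \1 =
    F \o tmap \1 (rho (Ind W) q))%VF.
  by rewrite [LHS]comp_lfunE [RHS]comp_lfunE !tmapE !id_lfunE.
apply: tens_ext => {}s {}t; suff /lfunP/(_ s) : (F \o tmap (rho (Ind V) q) \1 \o tprodR _ t =
    F \o tmap \1 (rho (Ind W) q) \o tprodR _ t)%VF.
  by rewrite [LHS]comp_lfunE [RHS]comp_lfunE tprodRE.
apply: tens_ext => a v; rewrite [LHS]comp_lfunE [RHS]comp_lfunE tprodRE.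
suff /lfunP/(_ t) : (F \o tmap (rho (Ind V) q) \1 \o tprodL _ (tprod a v : und (Ind V)) =
    F \o tmap \1 (rho (Ind W) q) \o tprodL _ (tprod a v : und (Ind V)))%VF.
  by rewrite [LHS]comp_lfunE [RHS]comp_lfunE tprodLE.
apply: tens_ext => b w; rewrite [LHS]comp_lfunE [RHS]comp_lfunE tprodLE.
rewrite [LHS]comp_lfunE [RHS]comp_lfunE !tmapE !id_lfunE !rho_ind !FE.
by rewrite (vmulC_vac _ a) vmulA_vac.
Qed.
(** The isomorphism of [(A ⊗ V) ⊗_A (A ⊗ W)] with [A ⊗ (V ⊗ W)] multiplies the two factors
    [A]. *)
Definition ind_tensf : 'Hom(und (T (Ind V) (Ind W)), und (Ind ((V : C) ⊗ W))) :=
  tdesc char0 (M := Ind V) (N := Ind W) F.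
Lemma ind_tensfE (a b : vacV k X) (v : gV V) (w : gV W) :
  ind_tensf ((tprod a v : und (Ind V)) # (tprod b w : und (Ind W))) =
  tprod (a · b) (tprod v w).
Proof. by rewrite [LHS](tdescE _ _ _ ind_tens_balanced) FE. Qed.

Lemma homog_vmul u v (a b : vacV k X) : homog (V := vac_obj k X) u a ->
  homog (V := vac_obj k X) v b -> homog (V := vac_obj k X) (u * v)%g (a · b).
Proof. by move=> ha hb; apply: (ghom_homog (vac_mulm k X)); apply: homog_tprod. Qed.

Lemma gQ_vmul g (a b : vacV k X) :
  gQ (vac_obj k X) g (a · b) = gQ (vac_obj k X) g a · gQ (vac_obj k X) g b.
Proof. by rewrite -[LHS](ghomQ (vac_mulm k X)) [X in vac_mulm _ _ X]tensQE. Qed.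

Lemma mod_mk M N (f : 'Hom(und M, und N)) :
  (forall j, f \o mod_op M j = mod_op N j \o f)%VF -> {g : Mor M N | g♭ = f}.
Proof. by move=> e; apply: cid; apply: mod_full. Qed.

Lemma homog_ind Z q u (z : gV Z) : homog u z ->
  homog (V := ⌊Ind Z⌋) (vdeg q * u)%g (tprod (vacb k q) z).
Proof. exact: (homog_tprod (V := vac_obj k X) (vac_homog k q)). Qed.
Lemma gQ_ind Z g (a : vacV k X) (z : gV Z) :
  gQ ⌊Ind Z⌋ g (tprod a z) = tprod (gQ (vac_obj k X) g a) (gQ Z g z).
Proof. exact: (tensQE (V := vac_obj k X)). Qed.

Fact ind_tens_subproof : {g : Mor (T (Ind V) (Ind W)) (Ind ((V : C) ⊗ W)) | g♭ = ind_tensf}.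
Proof.
apply: mod_mk => j; apply: ind_tn_ext => p q u u' v w hv hw; rewrite [LHS]comp_lfunE [RHS]comp_lfunE.
rewrite ind_tensfE; case: j => [[l|g]|r] /=; last first.
- by rewrite tn_rho !rho_ind ind_tensfE [RHS](rho_ind (V := gtens V W)) vmulA_vac.
- rewrite tnQ !gQ_ind ind_tensfE -gQ_vmul [RHS](gQ_ind (Z := gtens V W)).
  by congr (tprod _ _); rewrite [RHS]tensQE.
rewrite (homogP _ (tn_homog char0 (homog_ind p hv) (homog_ind q hw))).
have hab := homog_tprod (V := vac_obj k X) (W := gtens V W)
  (homog_vmul (vac_homog k p) (vac_homog k q)) (homog_tprod hv hw).
have -> : (vdeg p * u * (vdeg q * u') = vdeg p * vdeg q * (u * u'))%g.
  by rewrite -!mulgA; congr (_ * _)%g; rewrite (mulgA u) vdeg_central -mulgA.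
rewrite [RHS](homogP _ hab).
by case: eqP => _; rewrite ?linear0 // ind_tensfE.
Qed.
Definition ind_tens : Mor (T (Ind V) (Ind W)) (Ind ((V : C) ⊗ W)) := sval ind_tens_subproof.
Lemma ind_tensE (a b : vacV k X) (v : gV V) (w : gV W) :
  ind_tens♭ ((tprod a v : und (Ind V)) # (tprod b w : und (Ind W))) =
  tprod (a · b) (tprod v w).
Proof. by rewrite /ind_tens (svalP ind_tens_subproof) ind_tensfE. Qed.

Fact ind_tens_iso : is_iso ind_tens.
Proof.
pose G : 'Hom(tensV (vacV k X) (tensV (gV V) (gV W)), und (T (Ind V) (Ind W))) :=
  (tpr char0 (Ind V) (Ind W) \o tmap \1 (tprodL (gV W) (vone : vacV k X)) \o tassoci _ _ _)%VF.
have GE a v w : G (tprod a (tprod v w)) = (tprod a v : und (Ind V)) # (tprod vone w : und (Ind W)).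
  by rewrite [LHS]comp_lfunE tassociE [LHS]comp_lfunE tmapE id_lfunE tprodLE.
apply: (@mod_iso k X _ _ ind_tens G) => s.
  suff /lfunP/(_ s) : (G \o ind_tens♭ = \1)%VF by rewrite [LHS]comp_lfunE id_lfunE.
  apply: ind_tn_ext => p q u u' v w hv hw; rewrite [LHS]comp_lfunE ind_tensE id_lfunE GE.
  rewrite vmulC_vac -rho_ind tn_balanced rho_ind.
  by rewrite vmulC_vac vmul1_vac.
suff /lfunP/(_ s) : (ind_tens♭ \o G = \1)%VF by rewrite [LHS]comp_lfunE id_lfunE.
apply: tens_ext3r => a v w; rewrite [LHS]comp_lfunE GE ind_tensE id_lfunE.
by rewrite vmulC_vac vmul1_vac.
Qed.
End IndTens.

Lemma gQ_bd_vac m q : gQ (vac_obj k X) (bd m) (vacb k q) = vacb k q.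
Proof. by rewrite [LHS]vextE -/(vact _ _) vact_bd. Qed.

Lemma ind_mapE V W (f : Mor V W) (a : vacV k X) v :
  (fmap Ind f)♭ (tprod a v) = tprod a (gfun f v).
Proof. by rewrite [LHS]tmapE id_lfunE. Qed.

Fact ind_tens_nat V V' W W' (f : Mor V V') (g : Mor W W') :
  ind_tens V' W' ∘ mtensm (fmap Ind f) (fmap Ind g) = fmap Ind (f ⊠ g) ∘ ind_tens V W.
Proof.
apply: mod_eq; apply: ind_tn_ext => p q u u' v w hv hw.
rewrite [LHS]mod_compE [RHS]mod_compE mtensmE !ind_mapE !ind_tensE ind_mapE.
by congr (tprod _ _); rewrite [RHS]tmapE.
Qed.

Lemma ind_tn_ext3 V W Z (U : vectType k) (f g : 'Hom(und (T (T (Ind V) (Ind W)) (Ind Z)), U)) :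
  (forall p v q w r z,
     f (((tprod (vacb k p) v : und (Ind V)) # (tprod (vacb k q) w : und (Ind W)))
          # (tprod (vacb k r) z : und (Ind Z)))
     = g (((tprod (vacb k p) v : und (Ind V)) # (tprod (vacb k q) w : und (Ind W)))
          # (tprod (vacb k r) z : und (Ind Z)))) -> f = g.
Proof.
move=> e; apply: tn_ext => s t.
suff /lfunP/(_ t) : (f \o (tpr char0 _ _ \o tprodL _ s) =
    g \o (tpr char0 _ _ \o tprodL _ s))%VF.
  by rewrite [LHS]comp_lfunE [RHS]comp_lfunE [(_ \o _)%VF t]comp_lfunE tprodLE.
apply: vac_tens_extl => r z.
rewrite [LHS]comp_lfunE [RHS]comp_lfunE [(_ \o tprodL _ _)%VF _]comp_lfunE tprodLE.
suff /lfunP/(_ s) : (f \o (tpr char0 _ _ \o tprodR _ (tprod (vacb k r) z : und (Ind Z))) =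
    g \o (tpr char0 _ _ \o tprodR _ (tprod (vacb k r) z : und (Ind Z))))%VF.
  by rewrite [LHS]comp_lfunE [RHS]comp_lfunE [(_ \o _)%VF s]comp_lfunE tprodRE.
apply: ind_tn_ext => p q u u' v w hv hw.
rewrite [LHS]comp_lfunE [RHS]comp_lfunE [(_ \o tprodR _ _)%VF _]comp_lfunE tprodRE.
exact: e.
Qed.

Fact ind_tens_assoc V W Z :
  fmap Ind (assoc V W Z) ∘ ind_tens (V ⊗ W) Z ∘ mtensm (ind_tens V W) (idm (Ind Z)) =
  ind_tens V (W ⊗ Z) ∘ mtensm (idm (Ind V)) (ind_tens W Z) ∘ massoc (Ind V) (Ind W) (Ind Z).
Proof.
apply: mod_eq; apply: ind_tn_ext3 => p v q w r z.
rewrite [LHS]mod_compE [LHS]mod_compE [RHS]mod_compE [RHS]mod_compE.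
rewrite mtensmE massocE mtensmE !mod_idE !ind_tensE ind_mapE vmulA_vac.
by congr (tprod _ _); rewrite [LHS]tassocE.
Qed.

Fact ind_one_subproof : {g : Mor Aone (Ind 𝟙) | g♭ = tprodR (W := k^o) (vacV k X) 1}.
Proof.
apply: mod_mk => j; apply: vac_ext => q; rewrite [LHS]comp_lfunE [RHS]comp_lfunE.
rewrite !tprodRE; case: j => [[l|g]|r] /=; last first.
- by rewrite rho_one [RHS](rho_ind (V := gone k X)) vac_mulE.
- by rewrite [RHS](tensQE (V := vac_obj k X) (W := gone k X)) id_lfunE.
rewrite (homogP (V := vac_obj k X) _ (vac_homog k q)).
rewrite [RHS](tensPE (V := vac_obj k X) (W := gone k X) _ (vac_homog k q) (homog_one X _)).
by rewrite mulg1; case: eqP => _; rewrite ?tprod0l.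
Qed.
Definition ind_one : Mor Aone (Ind 𝟙) := sval ind_one_subproof.
Lemma ind_oneE (a : vacV k X) : ind_one♭ a = tprod a (1 : k^o).
Proof. by rewrite /ind_one (svalP ind_one_subproof) tprodRE. Qed.

Fact ind_one_iso : is_iso ind_one.
Proof.
apply: (@mod_iso k X _ _ ind_one (trunit (vacV k X))) => s; first by rewrite ind_oneE trunitE scale1r.
suff /lfunP/(_ s) : (ind_one♭ \o trunit (vacV k X) = \1)%VF.
  by rewrite [LHS]comp_lfunE id_lfunE.
apply: tens_ext => a c; rewrite [LHS]comp_lfunE trunitE ind_oneE id_lfunE.
by rewrite tprodZl -tprodZr -scale1o.
Qed.

Fact ind_lunit V : fmap Ind (lunit V) ∘ ind_tens 𝟙 V ∘ mtensm ind_one (idm (Ind V)) =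
  mlunit (Ind V).
Proof.
apply: mod_eq; apply: vac_tn_ext => q s.
suff /lfunP/(_ s) : ((fmap Ind (lunit V) ∘ ind_tens 𝟙 V ∘ mtensm ind_one (idm (Ind V)))♭ \o
    (tpr char0 Aone (Ind V) \o tprodL _ (vb q)) = (mlunit (Ind V))♭ \o
    (tpr char0 Aone (Ind V) \o tprodL _ (vb q)))%VF.
  by rewrite [LHS]comp_lfunE [RHS]comp_lfunE [(_ \o tprodL _ _)%VF s]comp_lfunE tprodLE.
apply: tens_ext => a v; rewrite [LHS]comp_lfunE [RHS]comp_lfunE.
rewrite [(_ \o tprodL _ _)%VF _]comp_lfunE tprodLE -/(_ # _).
rewrite [LHS]mod_compE [LHS]mod_compE mtensmE mod_idE.
rewrite mlunitE rho_ind ind_oneE ind_tensE ind_mapE; congr (tprod _ _).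
by rewrite [LHS]tlunitE scale1r.
Qed.

Fact ind_runit V : fmap Ind (runit V) ∘ ind_tens V 𝟙 ∘ mtensm (idm (Ind V)) ind_one =
  mrunit (Ind V).
Proof.
apply: mod_eq; apply: tn_vac_ext => q s.
suff /lfunP/(_ s) : ((fmap Ind (runit V) ∘ ind_tens V 𝟙 ∘ mtensm (idm (Ind V)) ind_one)♭ \o
    (tpr char0 (Ind V) Aone \o tprodR _ (vb q)) = (mrunit (Ind V))♭ \o
    (tpr char0 (Ind V) Aone \o tprodR _ (vb q)))%VF.
  by rewrite [LHS]comp_lfunE [RHS]comp_lfunE [(_ \o tprodR _ _)%VF s]comp_lfunE tprodRE.
apply: tens_ext => a v; rewrite [LHS]comp_lfunE [RHS]comp_lfunE.
rewrite [(_ \o tprodR _ _)%VF _]comp_lfunE tprodRE -/(_ # _).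
rewrite [LHS]mod_compE [LHS]mod_compE mtensmE mod_idE.
rewrite mrunitE rho_ind ind_oneE ind_tensE ind_mapE vmulC_vac; congr (tprod _ _).
by rewrite [LHS]trunitE scale1r.
Qed.

Fact ind_braid V W : fmap Ind (braid V W) ∘ ind_tens V W =
  ind_tens W V ∘ mbraid (Ind V) (Ind W).
Proof.
apply: mod_eq; apply: ind_tn_ext => p q u u' v w hv hw.
rewrite [LHS]mod_compE [RHS]mod_compE.
rewrite (mbraidE char0 _ (homog_ind p hv)) ind_tensE ind_mapE gQ_ind ind_tensE bd_vdegM.
rewrite gQ_bd_vac vmulC_vac; congr (tprod _ _).
exact: tbraidE.
Qed.

Fact ind_twist V : fmap Ind (twist V) = mtwist (Ind V).
Proof.
apply: mod_eq; apply: vac_tens_homog_ext => p u v hv.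
rewrite (mtwistE (homog_ind p hv)) ind_mapE [gfun _ _](ttwistE hv) gQ_ind bd_vdegM.
by rewrite gQ_bd_vac.
Qed.

Definition ind_ribbon : @ribbon_functor k C (Mod A) _ _ _ (mod_monoidal char0 X)
    (mod_braided char0 X) (mod_ribbon char0 X) Ind :=
  @RibbonFunctor k C (Mod A) _ _ _ (mod_monoidal char0 X) (mod_braided char0 X)
    (mod_ribbon char0 X) Ind ind_tens ind_one ind_tens_iso ind_one_iso ind_tens_nat
    ind_tens_assoc ind_lunit ind_runit ind_braid ind_twist.

(** The action map splits by [m ↦ #|K|^-1 \sum p ⊗ p^* m]. *)
Lemma ind_dominant : dominant Ind.
Proof.
move=> M; have [p pE] := ind_adj_mor (idm (⌊M⌋ : C)).
pose f : 'Hom(und M, und (Ind ⌊M⌋)) := tprodL (und M) (vone : vacV k X).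
have fE v : f v = tprod (vone : vacV k X) v by rewrite tprodLE.
have fP u v : f (gP ⌊M⌋ u v) = gP ⌊Ind ⌊M⌋⌋ u (f v).
  suff /lfunP/(_ v) : (f \o gP ⌊M⌋ u = gP ⌊Ind ⌊M⌋⌋ u \o f)%VF.
    by rewrite [LHS]comp_lfunE [RHS]comp_lfunE.
  apply: homog_ext => w m hm; rewrite [LHS]comp_lfunE [RHS]comp_lfunE.
  rewrite !fE (homogP _ hm) [RHS](tensPE _ (vone_homog k X) hm) mul1g.
  by case: eqP => _; rewrite ?tprod0r.
have fQ g v : f (gQ ⌊M⌋ g v) = gQ ⌊Ind ⌊M⌋⌋ g (f v) by rewrite !fE gQ_ind [gQ (vac_obj k X) _ _]gQ_vone.
have [|i iE] := @mod_full k X M (Ind ⌊M⌋) (nK^-1 *: vavg f).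
  move=> j; apply/lfunP=> v; rewrite [LHS]comp_lfunE [RHS]comp_lfunE !scale_lfunE.
  rewrite linearZ; congr (_ *: _); case: j => [[u|g]|q] /=.
  - exact: vavg_gP fP u v.
  - exact: vavg_gQ fQ g v.
  - exact: (@vavg_rho k X M (Ind ⌊M⌋) f q v).
exists ⌊M⌋, i, p; apply: mod_eq; apply/lfunP=> v; rewrite mod_compE mod_idE iE pE.
rewrite scale_lfunE linearZ vavgE linear_sum /=.
transitivity (nK^-1 *: \sum_q rho M q (rho M (vinv q) v)); last first.
  by rewrite rho_casimir scalerA mulVf ?scale1r // nK_neq0.
congr (_ *: _); apply: eq_bigr => q _; rewrite fE rho_ind vmulC_vac vmul1_vac.
by rewrite ind_adjE id_lfunE.
Qed.
End Induction.

(** * Quantum traces over the vacuum *)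

Lemma ltr_sum (k : fieldType) (V : vectType k) I (r : seq I) (P : pred I) (F : I -> 'End(V)) :
  ltr (\sum_(i <- r | P i) F i) = \sum_(i <- r | P i) ltr (F i).
Proof. exact: linear_sum. Qed.

Section EndUnit.
Variables (k : fieldType) (char0 : [pchar k] =i pred0) (X : crossed_module).
Local Notation act := (cm_act X).
Local Notation A := (vacuum k X).
Local Notation idx := (vac_index X).
Local Notation "⌊ M ⌋" := (mod_obj (M : left_module A)) (M at level 99).
Local Notation und M := (gV ⌊M⌋).
Local Notation vdeg := (@vac_degree X).
Local Notation "f ♭" := (gfun (mod_mor f)) (at level 2, format "f ♭").
Local Notation "m # n" := (tn char0 m n) (at level 39, left associativity).
Implicit Types M N P : Mod A.

Local Notation Aone := (@Aone k X).
Local Notation vb := (@vacb k X : idx -> und Aone).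
Local Notation vone := (@vone k X).
Local Notation mtensm := (@mtensm k char0 X _ _ _ _).

Local Notation mbraid := (@mbraid k char0 X).
Local Notation mtwist := (@mtwist k X).
Local Notation nK := (nK k X).
Local Notation mdual := (@mdual k X).
Local Notation mev := (@mev k char0 X).
Local Notation mcoev := (@mcoev k char0 X).

Lemma vac_coord (c : idx -> k) (F : idx -> idx) p : injective F ->
  (\sum_q c q *: vacb k (F q) : vacV k X) (F p) = c p.
Proof.
move=> Fi; rewrite sum_ffunE (bigD1 p) //= !ffunE eqxx big1 ?addr0.
  by rewrite /GRing.scale /= mulr1.
by move=> q ne; rewrite !ffunE (inj_eq Fi) eq_sym (negbTE ne) scaler0.
Qed.

Lemma vac_coord_Q g (a : vacV k X) p :
  (gQ (vac_obj k X) g a : vacV k X) (vact g p) = (a : {ffun _ -> k}) p.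
Proof.
rewrite -(vac_coord a p (@vact_inj X g)); congr (fun_of_fin _ _).
rewrite [in LHS](vac_dec a) linear_sum; apply: eq_bigr => q _.
by rewrite linearZ /= vextE.
Qed.

Lemma vac_coord_homog u (a : vacV k X) p : homog (V := vac_obj k X) u a ->
  u != vdeg p -> (a : {ffun _ -> k}) p = 0.
Proof.
move=> ha ne; rewrite -ha /= [in X in vacP k u X](vac_dec a) linear_sum sum_ffunE big1 // => q _.
rewrite linearZ /= ffunE [vacP _ _ _](homogP (V := vac_obj k X) _ (vac_homog k q)).
case: eqP => [e|_]; rewrite !ffunE ?scaler0 //.
by case: eqP => [e'|_]; rewrite ?scaler0 //; case/eqP: ne; rewrite e e'.
Qed.

Lemma vone_coord c : (vone : vacV k X) (1%g, c) = 1.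
Proof.
rewrite sum_ffunE (bigD1 c) //= ffunE eqxx big1 ?addr0 // => d ne.
by rewrite ffunE; case: eqP => // -[e]; rewrite e eqxx in ne.
Qed.

(** The image of the unit element is invariant and of degree [1]. The group [X1] permutes the
    points of [C] transitively, and an element of [K] of degree [1] is trivial, so only the
    multiples of the unit element have these properties. *)
Lemma end_vone (f : Mor Aone Aone) :
  f♭ vone = (f♭ vone : vacV k X) (1%g, 1%g) *: vone.
Proof.
apply/ffunP=> -[x c]; rewrite [RHS]ffunE; case: (eqVneq x 1%g) => [->|ne].
  rewrite vone_coord [RHS]mulr1.
  have -> : ((1%g, c) : idx) = vact (repr c) (1%g, 1%g).
    by rewrite /vact mulg1; congr (_, _); rewrite [RHS](coset_reprK c).
  by rewrite -{1}(gQ_vone k (repr c)) ghomQ [LHS]vac_coord_Q.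
have ne' : 1%g != vdeg (x, c).
  apply: contra_neq ne => /esym e; apply: val_inj.
  by apply: (act_inj act (repr c)^-1%g); rewrite [LHS]e /= cm_act_1.
rewrite (vac_coord_homog (ghom_homog _ (vone_homog k X)) ne') (vac_coord_homog (vone_homog k X) ne').
by rewrite [RHS]mulr0.
Qed.

Lemma mod_scaleE M N a (f : Mor M N) v : (a *: f)♭ v = a *: f♭ v.
Proof. by rewrite -scale_lfunE. Qed.

Lemma end_unit_mod : bijective (fun c : k => c *: idm Aone).
Proof.
exists (fun f : Mor Aone Aone => (f♭ vone : vacV k X) (1%g, 1%g) : k) => [c|f].
  by rewrite mod_scaleE mod_idE [LHS]ffunE vone_coord; apply: mulr1.
apply: mod_eq; apply: vac_ext => q; rewrite [LHS](@mod_scaleE Aone Aone _ _ (vb q)) mod_idE.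
have := homrho f q vone; rewrite (rho_vone k q) => ->.
by rewrite {2}end_vone linearZ /= (rho_vone k q).
Qed.

(** The twist and the braiding contribute the actions of [∂u] and of its inverse. *)
Lemma ev_braid_twist M (y : und M) (phi : und (mdual M)) :
  (mev M)♭ ((mbraid M (mdual M))♭ ((mtwist M)♭ y # phi)) =
  \sum_p (phi : 'Hom(und M, k^o)) (rho M (vinv p) y) *: vb p.
Proof.
suff /lfunP/(_ y) : ((mev M)♭ \o (mbraid M (mdual M))♭ \o
    (tpr char0 M (mdual M) \o tprodR _ phi) \o (mtwist M)♭ =
    \sum_p (linfun (scalev (vb p)) \o ((phi : 'Hom(und M, k^o)) \o rho M (vinv p))))%VF.
  do 3! rewrite [LHS]comp_lfunE; rewrite [(_ \o tprodR _ _)%VF _]comp_lfunE tprodRE => ->.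
  rewrite sum_lfunE; apply: eq_bigr => p _.
  by rewrite [LHS]comp_lfunE lfunE /= [in LHS]comp_lfunE.
apply: (homog_ext (V := ⌊M⌋)) => u {}y hy; do 3! rewrite [LHS]comp_lfunE.
rewrite [(_ \o tprodR _ _)%VF _]comp_lfunE tprodRE (mtwistE hy) -/(_ # _).
rewrite (mbraidE char0 _ (ttwist_homog hy)) mevE sum_lfunE; apply: eq_bigr => p _.
by rewrite mdual_Q rhoQ_bd gQK [RHS]comp_lfunE [X in _ = _ X]comp_lfunE [RHS]lfunE.
Qed.

Local Notation qtr := (@qtrace k (Mod A) (mod_monoidal char0 X) (mod_braided char0 X)
  (mod_ribbon char0 X) _).
Definition nC : k := #|[set: coset_of (cmI X)]|%:R.
Lemma nC_neq0 : nC != 0.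
Proof. exact: (natr_card_neq0 char0 [set: coset_of (cmI X)]%G). Qed.

(** The quantum trace is a scalar by [end_unit_mod]. Its value on the basis vector [vb q] is
    computed by the trace of [f] on the part of [M] over the point [q.2] of [C]; all these
    traces agree, and their sum over [C] is the trace of [f] on [M]. *)
Lemma mod_qtrace M (f : Mor M M) :
  qtr f = (ltr f♭ / (nK * nC)) *: idm Aone.
Proof.
have [co _ coK] := end_unit_mod; rewrite -[LHS]coK; congr (_ *: _).
have E q : co (qtr f) = nK^-1 * ltr (rho M (vinv q) \o f♭ \o rho M q)%VF.
  have e1 : (qtr f)♭ (vb q) = co (qtr f) *: vb q.
    by rewrite -[in LHS](coK (qtr f)) [LHS](@mod_scaleE Aone Aone _ _ (vb q)) mod_idE.
  have e2 : (qtr f)♭ (vb q) = nK^-1 *: \sum_p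
      ltr (rho M (vinv p) \o f♭ \o rho M q)%VF *: vb p.
    transitivity ((mev M ∘ mbraid M (mdual M) ∘ mtensm (mtwist M ∘ f) (idm _) ∘ mcoev M)♭ (vb q)).
      by [].
    rewrite [LHS]mod_compE [LHS]mod_compE [LHS]mod_compE mcoevE.
    rewrite !linearZ; congr (_ *: _); rewrite !linear_sum.
    under eq_bigr => i _ do rewrite /= mtensmE mod_compE mod_idE ev_braid_twist.
    rewrite exchange_big; apply: eq_bigr => p _; rewrite -scaler_suml; congr (_ *: _).
    by apply: eq_bigr => i _; rewrite dbasisE 2!comp_lfunE.
  have := congr1 (fun a : vacV k X => (a : {ffun _ -> k}) q) (etrans (esym e1) e2).
  rewrite /= ffunE [in X in X = _]ffunE eqxx => e3.
  rewrite -[LHS]mulr1 [LHS]e3 ffunE; congr (_ * _).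
  by rewrite (vac_coord (fun p => ltr (rho M (vinv p) \o f♭ \o rho M q)%VF) (F := id)).
have E1 c : ltr (f♭ \o rho M (1%g, c))%VF = nK * co (qtr f).
  rewrite (E (1%g, c)) mulrA mulfV ?nK_neq0 // mul1r [RHS]ltr_comm comp_lfunA [RHS]ltr_comm.
  congr (ltr (_ \o _)%VF); apply/lfunP=> v; rewrite comp_lfunE rhoM /= eqxx.
  by rewrite /vmul /vinv /= mul1g invg1.
have -> : ltr f♭ = nC * (nK * co (qtr f)).
  rewrite -[in LHS](comp_lfun1r f♭).
  have -> : (\1 : 'End(und M))%VF = (\sum_c rho M (1%g, c))%VF.
    by apply/lfunP=> v; rewrite id_lfunE sum_lfunE rho1.
  rewrite comp_lfun_sumr ltr_sum; under eq_bigr => c _ do rewrite E1.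
  by rewrite sumr_const -cardsT -[LHS]mulr_natl.
by rewrite mulrCA mulrA [_ * co _]mulrC mulfK // mulf_neq0 ?nK_neq0 ?nC_neq0.
Qed.

End EndUnit.

(** * The operators whose traces form the S-matrix *)

Section SMatrix.
Variables (k : fieldType) (char0 : [pchar k] =i pred0) (X : crossed_module).
Local Notation X1 := (cm1 X).
Local Notation X2 := (cm2 X).
Local Notation act := (cm_act X).
Local Notation bd := (cm_bd X).
Local Notation C := (catM k X).
Local Notation A := (vacuum k X).
Local Notation idx := (vac_index X).
Local Notation "⌊ M ⌋" := (mod_obj (M : left_module A)) (M at level 99).
Local Notation und M := (gV ⌊M⌋).
Local Notation vdeg := (@vac_degree X).
Local Notation "f ♭" := (gfun (mod_mor f)) (at level 2, format "f ♭").
Implicit Types M N P : Mod A.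

Local Notation vone := (@vone k X).

Local Notation nK := (nK k X).

Definition dbraid M N : 'End(tensV (und M) (und N)) :=
  (tbraid ⌊N⌋ ⌊M⌋ \o tbraid ⌊M⌋ ⌊N⌋)%VF.
Lemma dbraidE M N u v m n : homog (V := ⌊M⌋) u m -> homog (V := ⌊N⌋) v n ->
  dbraid M N (tprod m n) =
  tprod (gQ ⌊M⌋ (bd (u * v * u^-1)%g) m) (gQ ⌊N⌋ (bd u) n).
Proof.
move=> hm hn; rewrite [LHS]comp_lfunE (tbraidE _ hm) (tbraidE _ (gQ_homog (bd u) hn)).
by rewrite cm_act_bdV.
Qed.

Definition encircle_op M N : 'End(tensV (und M) (und N)) := (ten_idem M N \o dbraid M N)%VF.

(** The partial trace over [N] of the double braiding of [M] and [N] over the vacuum. Up to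
    a constant it is the endomorphism of [M] drawn as a loop coloured by [N] that encircles
    the strand of [M]; it is natural in [M], and its trace yields the S-matrix. *)
Definition encircle M N : 'End(und M) := ptr (encircle_op M N).

Lemma dbraid_op M N j t : dbraid M N (catM_op (gtens ⌊M⌋ ⌊N⌋) j t) =
  catM_op (gtens ⌊M⌋ ⌊N⌋) j (dbraid M N t).
Proof.
have := @catM_nat k X (gtens ⌊M⌋ ⌊N⌋) (gtens ⌊M⌋ ⌊N⌋)
  (gcomp (gbraid ⌊N⌋ ⌊M⌋) (gbraid ⌊M⌋ ⌊N⌋)) j.
by move/lfunP/(_ t); rewrite [LHS]comp_lfunE [RHS]comp_lfunE.
Qed.
Lemma encircle_op_op M N j t : encircle_op M N (catM_op (gtens ⌊M⌋ ⌊N⌋) j t) =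
  catM_op (gtens ⌊M⌋ ⌊N⌋) j (encircle_op M N t).
Proof. by rewrite [LHS]comp_lfunE dbraid_op ten_idem_op [encircle_op M N t]comp_lfunE. Qed.

Lemma encircle_op_nat M M' N (f : Mor M M') :
  (encircle_op M' N \o tmap f♭ \1 = tmap f♭ \1 \o encircle_op M N)%VF.
Proof.
apply: (homog_tens_ext (V := ⌊M⌋) (W := ⌊N⌋)) => u v m n hm hn.
rewrite [LHS]comp_lfunE [RHS]comp_lfunE tmapE id_lfunE.
rewrite [LHS]comp_lfunE [X in _ = tmap _ _ X]comp_lfunE.
rewrite (dbraidE (ghom_homog _ hm) hn) (dbraidE hm hn) !ten_idemE [RHS]linearZ.
congr (_ *: _); rewrite [RHS]linear_sum; apply: eq_bigr => p _.
by rewrite /= tmapE id_lfunE -ghomQ homrho.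
Qed.

Lemma encircle_op_rho M N q :
  (encircle_op M N \o tmap (rho M q) \1 = tmap (rho M q) \1 \o encircle_op M N)%VF.
Proof.
apply: (homog_tens_ext (V := ⌊M⌋) (W := ⌊N⌋)) => u v m n hm hn.
rewrite [LHS]comp_lfunE [RHS]comp_lfunE tmapE id_lfunE.
rewrite [LHS]comp_lfunE [X in _ = tmap _ _ X]comp_lfunE.
rewrite (dbraidE (rho_homog q hm) hn) (dbraidE hm hn) !ten_idemE [RHS]linearZ.
have -> : (vdeg q * u * v * (vdeg q * u)^-1 = u * v * u^-1)%g.
  by rewrite invMg !mulgA; apply: (mulIg (vdeg q)); rewrite mulgKV vdeg_central !mulgA.
congr (_ *: _); rewrite [RHS]linear_sum; apply: eq_bigr => p _.
by rewrite /= tmapE id_lfunE bd_vdegM -rhoQ_bd rho_comm.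
Qed.

Lemma encircle_nat M M' N (f : Mor M M') : (f♭ \o encircle M N = encircle M' N \o f♭)%VF.
Proof. by rewrite -ptr_compl -encircle_op_nat ptr_compr. Qed.

Section PtrEquivariant.
Variables (V W : C) (f : 'End(tensV (gV V) (gV W))).
Hypothesis fop : forall j t, f (catM_op (gtens V W) j t) = catM_op (gtens V W) j (f t).

(** The action of [g] on [V] alone is the action on [V ⊗ W] after that of [g^-1] on [W],
    which the partial trace absorbs by cyclicity. *)
Lemma ptr_gQ g : (ptr f \o gQ V g = gQ V g \o ptr f)%VF.
Proof.
rewrite -ptr_compl -ptr_compr.
have fQ : (f \o tmap (gQ V g) (gQ W g) = tmap (gQ V g) (gQ W g) \o f)%VF.
  by apply/lfunP=> t; rewrite [LHS]comp_lfunE [RHS]comp_lfunE; apply: (fop (inr g)).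
have WK : (gQ W g^-1 \o gQ W g = \1)%VF by rewrite -gQM mulVg gQ1.
have WK' : (gQ W g \o gQ W g^-1 = \1)%VF by rewrite -gQM mulgV gQ1.
have e : tmap (gQ V g) \1%VF = (tmap \1 (gQ W g^-1) \o tmap (gQ V g) (gQ W g))%VF.
  by rewrite tmap_comp WK comp_lfun1l.
rewrite [in RHS]e -[in RHS]comp_lfunA -fQ [RHS]ptr_comm -[in RHS]comp_lfunA.
by rewrite tmap_comp comp_lfun1r WK'.
Qed.

Lemma tmap_gP_homog d l w t : homog (V := gtens V W) d t -> (l * w)%g <> d ->
  tmap (gP V l) (gP W w) t = 0.
Proof.
move=> ht ne; rewrite -ht.
suff /lfunP/(_ t) : (tmap (gP V l) (gP W w) \o gP (gtens V W) d = 0)%VF.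
  by rewrite [LHS]comp_lfunE zero_lfunE.
apply: homog_tens_ext => a b x y hx hy; rewrite zero_lfunE [LHS]comp_lfunE.
rewrite [X in tmap _ _ X](homogP (V := gtens V W) _ (homog_tprod hx hy)).
case: eqP => [e|_]; last by rewrite linear0.
rewrite tmapE (homogP _ hx) (homogP _ hy).
case: eqP => [el|_]; last exact: tprod0l.
case: eqP => [ew|_]; last exact: tprod0r.
by case: ne; rewrite el ew.
Qed.

(** The partial trace only sees the part of [f] that preserves the degree in [W]; as [f]
    preserves the total degree, this part preserves the degree in [V]. *)
Lemma ptr_homog u v : homog (V := V) u v -> homog (V := V) u (ptr f v).
Proof.
move=> hv; rewrite /homog [in RHS](homog_dec (ptr f v)) (bigD1 u) //= big1 ?addr0 // => l ne.
suff /lfunP/(_ v) : (gP V l \o ptr f \o gP V u = 0)%VF.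
  by rewrite [LHS]comp_lfunE [LHS]comp_lfunE hv zero_lfunE.
pose Pw w : 'End(tensV (gV V) (gV W)) := tmap \1 (gP W w).
have PP w : (Pw w \o Pw w)%VF = Pw w by rewrite /Pw tmap_comp comp_lfun1l gP_orth eqxx.
have fE : f = (\sum_w (f \o Pw w \o Pw w))%VF.
  under eq_bigr => w _ do rewrite -comp_lfunA PP.
  rewrite -comp_lfun_sumr -[LHS]comp_lfun1r; congr (_ \o _)%VF.
  apply: tens_ext => x y; rewrite id_lfunE sum_lfunE [in LHS](homog_dec y) tprod_sumr.
  by apply: eq_bigr => w _; rewrite tmapE id_lfunE.
have -> : ptr f = (\sum_w ptr (Pw w \o f \o Pw w))%VF.
  rewrite [in LHS]fE linear_sum; apply: eq_bigr => w _.
  by rewrite -[X in ptr X = _]comp_lfunA -[in RHS]comp_lfunA ptr_comm -!comp_lfunA.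
rewrite comp_lfun_sumr comp_lfun_suml big1 // => w _.
rewrite -ptr_compl -ptr_compr -[RHS](linear0 (@ptr k (gV V) (gV V) (gV W))).
congr ptr; apply: homog_tens_ext => a b x y hx hy; rewrite zero_lfunE.
rewrite [LHS]comp_lfunE tmapE id_lfunE (homogP _ hx).
case: eqP => [e|_]; last by rewrite tprod0l linear0.
rewrite e {e} in ne *.
rewrite [LHS]comp_lfunE [X in tmap _ _ X]comp_lfunE [X in tmap _ _ X]comp_lfunE.
rewrite [X in f X]tmapE id_lfunE (homogP _ hy).
case: eqP => [e|_]; last by rewrite tprod0r !linear0.
rewrite -[LHS]comp_lfunE tmap_comp comp_lfun1l comp_lfun1r e {e}.
apply: (@tmap_gP_homog (a * b)%g).
  have := fop (inl (a * b)%g) (tprod x y).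
  by rewrite [X in f X](homog_tprod hx hy : homog (V := gtens V W) _ _) => /esym.
by move/mulIg => e; rewrite e eqxx in ne.
Qed.
End PtrEquivariant.

Lemma encircle_mor M N : exists f : Mor M M, f♭ = encircle M N.
Proof.
apply: mod_full => -[[m|g]|p].
- apply/lfunP=> v; rewrite [LHS]comp_lfunE [RHS]comp_lfunE.
  rewrite [v in RHS]homog_dec !linear_sum (bigD1 m) //= big1 ?addr0 => [|n ne].
    by apply/esym/(ptr_homog (@encircle_op_op M N)); apply: gP_homog.
  rewrite (homogP _ (ptr_homog (@encircle_op_op M N) (gP_homog n v))).
  by rewrite eq_sym (negbTE ne).
- exact: (ptr_gQ (@encircle_op_op M N)).
- by rewrite /= -ptr_compr encircle_op_rho ptr_compl.
Qed.

(** * Characters and the encircling operators *)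

(** The character of [N], on the operators [mod_B N t] that span the algebra generated by
    all [mod_op N j]. *)
Definition char N (t : idx * (X1 * X2)) : k := ltr (mod_B N t).

(** The coefficients of the encircling operator in terms of the operators of [M] are values of
    the character of [N]. *)
Lemma encircle_gP M N u : (encircle M N \o gP ⌊M⌋ u)%VF = nK^-1 *: \sum_p \sum_v
  char N (vinv p, (bd u, v)) *: (rho M p \o gQ ⌊M⌋ (bd (u * v * u^-1)%g) \o gP ⌊M⌋ u)%VF.
Proof.
rewrite -ptr_compr; transitivity (ptr (nK^-1 *: \sum_p \sum_v
    tmap (rho M p \o gQ ⌊M⌋ (bd (u * v * u^-1)%g) \o gP ⌊M⌋ u)%VF
      (mod_B N (vinv p, (bd u, v))))).
  congr ptr; apply: (homog_tens_ext (V := ⌊M⌋) (W := ⌊N⌋)) => a b m n hm hn.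
  rewrite [LHS]comp_lfunE tmapE id_lfunE (homogP _ hm) scale_lfunE sum_lfunE.
  case: (eqVneq u a) => [->|ne]; last first.
    rewrite tprod0l linear0 big1 ?scaler0 // => p _; rewrite sum_lfunE big1 // => v _.
    by rewrite tmapE [X in tprod X _]comp_lfunE (homogP _ hm) (negbTE ne) linear0 tprod0l.
  rewrite [LHS]comp_lfunE (dbraidE hm hn) ten_idemE; congr (_ *: _).
  apply: eq_bigr => p _; rewrite sum_lfunE (bigD1 b) //= big1 ?addr0 => [|v ne].
    rewrite tmapE; do 2! rewrite [X in _ = tprod X _]comp_lfunE.
    rewrite [X in _ = tprod _ X]comp_lfunE [X in _ = tprod _ (rho _ _ X)]comp_lfunE.
    by rewrite hm hn.
  rewrite tmapE [X in tprod _ X]comp_lfunE [X in tprod _ (rho _ _ X)]comp_lfunE /=.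
  by rewrite (homogP _ hn) (negbTE ne) !linear0.
rewrite linearZ linear_sum; congr (_ *: _); apply: eq_bigr => p _.
by rewrite linear_sum; apply: eq_bigr => v _; rewrite /= ptr_tmap.
Qed.

Lemma rho_fibre M p q v : q.2 = p.2 -> rho M q (rho M (vinv q) (rho M p v)) = rho M p v.
Proof.
move=> e; rewrite rhoM /= eqxx rhoM /= e eqxx; congr (rho M _ v).
by case: p e => x c /= <-; rewrite /vmul /= mulgV mul1g.
Qed.

(** On the part of [N] over the point [p.2] of [C] the operator [rho N q] is invertible. It
    shifts the degree by [vdeg q] and commutes with [rho N p] and with the action of the image
    of the boundary map; conjugation by it does not change the trace. *)
Lemma char_coset N p q u v : q.2 = p.2 ->
  char N (p, (bd u, (vdeg q * v)%g)) = char N (p, (bd u, v)).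
Proof.
move=> e; pose f w := (rho N p \o gQ ⌊N⌋ (bd u) \o gP ⌊N⌋ w)%VF.
have charE w : char N (p, (bd u, w)) = ltr (f w) by rewrite /char /mod_B /catM_B comp_lfunA.
rewrite !charE.
transitivity (ltr (rho N q \o (rho N (vinv q) \o f (vdeg q * v)%g))%VF).
  congr ltr; apply/lfunP=> w; rewrite [RHS]comp_lfunE [X in _ = _ X]comp_lfunE.
  by rewrite 2![X in _ = _ (_ X)]comp_lfunE rho_fibre // 2!comp_lfunE.
rewrite ltr_comm; congr ltr; apply/lfunP=> w.
rewrite 2![LHS]comp_lfunE 2![X in _ X = _]comp_lfunE -rhoP.
by rewrite -rhoQ_bd [rho N p _]rho_comm rho_comm rho_fibre // 2!comp_lfunE.
Qed.

(** The action of [g] moves the part of [N] over a point of [C] to the part over another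
    point, unless [g] lies in the image of the boundary map. *)
Lemma char_out N p g v : g \notin cmI X -> char N (p, (g, v)) = 0.
Proof.
move=> gI; pose e := rho N (1%g, p.2).
transitivity (ltr (e \o mod_B N (p, (g, v)))%VF).
  congr ltr; apply/lfunP=> w; rewrite [RHS]comp_lfunE [X in _ = _ X]comp_lfunE rhoM /= eqxx.
  by rewrite /vmul /= mul1g -surjective_pairing comp_lfunE.
rewrite ltr_comm; transitivity (ltr (0 : 'End(und N))); last exact: linear0.
congr ltr; apply/lfunP=> w.
rewrite 2![LHS]comp_lfunE comp_lfunE zero_lfunE Prho Qrho rhoM.
case: eqP => // /= e'; case/negP: gI.
have : coset (cmI X) g = 1%g by apply: (mulIg p.2); rewrite mul1g -e'.
by move/(coset_idr (cmI_norm g)).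
Qed.

Section Faithful.
Variables (n : nat) (L : 'I_n -> Mod A) (x : 'I_n -> k).
Hypothesis rx0 : forall M, \sum_b x b *: encircle M (L b) = 0.

Let R : Mod A := Ind A (reg_obj k X).
Let gen u g : und R := tprod (vone : vacV k X) (freeb k (u, g) : freeV k (X2 * X1)%type).

Let gen_homog u : homog (V := ⌊R⌋) u (gen u 1%g).
Proof.
rewrite -[u in homog u]mul1g; apply: (homog_tprod (vone_homog k X)).
by rewrite /homog /= /regP fextE /= cm_act1 eqxx.
Qed.
Let gQ_gen u g : gQ ⌊R⌋ g (gen u 1%g) = gen u g.
Proof. by rewrite gQ_ind [gQ (vac_obj k X) _ _]gQ_vone /= /regQ fextE /= mulg1. Qed.
Let rho_gen p u g : rho R p (gen u g) = tprod (vacb k p) (freeb k (u, g)).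
Proof. by rewrite rho_ind vmulC_vac vmul1_vac. Qed.

Let coo (p : idx) (i : X2 * X1) : 'Hom(und R, k^o) :=
  tlift (fun (a : vacV k X) (z : freeV k (X2 * X1)%type) =>
    ((a : {ffun _ -> k}) p * (z : {ffun _ -> k}) i : k^o)).
Let cooE p i q j : coo p i (tprod (vacb k q) (freeb k j)) = ((p == q) && (i == j))%:R.
Proof.
rewrite /coo tliftE; last first.
  by split=> [z|a] c y y'; rewrite !ffunE /GRing.scale /=; [rewrite mulrDl mulrA | rewrite mulrDr mulrCA].
by rewrite !ffunE -natrM mulnb.
Qed.

(** On the module induced from the regular representation the operators that occur in
    [encircle_gP] send the generator of degree [u] to distinct basis vectors, except that
    [v] only matters through the boundary of [u v u^-1]. *)
Lemma char_sum_fibre p u g :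
  \sum_(v | bd (u * v * u^-1)%g == g) \sum_b x b * char (L b) (p, (bd u, v)) = 0.
Proof.
have e : \sum_b x b *: (nK^-1 *: \sum_q \sum_v char (L b) (vinv q, (bd u, v)) *:
    (tprod (vacb k q) (freeb k (u, bd (u * v * u^-1)%g)) : und R)) = 0.
  have /lfunP/(_ (gen u 1%g)) := rx0 R; rewrite zero_lfunE sum_lfunE => e.
  rewrite -[RHS]e {e}; apply: eq_bigr => b _; rewrite [RHS]scale_lfunE; congr (_ *: _).
  rewrite -[in RHS](gen_homog u) -[RHS]comp_lfunE encircle_gP [RHS]scale_lfunE; congr (_ *: _).
  rewrite sum_lfunE; apply: eq_bigr => q _; rewrite sum_lfunE; apply: eq_bigr => v _.
  rewrite scale_lfunE; congr (_ *: _).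
  by rewrite 2!comp_lfunE gen_homog gQ_gen rho_gen.
transitivity (nK * coo (vinv p) (u, g) (\sum_b x b *: (nK^-1 *: \sum_q \sum_v
    char (L b) (vinv q, (bd u, v)) *: (tprod (vacb k q) (freeb k (u, bd (u * v * u^-1)%g)) : und R))));
  last by rewrite e linear0 mulr0.
rewrite {e} exchange_big linear_sum mulr_sumr; apply: eq_bigr => b _.
rewrite -mulr_sumr linearZ /= linearZ /= {1 2}/GRing.scale /= mulrCA mulVKf ?nK_neq0 //.
congr (_ * _); rewrite linear_sum [RHS](bigD1 (vinv p)) //= [X in _ = _ + X]big1 ?addr0 => [|q ne].
  rewrite linear_sum big_mkcond; apply: eq_bigr => v _ /=.
  rewrite linearZ /= cooE eqxx vinvK xpair_eqE eqxx /= eq_sym /GRing.scale /=.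
  by case: eqP => _; rewrite ?mulr1 ?mulr0.
by rewrite linear_sum big1 // => v _; rewrite linearZ /= cooE eq_sym (negbTE ne) scaler0.
Qed.

(** The elements [v] with a given boundary form a coset of [K], on which the characters are
    constant by [char_coset]; their number is invertible in [k]. *)
Lemma char_sum_eq0 t : \sum_b x b * char (L b) t = 0.
Proof.
case: t => p [g v0]; have [|gI] := boolP (g \in cmI X); last first.
  by rewrite big1 // => b _; rewrite char_out ?mulr0.
move=> /morphimP[u _ _ ->].
have := char_sum_fibre p u (bd (u * v0 * u^-1)%g).
rewrite (eq_bigr (fun=> \sum_b x b * char (L b) (p, (bd u, v0)))) => [|v /eqP e].
  rewrite sumr_const -mulr_natr => /eqP; rewrite mulf_eq0 => /orP[/eqP//|].
  rewrite (proj1 (pcharf0P k) char0) => /eqP/card0_eq z.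
  have : (bd (u * v0 * u^-1)%g == bd (u * v0 * u^-1)%g) = false := z v0.
  by rewrite eqxx.
have vK : (v * v0^-1)%g \in cmK X.
  have e' : bd v = bd v0.
    by move: e; rewrite !cm_bdM => /mulIg/mulgI.
  by apply/cmK_P; rewrite cm_bdM e' -cm_bdM mulgV cm_bd1.
have rK : act (v * v0^-1)%g (repr p.2) \in cmK X by rewrite cmK_act.
pose q : idx := (subg _ (act (v * v0^-1)%g (repr p.2)), p.2).
have vq : v = (vdeg q * v0)%g.
  by rewrite /vac_degree /= subgK // cm_actK mulgKV.
by apply: eq_bigr => b _; rewrite vq char_coset.
Qed.

End Faithful.
End SMatrix.

(** * Nondegeneracy of the S-matrix *)

Section Nondegenerate.
Variables (k : closedFieldType) (char0 : [pchar k] =i pred0) (X : crossed_module).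
Local Notation A := (vacuum k X).
Local Notation "⌊ M ⌋" := (mod_obj (M : left_module A)) (M at level 99).
Local Notation und M := (gV ⌊M⌋).
Local Notation "f ♭" := (gfun (mod_mor f)) (at level 2, format "f ♭").
Local Notation "m # n" := (tn char0 m n) (at level 39, left associativity).
Implicit Types M N P : Mod A.

Local Notation mbraid := (@mbraid k char0 X).
Local Notation nK := (nK k X).
Local Notation cc := (mod_concrete X char0).

(** The double braiding over the vacuum is the compression of the double braiding of vector
    spaces to the image of [ten_idem]. *)
Lemma ltr_double_braid M N : ltr (mbraid N M ∘ mbraid M N)♭ = ltr (encircle M N).
Proof.
have e : ((mbraid N M ∘ mbraid M N)♭ \o tpr char0 M N = tpr char0 M N \o dbraid M N)%VF.
  apply: (homog_tens_ext (V := ⌊M⌋) (W := ⌊N⌋)) => u v m n hm hn.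
  rewrite [LHS]comp_lfunE [RHS]comp_lfunE (dbraidE hm hn) [LHS]mod_compE.
  rewrite -/(m # n) (mbraidE char0 _ hm) (mbraidE char0 _ (gQ_homog _ hn)).
  by rewrite cm_act_bdV.
have id_tpr : (tpr char0 M N \o tinc char0 M N = \1)%VF.
  by apply/lfunP=> w; rewrite [LHS]comp_lfunE tpr_tinc id_lfunE.
set f := ((mbraid N M ∘ mbraid M N)♭) in e *.
transitivity (ltr (tpr char0 M N \o (dbraid M N \o tinc char0 M N))%VF).
  by rewrite comp_lfunA -e -comp_lfunA id_tpr comp_lfun1r.
rewrite ltr_comm ltr_ptr -comp_lfunA ltr_comm; congr ltr; apply/lfunP=> t.
by rewrite [LHS]comp_lfunE [X in X = _]comp_lfunE tinc_tpr [RHS]comp_lfunE.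
Qed.

Variables (n : nat) (L : 'I_n -> Mod A).
Hypothesis repL : simple_representatives L.

(** On a simple module the sum is a scalar by Schur's lemma, and its trace vanishes by
    assumption; the sum is natural, so that [natural_zero] covers the other modules. *)
Lemma encircle_separates x : (forall a, \sum_b ltr (encircle (L a) (L b)) * x b = 0) ->
  forall M, \sum_b x b *: encircle M (L b) = 0.
Proof.
move=> sx; pose h M : 'End(und M) := \sum_b x b *: encircle M (L b).
have nat M N (f : Mor M N) : (f♭ \o h M = h N \o f♭)%VF.
  rewrite comp_lfun_sumr comp_lfun_suml; apply: eq_bigr => b _.
  by rewrite -comp_lfunZr encircle_nat comp_lfunZl.
apply: (@natural_zero k (Mod A) cc h) => [M N f|M sM]; first exact: nat.
have [simp _ /(_ M sM)[a [f [g [gf fg]]]]] := repL.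
suff ha : h (L a) = 0.
  rewrite -[LHS]comp_lfun1l; have -> : (\1 = g♭ \o f♭ :> 'End(und M))%VF.
    by have := cc_comp cc g f; rewrite gf cc_id.
  by rewrite -comp_lfunA nat ha comp_lfun0l comp_lfun0r.
have [G hG] : exists G : Mor (L a) (L a), cc_map cc G = h (L a).
  exists (\sum_b x b *: projT1 (cid (encircle_mor (L a) (L b)))).
  rewrite linear_sum; apply: eq_bigr => b _; rewrite linearZ /=; congr (_ *: _).
  exact: projT2 (cid (encircle_mor (L a) (L b))).
have [c Gc] := schur_scalar cc G (simp a).
have hc : h (L a) = c *: \1%VF by rewrite -hG Gc linearZ -(cc_id cc).
have : ltr (h (L a)) = 0.
  rewrite linear_sum -[RHS](sx a); apply: eq_bigr => b _.
  by rewrite linearZ mulrC.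
rewrite {1}hc linearZ /= ltr1 => /eqP; rewrite mulf_eq0 (proj1 (pcharf0P k) char0).
by rewrite eqn0Ngt (simple_dim cc (simp a)) orbF hc => /eqP ->; rewrite scale0r.
Qed.

(** The orthogonality of the characters of non-isomorphic simple modules. *)
Lemma char_free x : (forall t, \sum_b x b * char (L b) t = 0) -> forall a, x a = 0.
Proof.
move=> cx a; have [simp inj _] := repL.
transitivity (\sum_t ltr (cc_A cc (L a) t) * \sum_b x b * char (L b) t); last first.
  by rewrite big1 // => t _; rewrite cx mulr0.
under eq_bigr => t _ do rewrite mulr_sumr.
rewrite exchange_big (bigD1 a) //= [X in _ = _ + X]big1 ?addr0 => [|b ne].
  under eq_bigr => t _ do rewrite mulrCA.
  by rewrite -mulr_sumr (trace_orth_eq cc (simp a)) mulr1.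
under eq_bigr => t _ do rewrite mulrCA.
rewrite -mulr_sumr (trace_orth_neq cc (simp a) (simp b)) ?mulr0 // => /inj e.
by rewrite e eqxx in ne.
Qed.

Definition smatrix : 'M[k]_n := \matrix_(a, b) (ltr (encircle (L a) (L b)) / (nK * nC k X)).

Lemma smatrix_unit : smatrix \in unitmx.
Proof.
rewrite -unitmx_tr -row_free_unit; apply: inj_row_free => x xS.
have nz : nK * nC k X != 0 by rewrite mulf_neq0 ?nK_neq0 ?nC_neq0.
apply/rowP=> b; rewrite mxE; apply: (@char_free (fun b => x 0 b)) => t.
apply: (char_sum_eq0 char0); apply: encircle_separates => a.
have /rowP/(_ a) := xS; rewrite !mxE => e; apply: (mulIf (invr_neq0 nz)).
rewrite mul0r -[RHS]e mulr_suml; apply: eq_bigr => c _.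
by rewrite !mxE [RHS]mulrA [X in _ = X / _]mulrC.
Qed.

Lemma mod_premodular : @premodular k (Mod A) (mod_monoidal char0 X).
Proof.
split; [exact: concrete_abelian cc | exact: concrete_semisimple cc
  | exact: (end_unit_mod k X) | exact: finite_simples cc].
Qed.

End Nondegenerate.

Lemma mod_modular (k : closedFieldType) (char0 : [pchar k] =i pred0) (X : crossed_module) :
  @modular k (Mod (vacuum k X)) (mod_monoidal char0 X) (mod_braided char0 X) (mod_ribbon char0 X).
Proof.
split; first exact: mod_premodular.
have [n [L repL]] := finite_simples (mod_concrete X char0).
exists n, L, (smatrix L); split; [exact: repL | move=> a b | exact: (smatrix_unit char0)].
by rewrite mod_qtrace ltr_double_braid mxE.
Qed.

Theorem proposition7 (k : closedFieldType) (char0 : [pchar k] =i pred0)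
    (X : crossed_module) :
  exists (T : monoidal (Mod (vacuum k X))) (B : braided (Mod (vacuum k X)))
      (R : ribbon (Mod (vacuum k X))),
    inhabited (relative_ribbon (vacuum k X) T B R) /\
    modularization (Ind (vacuum k X)).
Proof.
exists (mod_monoidal char0 X), (mod_braided char0 X), (mod_ribbon char0 X).
split; first exact: (inhabits (mod_relative char0 X)).
split; [exact: catM_premodular | exact: mod_modular
  | exact: (inhabits (ind_ribbon char0 X)) | exact: ind_dominant].
Qed.
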